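(* Assume that the smoothness-and-decay condition on $c_{kl}$, the taper condition, the minimal distance condition and the minimal eigenvalue condition (all stated in the context) hold. (1) Let $(x_{\mathrm{new},n})_{n\ge1}$ be a fixed sequence in $\mathbb{R}^d$. Then, as $n\to\infty$, $$\sup_{\theta\in\Theta}\left|\left[\sigma_\theta(x_{\mathrm{new},n})^{\mathsf T}\Sigma_\theta^{-1}z-Z_1(x_{\mathrm{new},n})\right]^2-\left[k_\theta(x_{\mathrm{new},n})^{\mathsf T}K_\theta^{-1}z-Z_1(x_{\mathrm{new},n})\right]^2\right|=o_p(1).$$ (2) Assume furthermore that for any fixed $\theta\in\Theta$ and $k,l\in\{1,\dots,p\}$ the functions $x\mapsto c_{kl}(x;\theta)$ and $x\mapsto t_{kl}(x)$ are continuous. Let $(D_n)$ be a sequence of measurable subsets of $\mathbb{R}^d$ with positive Lebesgue measures and let $(f_n)$ be a sequence of continuous probability density functions, $f_n$ being a density on $D_n$. Then, as $n\to\infty$, $$\sup_{\theta\in\Theta}\left|\int_{D_n}\left[\sigma_\theta(x)^{\mathsf T}\Sigma_\theta^{-1}z-Z_1(x)\right]^2f_n(x)\,dx-\int_{D_n}\left[k_\theta(x)^{\mathsf T}K_\theta^{-1}z-Z_1(x)\right]^2f_n(x)\,dx\right|=o_p(1).$$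
   Context: Notation. For $x\in\mathbb{R}^m$, $|x|=\max_i|x_i|$ and $\|x\|=\sqrt{\sum_i x_i^2}$. For a symmetric $N\times N$ matrix $A$, $\lambda_1(A)\ge\dots\ge\lambda_N(A)$ are its eigenvalues. $o_p(1)$ denotes a sequence of random variables converging to $0$ in probability as $n\to\infty$. The symbol $\circ$ is the entrywise (Schur) product of matrices and ${}^{\mathsf T}$ is transposition. Setting. Let $d,p,q\in\{1,2,\dots\}$ be fixed. Let $\{Z_k(s): s\in D\subset\mathbb{R}^d,\ k=1,\dots,p\}$ be a $p$-variate stationary Gaussian random process with zero mean, and $Z(s)=(Z_1(s),\dots,Z_p(s))^{\mathsf T}$; the domain $D$ contains all observation points and all points at which $Z_1$ is predicted. Let $\Theta=[\theta_{\inf},\theta_{\sup}]^q$ with $-\infty<\theta_{\inf}<\theta_{\sup}<+\infty$. For each $\theta\in\Theta$, $C(h;\theta)=(c_{kl}(h;\theta))_{k,l=1,\dots,p}$ is a stationary matrix covariance function on $\mathbb{R}^d$, and there exists $\theta_0\in\Theta$ with $\theta_{\inf}<\theta_{0i}<\theta_{\sup}$ for $i=1,\dots,q$ such that $C(h;\theta_0)=\mathrm{Cov}(Z(s),Z(s+h))$. Let $(t_{kl}(h))_{k,l=1,\dots,p}$ be a stationary taper matrix (covariance) function on $\mathbb{R}^d$, with $t_{kl}(h)=0$ for $\|h\|\ge1$. (A stationary matrix covariance function $(r_{kl})$ is one for which, for any finite set of points $y_1,\dots,y_m$, the $mp\times mp$ matrix with entries $r_{kl}(y_a-y_b)$ in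 row $(k,a)$ and column $(l,b)$ is symmetric and nonnegative definite.) The process is observed, all $p$ components at the same locations, at distinct points $x_1,\dots,x_n$, where $(x_a)_{a\ge1}$ is a sequence in $\mathbb{R}^d$, and $n\to\infty$. Let $\gamma_n>0$ be the taper range. For $i=(k-1)n+a$ and $j=(l-1)n+b$ with $k,l\in\{1,\dots,p\}$, $a,b\in\{1,\dots,n\}$: $z$ is the $np\times1$ vector with $z_i=Z_k(x_a)$; $\Sigma_\theta$ is the $np\times np$ covariance matrix with $(i,j)$ entry $c_{kl}(x_a-x_b;\theta)$; $T$ is the $np\times np$ taper covariance matrix with $(i,j)$ entry $t_{kl}((x_a-x_b)/\gamma_n)$; and $K_\theta=\Sigma_\theta\circ T$. For $x\in\mathbb{R}^d$, $\sigma_\theta(x)$ and $k_\theta(x)$ are the $np\times1$ vectors with, for $i=(k-1)n+a$, $$\sigma_\theta(x)_i=c_{1k}(x-x_a;\theta),\qquad k_\theta(x)_i=c_{1k}(x-x_a;\theta)\,t_{1k}\bigl((x-x_a)/\gamma_n\bigr).$$ In part (2) the continuity assumptions serve to define the integrals of random functions in the $L^2$ sense. Conditions. Smoothness-and-decay condition: for all fixed $x\in\mathbb{R}^d$ and $k,l=1,\dots,p$, $c_{kl}(x;\theta)$ is continuously differentiable with respect to $\theta$ on $\Theta$, and there exist constants $A<+\infty$ and $\alpha>0$ such that for all $k,l=1,\dots,p$, $i=1,\dots,q$, $x\in\mathbb{R}^d$, $\theta\in\Theta$, $$|c_{kl}(x;\theta)|\le\frac{A}{1+|x|^{d+\alpha}},\qquad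 \Bigl|\frac{\partial}{\partial\theta_i}c_{kl}(x;\theta)\Bigr|\le\frac{A}{1+|x|^{d+\alpha}}.$$ Taper condition: for all $k,l=1,\dots,p$, $t_{kl}$ is continuous at $0$, $t_{kl}(0)=1$ and $|t_{kl}(x)|\le1$ for all $x\in\mathbb{R}^d$; and $\gamma_n\to+\infty$ as $n\to\infty$. Minimal distance condition: there exists $\Delta>0$ such that for all $n\ge1$ and all $a\ne b$ in $\{1,\dots,n\}$, $|x_a-x_b|\ge\Delta$. Minimal eigenvalue condition: there exists $\delta>0$ such that for all $n\ge1$ and all $\theta\in\Theta$, $\lambda_{np}(\Sigma_\theta)\ge\delta$ and $\lambda_{np}(K_\theta)\ge\delta$. *)

(* Defs.v *)
From HB Require Import structures.
From mathcomp Require Import all_boot all_order all_algebra.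
From mathcomp Require Import all_classical all_reals all_analysis.
From mathcomp Require Import measurable_realfun random_variable normal_distribution.

Set Implicit Arguments.
Unset Strict Implicit.
Unset Printing Implicit Defensive.

Import Order.TTheory GRing.Theory Num.Theory.
Import numFieldNormedType.Exports.

Local Open Scope classical_set_scope.
Local Open Scope ring_scope.

(* Points of R^m are row vectors 'rV[R]_m; the library norm `|x| on them is the
   maximum of the absolute values of the entries. *)
Definition enorm (R : realType) (m : nat) (x : 'rV[R]_m) : R :=
  Num.sqrt (\sum_i x ord0 i ^+ 2).

Section lebesgue_outer.
Context (R : realType) (d : nat).
Local Notation Rd := 'rV[R]_d.+1.

Definition open_box (ab : Rd * Rd) : set Rd :=
  [set x | forall i, ab.1 ord0 i < x ord0 i < ab.2 ord0 i].

Definition box_vol (ab : Rd * Rd) : R :=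
  \prod_i Num.max 0 (ab.2 ord0 i - ab.1 ord0 i).

Definition lebesgue_outer (X : set Rd) : \bar R :=
  ereal_inf [set (\sum_(k <oo) (box_vol (ab k))%:E)%E
            | ab in [set ab : nat -> Rd * Rd |
                      X `<=` \bigcup_k open_box (ab k)]].

Lemma box_vol_ge0 ab : 0 <= box_vol ab.
Proof. by apply: prodr_ge0 => i _; rewrite le_max lexx. Qed.

Local Lemma lebesgue_outer_ge0 X : (0 <= lebesgue_outer X)%E.
Proof.
apply: le_ereal_inf_tmp => _ [ab _ <-].
by apply: nneseries_ge0 => k _ _; rewrite lee_fin box_vol_ge0.
Qed.

Local Lemma lebesgue_outer0 : lebesgue_outer set0 = 0%E.
Proof.
apply/eqP; rewrite eq_le lebesgue_outer_ge0 andbT.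
apply: ereal_inf_lbound; exists (fun=> (0, 0)); first exact: sub0set.
apply: eseries0 => k _ _; congr EFin.
by rewrite /box_vol (bigD1 ord0)//= mxE subrr maxxx mul0r.
Qed.

Local Lemma le_lebesgue_outer :
  {homo lebesgue_outer : A B / A `<=` B >-> (A <= B)%E}.
Proof.
move=> A B AB; apply/ereal_inf_le_tmp => _ [ab Bab <-].
by exists ab => //; exact: subset_trans AB Bab.
Qed.

Local Lemma lebesgue_outer_sigma_subadditive :
  sigma_subadditive lebesgue_outer.
Proof.
move=> A; have [[i ioo]|] := pselect (exists i, lebesgue_outer (A i) = +oo%E).
  rewrite (eseries_pinfty _ _ ioo) ?leey// => n _.
  by rewrite -ltNye (lt_le_trans _ (lebesgue_outer_ge0 _)).
rewrite -forallNE => Aoo.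
suff add2e (e : {posnum R}) : (lebesgue_outer (\bigcup_n A n) <=
    \sum_(i <oo) lebesgue_outer (A i) + e%:num%:E)%E.
  by apply/lee_addgt0Pr => _/posnumP[].
rewrite (le_trans _ (epsilon_trick _ _ _))//; last first.
  by move=> n; exact: lebesgue_outer_ge0.
pose P n (B : nat -> Rd * Rd) := A n `<=` \bigcup_k open_box (B k) /\
  (\sum_(k <oo) (box_vol (B k))%:E <=
     lebesgue_outer (A n) + (e%:num / (2 ^ n.+1)%:R)%:E)%E.
have [G PG] : {G : nat -> nat -> Rd * Rd & forall n, P n (G n)}.
  apply: (@choice _ _ P) => n; rewrite /P /lebesgue_outer.
  set S := (X in ereal_inf X); move infS : (ereal_inf S) => iS.
  case: iS infS => [r Sr|Soo|Soo].
  - have en1 : 0 < e%:num / (2 ^ n.+1)%:R by [].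
    have /(lb_ereal_inf_adherent en1) : ereal_inf S \is a fin_num by rewrite Sr.
    move=> [x [B AnB muBx] xS].
    by exists B; split => //; rewrite muBx -Sr; exact/ltW.
  - by have := Aoo n; rewrite /lebesgue_outer Soo.
  - suff : lbound S 0%E by move/le_ereal_inf_tmp; rewrite Soo.
    move=> /= _ [B AnB <-]; apply: nneseries_ge0 => k _ _.
    by rewrite lee_fin box_vol_ge0.
pose vG (ij : nat * nat) : \bar R := (box_vol (G ij.1 ij.2))%:E.
have vG_ge0 x : (0 <= vG x)%E by rewrite lee_fin box_vol_ge0.
apply: (@le_trans _ _ (\esum_(i in setT) vG i)%E).
  apply: ereal_inf_lbound => /=.
  have /card_esym/ppcard_eqP[f] := card_nat2.
  exists (uncurry G \o f).
    move=> t [i _ /(PG i).1 [j _ ?]]; exists (f^-1%FUN (i, j)) => //=.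
    by rewrite invK ?inE.
  transitivity (\sum_(k <oo) vG (f k))%E.
    by apply: eq_eseriesr => k _; rewrite /vG /=; case: (f k).
  rewrite -(esum_pred_image vG _ xpredT) ?[fun=> _]set_true//.
  by rewrite image_eq.
rewrite (_ : esum _ _ = \sum_(i <oo) \sum_(j <oo) (box_vol (G i j))%:E)%E;
  last first.
  pose J : nat -> set (nat * nat) := fun i => [set (i, j) | j in setT].
  rewrite (_ : setT = \bigcup_k J k); last first.
    by rewrite predeqE => -[a b]; split => // _; exists a => //; exists b.
  rewrite esum_bigcupT /=; last 2 first.
    - apply/trivIsetP => i j _ _ ij.
      rewrite predeqE => -[n m] /=; split => //= -[] [_] _ [<-{n} _].
      by move=> [m' _] [] /esym/eqP; rewrite (negbTE ij).
    - by move=> /= x.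
  rewrite -(image_id [set: nat]) -fun_true esum_pred_image//; last first.
    by move=> n _; exact: esum_ge0.
  apply: eq_eseriesr => /= j _.
  rewrite -(esum_pred_image vG (pair j) predT)//=; last first.
    by move=> ? ? _ _; exact: (@can_inj _ _ _ snd).
  by congr esum; rewrite predeqE => -[a b]; split; move=> [i _ <-]; exists i.
apply: lee_nneseries => [n _ _|n _]; last exact: (PG n).2.
by apply: nneseries_ge0 => k _ _; rewrite lee_fin box_vol_ge0.
Qed.

HB.instance Definition _ := isOuterMeasure.Build R Rd lebesgue_outer
  lebesgue_outer0 lebesgue_outer_ge0 le_lebesgue_outer
  lebesgue_outer_sigma_subadditive.

End lebesgue_outer.

(* The measurable sets of lebRd R d are the Lebesgue measurable subsets of
   R^(d+1), obtained by Caratheodory's construction. *)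
Definition lebRd (R : realType) (d : nat) :=
  caratheodory_type (@lebesgue_outer R d).
HB.instance Definition _ R d := Measurable.on (lebRd R d).

Definition lebesgue_Rd (R : realType) (d : nat) : set (lebRd R d) -> \bar R :=
  @lebesgue_outer R d.

Section lebesgue_Rd_measure.
Context (R : realType) (d : nat).
Local Notation mu := (@lebesgue_Rd R d).

Let mu0 : mu set0 = 0%E. Proof. exact: caratheodory_measure0. Qed.

Let mu_ge0 A : (0 <= mu A)%E. Proof. exact: caratheodory_measure_ge0. Qed.

Let mu_sigma_additive : semi_sigma_additive mu.
Proof. exact: caratheodory_measure_sigma_additive. Qed.

HB.instance Definition _ := isMeasure.Build _ _ _ mu
  mu0 mu_ge0 mu_sigma_additive.

End lebesgue_Rd_measure.

Section probability_notions.
Context (R : realType) (disp : measure_display) (Omega : measurableType disp).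
Variable P : probability Omega R.

(* Degenerate (almost surely constant) variables count as Gaussian; they have
   to be listed apart because normal_prob _ 0 is not a Dirac measure. *)
Definition gaussian_rv (X : Omega -> R) : Prop :=
  measurable_fun setT X /\
  ((exists m : R, {ae P, forall w, X w = m}) \/
   (exists m s : R, s != 0 /\
      forall A, measurable A -> P (X @^-1` A) = normal_prob m s A)).

Definition gaussian_process (d p : nat) (D : set 'rV[R]_d)
    (Z : 'I_p -> 'rV[R]_d -> {RV P >-> R}) : Prop :=
  forall (m : nat) (k : 'I_m -> 'I_p) (s : 'I_m -> 'rV[R]_d) (a : 'I_m -> R),
    (forall i, D (s i)) ->
    gaussian_rv (fun w => \sum_i a i * Z (k i) (s i) w).

(* X n = o_p(1) as n tends to infinity; being random variables, the X n are
   required to be measurable. *)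
Definition op1 (X : nat -> Omega -> \bar R) : Prop :=
  (forall n, measurable_fun setT (X n)) /\
  forall eps : R, 0 < eps ->
    P [set w | (eps%:E < `|X n w|)%E] @[n --> \oo] --> 0%E.

End probability_notions.

(* Bochner integral, with values in L^2(P), of the random function
   u |-> G u (.) over D with respect to mu. *)
Section L2_integral.
Context (R : realType) (disp : measure_display) (Omega : measurableType disp).
Variable P : probability Omega R.
Context (dispU : measure_display) (U : measurableType dispU).
Variable mu : {measure set U -> \bar R}.

Definition L2norm (X : Omega -> R) : \bar R := ('N[P]_2%:E [EFin \o X])%E.

Record simple_field := SimpleField {
  sf_size : nat ;
  sf_set : 'I_sf_size -> set U ;
  sf_val : 'I_sf_size -> Omega -> R ;
  sf_measurable : forall j, measurable (sf_set j) ;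
  sf_finite : forall j, (mu (sf_set j) < +oo)%E ;
  sf_L2 : forall j, sf_val j \in Lfun P 2%:E }.
Arguments sf_set : clear implicits.
Arguments sf_val : clear implicits.

Definition sf_eval (S : simple_field) (u : U) (w : Omega) : R :=
  \sum_j \1_(sf_set S j) u * sf_val S j w.

Definition sf_integral (S : simple_field) (D : set U) (w : Omega) : R :=
  \sum_j fine (mu (sf_set S j `&` D)) * sf_val S j w.

Definition L2dist (G : U -> Omega -> R) (S : simple_field) (u : U) : \bar R :=
  L2norm (fun w => G u w - sf_eval S u w).

Definition is_L2_integral (D : set U) (G : U -> Omega -> R) (I : Omega -> R) :
    Prop :=
  (forall u, D u -> G u \in Lfun P 2%:E) /\ I \in Lfun P 2%:E /\
  exists S : nat -> simple_field,
    [/\ forall m, measurable_fun D (L2dist G (S m)),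
        (\int[mu]_(u in D) L2dist G (S m) u)%E @[m --> \oo] --> 0%E &
        L2norm (fun w => I w - sf_integral (S m) D w) @[m --> \oo] --> 0%E].

End L2_integral.

Section eigenvalues.
Context (R : realType) (N : nat).

(* The eigenvalues counted with multiplicity, in nonincreasing order, when the
   characteristic polynomial splits over R (as it does for symmetric A);
   [::] otherwise. *)
Definition eigvals (A : 'M[R]_N) : seq R :=
  xget [::] [set s : seq R | sorted (fun a b => b <= a) s /\
                             char_poly A = \prod_(a <- s) ('X - a%:P)].

(* lambda A 1 >= ... >= lambda A N: indices start from 1 here. *)
Definition lambda (A : 'M[R]_N) (k : nat) : R := (eigvals A)`_k.-1.

End eigenvalues.

Section partial_derivatives.
Context (R : realType) (q : nat) (Th : set 'rV[R]_q).

(* Only increments staying in Th are used: one-sided derivatives on the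
   boundary of a box. *)
Definition partial_quot (f : 'rV[R]_q -> R) (i : 'I_q) (th : 'rV[R]_q) (h : R)
    : R :=
  h^-1 * (f (th + h *: delta_mx ord0 i) - f th).

Definition partial_filter (i : 'I_q) (th : 'rV[R]_q) : set_system R :=
  within [set h : R | Th (th + h *: delta_mx ord0 i)] (0 : R)^'.

Definition partial_on (f : 'rV[R]_q -> R) (i : 'I_q) (th : 'rV[R]_q) : R :=
  lim (partial_quot f i th h @[h --> partial_filter i th]).

Definition C1_on (f : 'rV[R]_q -> R) : Prop :=
  forall i,
    (forall th, Th th ->
       cvg (partial_quot f i th h @[h --> partial_filter i th])) /\
    {within Th, continuous (partial_on f i)}.

End partial_derivatives.

Section model.
Context (R : realType).

Definition param_box (q : nat) (tinf tsup : R) : set 'rV[R]_q :=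
  [set th | forall i, tinf <= th ord0 i <= tsup].

(* The pair (k, a) encoded by a row-major index i, that is i = k * n + a with
   indices starting from 0. *)
Definition unpair (p n : nat) (i : 'I_(p * n)) : 'I_p * 'I_n :=
  enum_val (cast_ord (esym (mxvec_cast p n)) i).

Lemma unpairK p n (k : 'I_p) (a : 'I_n) : unpair (mxvec_index k a) = (k, a).
Proof. by rewrite /unpair /mxvec_index cast_ordK enum_rankK. Qed.

Lemma mxvec_unindex p n (i : 'I_(p * n)) :
  mxvec_index (unpair i).1 (unpair i).2 = i.
Proof.
by rewrite /mxvec_index /unpair -surjective_pairing enum_valK cast_ordKV.
Qed.

Definition cov_mx (d p n : nat) (r : 'rV[R]_d -> 'M[R]_p)
    (y : 'I_n -> 'rV[R]_d) : 'M[R]_(p * n) :=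
  \matrix_(i, j) r (y (unpair i).2 - y (unpair j).2) (unpair i).1 (unpair j).1.

Definition stationary_covariance (d p : nat) (r : 'rV[R]_d -> 'M[R]_p) : Prop :=
  forall (m : nat) (y : 'I_m -> 'rV[R]_d), injective y ->
    (cov_mx r y)^T = cov_mx r y /\
    forall v : 'cV[R]_(p * m), 0 <= (v^T *m cov_mx r y *m v) ord0 ord0.

Definition schur (m n : nat) (A B : 'M[R]_(m, n)) : 'M[R]_(m, n) :=
  map2_mx *%R A B.

Context (d p q : nat).
Local Notation Rd := 'rV[R]_d.+1.
Local Notation Rq := 'rV[R]_q.+1.

(* C h th : matrix covariance function at lag h; t : matrix taper function;
   x : observation points, the first n of them being x 0, ..., x n.-1. *)
Variables (C : Rd -> Rq -> 'M[R]_p.+1) (t : Rd -> 'M[R]_p.+1).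
Variables (x : nat -> Rd) (gamma : nat -> R).

Definition Sigma (n : nat) (th : Rq) : 'M[R]_(p.+1 * n) :=
  cov_mx (C ^~ th) (fun a : 'I_n => x a).

Definition Taper (n : nat) : 'M[R]_(p.+1 * n) :=
  cov_mx (fun h => t ((gamma n)^-1 *: h)) (fun a : 'I_n => x a).

Definition K (n : nat) (th : Rq) : 'M[R]_(p.+1 * n) :=
  schur (Sigma n th) (Taper n).

Definition sigma_vec (n : nat) (th : Rq) (u : Rd) : 'cV[R]_(p.+1 * n) :=
  \col_i C (u - x (unpair i).2) th ord0 (unpair i).1.

Definition k_vec (n : nat) (th : Rq) (u : Rd) : 'cV[R]_(p.+1 * n) :=
  \col_i (C (u - x (unpair i).2) th ord0 (unpair i).1 *
          t ((gamma n)^-1 *: (u - x (unpair i).2)) ord0 (unpair i).1).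

Section predictors.
Context (disp : measure_display) (Omega : measurableType disp).
Variables (P : probability Omega R) (Z : 'I_p.+1 -> Rd -> {RV P >-> R}).

Definition obs (n : nat) (w : Omega) : 'cV[R]_(p.+1 * n) :=
  \col_i Z (unpair i).1 (x (unpair i).2) w.

(* The predicted component Z_1 is Z ord0. *)
Definition sq_err (n : nat) (th : Rq) (u : Rd) (w : Omega) : R :=
  (((sigma_vec n th u)^T *m invmx (Sigma n th) *m obs n w) ord0 ord0
     - Z ord0 u w) ^+ 2.

Definition sq_err_taper (n : nat) (th : Rq) (u : Rd) (w : Omega) : R :=
  (((k_vec n th u)^T *m invmx (K n th) *m obs n w) ord0 ord0
     - Z ord0 u w) ^+ 2.

(* A continuous version, on the parameter set Th, of the random field
   th |-> \int_D err th u f u du. An integral in the L^2 sense is only defined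
   up to a null event depending on th, so that a supremum over the uncountable
   set Th is only meaningful for such a version. *)
Definition int_err (Th : set Rq) (err : Rq -> Rd -> Omega -> R)
    (D : set Rd) (f : Rd -> R) (I : Rq -> Omega -> R) : Prop :=
  (forall th, Th th ->
     is_L2_integral P (@lebesgue_Rd R d) D (fun u w => err th u w * f u)
       (I th)) /\
  (forall w, {within Th, continuous (fun th => I th w)}).

End predictors.

Definition smoothness_decay (Th : set Rq) : Prop :=
  (forall u k l, C1_on Th (fun th => C u th k l)) /\
  exists A alpha : R, 0 < alpha /\
    forall k l i u th, Th th ->
      `|C u th k l| <= A / (1 + `|u| `^ (d.+1%:R + alpha)) /\
      `|partial_on Th (fun th => C u th k l) i th|
        <= A / (1 + `|u| `^ (d.+1%:R + alpha)).

Definition taper_condition : Prop :=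
  (forall k l,
     [/\ {for 0, continuous (fun u => t u k l)},
         t 0 k l = 1 &
         forall u, `|t u k l| <= 1]) /\
  gamma n @[n --> \oo] --> +oo.

Definition minimal_distance : Prop :=
  exists Delta : R, 0 < Delta /\
    forall (n : nat) (a b : 'I_n), a != b -> Delta <= `|x a - x b|.

Definition minimal_eigenvalue (Th : set Rq) : Prop :=
  exists delta : R, 0 < delta /\
    forall n th, (0 < n)%N -> Th th ->
      delta <= lambda (Sigma n th) (p.+1 * n) /\
      delta <= lambda (K n th) (p.+1 * n).

End model.

(* Main.v *)
Require Import Defs.
From HB Require Import structures.
From mathcomp Require Import all_boot all_order all_algebra.
From mathcomp Require Import all_classical all_reals all_analysis.
From mathcomp Require Import measurable_realfun random_variable normal_distribution.
From mathcomp Require Import ring lra.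

(** Let [a] and [b] be the vectors of prediction weights, [Sigma^-1 sigma] and
    [K^-1 k]. Both squared errors are squares of linear combinations of the data
    [z] and of the predicted variable [Z_0(u)], so that their difference factors as
    [((a - b)^T z) * ((a + b)^T z - 2 Z_0(u))]. The first factor is uniformly small,
    the second one is uniformly bounded, both in quadratic mean.

    Deterministic part. Since the observation points are separated and the
    covariances decay faster than [|h|^-(d+1)], sums of covariances along the
    points are bounded uniformly in [n] ([lattice_sum_le]), and so are the norms of
    the covariance matrices of the data, by Schur's test ([schur_test]). The lower
    bound on the eigenvalues turns this into bounds on the weights and on their
    Lipschitz constants in the parameter ([weights_bounded], [weights_lipschitz]).
    As the taper tends to [1] at each lag, it changes these sums by an amount
    tending to [0] ([taper_sum_small]), hence [|a - b|] tends to [0] uniformly in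
    the prediction point and in the parameter ([weights_taper_small]).

    Suprema over the parameter. A Gaussian variable has an exponential square
    moment at the scale of its quadratic mean ([gaussian_subg]), so that the maximum
    of [N] of them costs a factor of order [log N] only. Summed along dyadic grids
    of the box, this gives [chaining]: the expected square of the supremum of a
    Gaussian field is governed by its variance and, up to a factor that a fine
    initial grid makes small, by its Lipschitz constant in quadratic mean. Applied
    to both factors, it shows that the expected supremum of the difference of the
    squared errors tends to [0] uniformly in the prediction point
    ([squared_errors_gap]). Markov's inequality then gives the first part
    ([op1_sup]).

    Integrals. The maximum of finitely many linear combinations of integrals is a
    pairing of these integrals with random weights, which passes under the integral
    sign: a bound on expected maxima that holds at each point, relatively to the
    density, holds for the integrals ([L2_integral_max]). With
    [squared_errors_gap], this gives the second part for any continuous versions.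
    That such versions exist follows from the same principle: the expected largest
    slope of the integrals over a dyadic grid is bounded independently of the grid,
    hence almost surely the integrals are Lipschitz on the union of the grids, from
    which they are extended by continuity ([L2_integral_continuous_version]). At a
    fixed parameter, the integral is a limit of integrals of step fields, by
    continuity of the integrand in [L^2] ([L2_integral_exists]). *)

Set Implicit Arguments.
Unset Strict Implicit.
Unset Printing Implicit Defensive.

Import Order.TTheory GRing.Theory Num.Theory.
Import numFieldNormedType.Exports.

Local Open Scope classical_set_scope.
Local Open Scope ring_scope.

(** * Exponential square moments of Gaussian variables *)

Section density.
Context (R : realType).
Local Open Scope ereal_scope.

Lemma integral_normal_prob (m s : R) (g : R -> \bar R) :
  measurable_fun setT g -> (forall x, 0 <= g x) ->
  \int[normal_prob m s]_x g x =
  \int[lebesgue_measure]_x (g x * (normal_pdf m s x)%:E).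
Proof.
move=> mg g0.
pose nu : {finite_measure set _ -> \bar R} := normal_prob m s.
have numu : nu `<< @lebesgue_measure R := normal_prob_dominates m s.
rewrite -(Radon_Nikodym_SigmaFinite.change_of_variables numu g0 measurableT mg).
have iF := Radon_Nikodym_SigmaFinite.f_integrable numu.
have ipdf := integrable_normal_pdf m s.
apply: ae_eq_integral => //.
- by apply: emeasurable_funM => //; exact: measurable_int iF.
- by apply: emeasurable_funM => //; exact: measurable_int ipdf.
- have : ae_eq lebesgue_measure setT (Radon_Nikodym_SigmaFinite.f nu lebesgue_measure)
      (fun x => (normal_pdf m s x)%:E).
    apply: integral_ae_eq => //; first exact: measurable_int ipdf.
    by move=> E _ mE; rewrite -(Radon_Nikodym_SigmaFinite.f_integral numu).
  by apply: filterS => x /= /(_ I) ->.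
Qed.

(** Multiplying the density of [normal_prob m s] by this exponential gives
    [sqrt 2] times the density of [normal_prob m (sqrt 2 * s)]. *)
Lemma normal_exp_sqr (m s : R) : s != 0%R ->
  \int[normal_prob m s]_x (expR ((x - m) ^+ 2 / (4 * s ^+ 2)))%:E =
  (Num.sqrt 2)%:E.
Proof.
move=> s0; pose s' := (Num.sqrt 2 * s)%R.
have s20 : (Num.sqrt 2 : R) != 0%R by rewrite gt_eqF// sqrtr_gt0.
have s'0 : s' != 0%R by rewrite mulf_neq0.
have s'2 : (s' ^+ 2 = 2 * s ^+ 2)%R by rewrite exprMn sqr_sqrtr.
rewrite integral_normal_prob; last 2 first.
- apply/measurable_EFinP; apply: measurableT_comp => //.
  by apply: measurable_funM => //; apply: measurable_funX; exact: measurable_funB.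
- by move=> x; rewrite lee_fin expR_ge0.
transitivity (\int[lebesgue_measure]_x ((Num.sqrt 2)%:E * (normal_pdf m s' x)%:E)).
  apply: eq_integral => x _; rewrite -!EFinM; congr EFin.
  rewrite !normal_pdfE// mulrCA mulrA.
  have -> : normal_fun m s' x =
      (expR ((x - m) ^+ 2 / (4 * s ^+ 2)) * normal_fun m s x)%R.
    rewrite /normal_fun -expRD s'2; congr expR.
    by field; rewrite s0.
  have -> : normal_peak s = (Num.sqrt 2 * normal_peak s')%R.
    rewrite /normal_peak s'2 -(mulrA 2%R) -(mulrnAr 2%R) [in RHS]sqrtrM// invfM.
    by rewrite mulrA divff// mul1r.
  by ring.
rewrite integralZl//; last exact: integrable_normal_pdf.
by rewrite integral_normal_pdf mule1.
Qed.

End density.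

Section nonneg_expectation.
Context (R : realType) (disp : measure_display) (T : measurableType disp).
Variable P : probability T R.
Implicit Types f g : T -> R.

(** Expectation of a nonnegative variable: with values in [\bar R], it needs no
    integrability proof. *)
Definition EE (f : T -> R) : \bar R := (\int[P]_w (f w)%:E)%E.

Lemma EE_ge0 f : (forall w, 0 <= f w) -> (0 <= EE f)%E.
Proof. by move=> f0; apply: integral_ge0 => w _; rewrite lee_fin. Qed.

Lemma le_EE f g : measurable_fun setT f -> measurable_fun setT g ->
  (forall w, 0 <= f w) -> (forall w, f w <= g w) -> (EE f <= EE g)%E.
Proof.
move=> mf mg f0 fg; apply: ge0_le_integral => //=.
- by move=> w _; rewrite lee_fin.
- exact/measurable_EFinP.
- exact/measurable_EFinP.
- by move=> w _; rewrite lee_fin.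
Qed.

Lemma EED f g : measurable_fun setT f -> measurable_fun setT g ->
  (forall w, 0 <= f w) -> (forall w, 0 <= g w) ->
  EE (fun w => f w + g w) = (EE f + EE g)%E.
Proof.
move=> mf mg f0 g0; rewrite /EE.
under eq_integral do rewrite EFinD.
rewrite ge0_integralD//.
- by move=> w _; rewrite lee_fin.
- exact/measurable_EFinP.
- by move=> w _; rewrite lee_fin.
- exact/measurable_EFinP.
Qed.

Lemma EEZ k f : measurable_fun setT f -> (forall w, 0 <= f w) -> 0 <= k ->
  EE (fun w => k * f w) = (k%:E * EE f)%E.
Proof.
move=> mf f0 k0; rewrite /EE.
under eq_integral do rewrite EFinM.
rewrite ge0_integralZl//.
- exact/measurable_EFinP.
- by move=> w _; rewrite lee_fin.
Qed.

Lemma EE_cst k : EE (fun=> k) = k%:E.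
Proof. by rewrite /EE integral_cst//= -[X in (_ * X)%E]/(P setT) probability_setT mule1. Qed.

Lemma EE_sum (I : Type) (r : seq I) (f : I -> T -> R) :
  (forall i, measurable_fun setT (f i)) -> (forall i w, 0 <= f i w) ->
  EE (fun w => \sum_(i <- r) f i w) = (\sum_(i <- r) EE (f i))%E.
Proof.
move=> mf f0; rewrite /EE.
under eq_integral do rewrite -sumEFin.
rewrite ge0_integral_sum//.
- by move=> i; exact/measurable_EFinP.
- by move=> i w _; rewrite lee_fin.
Qed.

Lemma eq_EE f g : f =1 g -> EE f = EE g.
Proof. by move=> fg; apply: eq_integral => w _; rewrite fg. Qed.

Lemma EE_markov f (e k : R) : measurable_fun setT f -> (forall w, 0 <= f w) ->
  0 < e -> (EE f <= k%:E)%E -> (P [set w | (e < f w)%R] <= (k / e)%:E)%E.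
Proof.
move=> mf f0 e0 fk.
have mA : measurable [set w | (e < f w)%R].
  have -> : [set w | (e < f w)%R] = setT `&` f @^-1` `]e, +oo[%classic.
    by rewrite setTI; apply/seteqP; split=> w /=; rewrite in_itv/= andbT.
  exact: mf.
have -> : P [set w | (e < f w)%R] = EE (fun w => \1_([set w | (e < f w)%R]) w).
  by rewrite /EE integral_indic// setIT.
rewrite -(@lee_pmul2l _ e%:E) ?lte_fin// -EFinM mulrCA divff ?gt_eqF// mulr1.
apply: le_trans fk; rewrite -EEZ//; [|exact: measurable_indic|exact: ltW].
apply: le_EE => //.
- by apply: measurable_funM => //; exact: measurable_indic.
- by move=> w; rewrite mulr_ge0// ltW.
- move=> w; rewrite indicE; case: (boolP (_ \in _)); rewrite ?mulr0 ?mulr1//.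
  by rewrite inE => /ltW.
Qed.

End nonneg_expectation.

Section subgaussian.
Context (R : realType) (disp : measure_display) (T : measurableType disp).
Variable P : probability T R.
Implicit Types X : T -> R.

Definition subg_const : R := 2 * expR 5.

Lemma subg_const_ge1 : 1 <= subg_const.
Proof.
have : 1 + 5 <= expR 5 :> R by apply: expR_ge1Dx.
rewrite /subg_const; lra.
Qed.

(** The same bound [subg_const] serves all Gaussian variables, centered or not,
    at a scale [s] comparable with their quadratic mean. *)
Definition subg X (s : R) : Prop :=
  measurable_fun setT X /\
  (EE P (fun w => expR (X w ^+ 2 / s ^+ 2)) <= subg_const%:E)%E.

Lemma law_EE X (nu : probability (measurableTypeR R) R) (f : R -> R) :
  measurable_fun setT X ->
  (forall A, measurable A -> P (X @^-1` A) = nu A) ->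
  measurable_fun setT f -> (forall x, 0 <= f x) ->
  EE P (f \o X) = EE nu f.
Proof.
move=> mX XP mf f0; rewrite /EE.
have mX' : measurable_fun setT (X : T -> measurableTypeR R) by exact: mX.
pose Y : {RV P >-> measurableTypeR R} :=
  @mfun_Sub _ _ T (measurableTypeR R) X (mem_set mX').
have <- : (\int[distribution P Y]_y (f y)%:E)%E = (\int[P]_w ((f \o X) w)%:E)%E.
  by rewrite ge0_integral_distribution//; exact/measurable_EFinP.
apply: eq_measure_integral => A mA _.
by rewrite /distribution /= /pushforward -XP.
Qed.

(** The density is at most its peak, so that an interval of length [`|s|] carries
    at most half of the mass. *)
Lemma normal_sd_le (m s v : R) : s != 0 ->
  (EE (normal_prob m s) (fun x : R => x ^+ 2)%R <= v%:E)%E -> s ^+ 2 <= 8 * v.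
Proof.
move=> s0 H.
have s2 : 0 < `|s| by rewrite normr_gt0.
have mf : measurable_fun setT (fun x : R => x ^+ 2) by exact: measurable_funX.
pose A := [set x : R | s ^+ 2 / 4 <= x ^+ 2].
have mA : measurable A.
  by rewrite -[X in measurable X]setTI; exact: measurable_fun_le.
have nuA : (2^-1%:E <= normal_prob m s A)%E.
  have nuC : (normal_prob m s (~` A) <= 2^-1%:E)%E.
    rewrite /normal_prob.
    pose J := `]-(`|s| / 2), `|s| / 2[%classic.
    have AJ : ~` A `<=` J.
      move=> x /= /negP; rewrite -ltNge => xs.
      rewrite /J/= in_itv/= -ltr_norml -(@ltr_pXn2r _ 2)// ?nnegrE ?divr_ge0//.
      by rewrite exprMn exprVn !real_normK ?num_real// -natrX.
    apply: (@le_trans _ _ (\int[lebesgue_measure]_(x in J) (normal_pdf m s x)%:E)%E).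
      apply: ge0_subset_integral => //.
      - exact: measurableC.
      - exact: measurable_itv.
      - by apply/measurable_EFinP/measurable_funTS; exact: measurable_normal_pdf.
      - by move=> x _; rewrite lee_fin normal_pdf_ge0.
    apply: (@le_trans _ _ (\int[lebesgue_measure]_(x in J) (normal_peak s)%:E)%E).
      apply: ge0_le_integral => //; first exact: measurable_itv.
      - by move=> x _; rewrite lee_fin normal_pdf_ge0.
      - by apply/measurable_EFinP/measurable_funTS; exact: measurable_normal_pdf.
      - by move=> x _; rewrite lee_fin normal_pdf_ub.
    rewrite integral_cst//; last exact: measurable_itv.
    rewrite /= [lebesgue_measure _]lebesgue_measure_itv/= lte_fin gtrN ?divr_gt0//.
    rewrite -EFinD -EFinM lee_fin opprK -splitr.
    have pi2 := pi_ge2 R.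
    rewrite /normal_peak -(real_normK (num_real s)) -mulrnAr sqrtrM ?sqr_ge0// sqrtr_sqr normr_id.
    rewrite invfM mulrAC mulVf ?gt_eqF// mul1r lef_pV2 ?posrE//; last first.
      by rewrite sqrtr_gt0 mulrn_wgt0// pi_gt0.
    have -> : 2 = Num.sqrt (2 ^+ 2) :> R by rewrite sqrtr_sqr ger0_norm.
    by apply: ler_wsqrtr; rewrite -[X in _ <= X]mulr_natr; lra.
  have := probability_setC (normal_prob m s) mA.
  move=> CE; rewrite CE in nuC.
  have fA := @fin_num_measure _ _ _ (normal_prob m s) A mA.
  move: nuC; rewrite -(fineK fA) -EFinB !lee_fin => nuC.
  by rewrite -(fineK fA) lee_fin; lra.
have : ((s ^+ 2 / 4)%:E * 2^-1%:E <= v%:E)%E.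
  apply: le_trans H.
  apply: (@le_trans _ _ ((s ^+ 2 / 4)%:E * normal_prob m s A)%E).
    by apply: lee_wpmul2l => //; rewrite lee_fin divr_ge0// sqr_ge0.
  have -> : normal_prob m s A = EE (normal_prob m s) (\1_A).
    by rewrite /EE integral_indic// setIT.
  have s4 : 0 <= s ^+ 2 / 4 by rewrite divr_ge0// sqr_ge0.
  rewrite -EEZ//.
  apply: le_EE => //.
  - exact: measurable_funM.
  - by move=> x; rewrite mulr_ge0.
  - move=> x; rewrite indicE; case: (boolP (_ \in _)); rewrite ?mulr1 ?mulr0 ?sqr_ge0//.
    by rewrite inE.
rewrite -EFinM lee_fin; lra.
Qed.

(** The mean is the difference between [x] and [x - m]; the second moment of the
    latter is bounded by its exponential square moment, through [y <= expR y]. *)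
Lemma normal_mean_le (m s v : R) : s != 0 ->
  (EE (normal_prob m s) (fun x : R => x ^+ 2)%R <= v%:E)%E -> m ^+ 2 <= 130 * v.
Proof.
move=> s0 H; have s8 := normal_sd_le s0 H.
have s2 : 0 < s ^+ 2 by rewrite exprn_even_gt0.
have mf : measurable_fun setT (fun x : R => x ^+ 2) by exact: measurable_funX.
have mg : measurable_fun setT (fun x : R => (x - m) ^+ 2).
  by apply: measurable_funX; exact: measurable_funB.
have mh : measurable_fun setT (fun x : R => expR ((x - m) ^+ 2 / (4 * s ^+ 2))).
  by apply: measurableT_comp => //; exact: measurable_funM.
have h0 (x : R) : 0 <= expR ((x - m) ^+ 2 / (4 * s ^+ 2)) by exact: expR_ge0.
have B : (EE (normal_prob m s) (fun x => (x - m) ^+ 2)%R <= (8 * s ^+ 2)%:E)%E.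
  apply: (@le_trans _ _ (EE (normal_prob m s)
     (fun x => 4 * s ^+ 2 * expR ((x - m) ^+ 2 / (4 * s ^+ 2)))%R)).
    apply: le_EE => //; first exact: measurable_funM.
      by move=> x; exact: sqr_ge0.
    move=> x; rewrite mulrC -ler_pdivrMr; last by rewrite mulr_gt0.
    by apply: le_trans (expR_ge1Dx _); rewrite lerDr.
  rewrite EEZ//; last by rewrite mulr_ge0 ?sqr_ge0.
  rewrite /EE normal_exp_sqr// -EFinM lee_fin.
  have : Num.sqrt 2 <= 2 :> R.
    by rewrite -[leRHS](@ger0_norm _ 2)// -sqrtr_sqr ler_sqrt// expr2; lra.
  nra.
rewrite -lee_fin -(EE_cst (normal_prob m s)).
apply: (@le_trans _ _ (EE (normal_prob m s) (fun x => 2 * x ^+ 2 + 2 * (x - m) ^+ 2)%R)).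
  apply: le_EE => //.
  - by apply: measurable_funD; exact: measurable_funM.
  - by move=> _; exact: sqr_ge0.
  - move=> x; rewrite -subr_ge0.
    have -> : 2 * x ^+ 2 + 2 * (x - m) ^+ 2 - m ^+ 2 = (2 * x - m) ^+ 2 by ring.
    exact: sqr_ge0.
rewrite EED//; last 4 first.
- exact: measurable_funM.
- exact: measurable_funM.
- by move=> x; rewrite mulr_ge0 ?sqr_ge0.
- by move=> x; rewrite mulr_ge0 ?sqr_ge0.
rewrite !EEZ//; last 2 first.
- by move=> x; exact: sqr_ge0.
- by move=> x; exact: sqr_ge0.
apply: (@le_trans _ _ (2%:E * v%:E + 2%:E * (8 * s ^+ 2)%:E)%E).
  by apply: leeD; apply: lee_wpmul2l.
rewrite -!EFinM -EFinD lee_fin; lra.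
Qed.

(** A bound on the second moment controls both the mean and the deviation; the
    factor [8] makes [x ^+ 2 / (8 * v) ^+ 2] at most [5] plus the exponent of
    [normal_exp_sqr]. *)
Lemma gaussian_subg X (v : R) : gaussian_rv P X -> 0 < v ->
  (EE P (fun w => X w ^+ 2)%R <= (v ^+ 2)%:E)%E -> subg X (8 * v).
Proof.
move=> [mX HX] v0 H; split=> //.
have v2 : 0 < v ^+ 2 by rewrite exprn_gt0.
have mf : measurable_fun setT (fun x : R => x ^+ 2) by exact: measurable_funX.
pose g (x : R) := expR (x ^+ 2 / (8 * v) ^+ 2).
have mg : measurable_fun setT g.
  by apply: measurableT_comp => //; exact: measurable_funM.
have g0 x : 0 <= g x by exact: expR_ge0.
have gE (x B : R) : 0 <= B -> x ^+ 2 <= B * v ^+ 2 -> g x <= expR (B / 64).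
  move=> B0 xB; rewrite /g ler_expR ler_pdivrMr; last by rewrite exprn_gt0 ?mulr_gt0.
  by rewrite exprMn mulrA -mulrA; lra.
case: HX => [[m mE]|[m [s [s0 XP]]]].
- have XE : EE P (fun w => X w ^+ 2) = (m ^+ 2)%:E.
    rewrite -(EE_cst P (m ^+ 2)) /EE.
    apply: ae_eq_integral => //.
    + by apply/measurable_EFinP/measurable_funX.
    + by apply: filterS mE => w Xm _ /=; rewrite Xm.
  have -> : EE P (fun w => expR (X w ^+ 2 / (8 * v) ^+ 2)) = (g m)%:E.
    rewrite -(EE_cst P (g m)) /EE.
    apply: ae_eq_integral => //.
    + by apply/measurable_EFinP; exact: (measurableT_comp mg).
    + by apply: filterS mE => w Xm _ /=; rewrite Xm.
  rewrite lee_fin; move: H; rewrite XE lee_fin => H.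
  apply: (le_trans (@gE m 1 _ _)) => //; first by rewrite mul1r.
  apply: (@le_trans _ _ (expR 5)); first by rewrite ler_expR; lra.
  by rewrite /subg_const; have := expR_ge0 (5 : R); lra.
- have XE f := @law_EE X (normal_prob m s) f mX XP.
  have H2 : (EE (normal_prob m s) (fun x : R => x ^+ 2)%R <= (v ^+ 2)%:E)%E.
    by rewrite -XE// => x; exact: sqr_ge0.
  rewrite (XE g)//.
  have s8 := normal_sd_le s0 H2; have m130 := normal_mean_le s0 H2.
  have s2 : 0 < s ^+ 2 by rewrite exprn_even_gt0.
  have mh : measurable_fun setT (fun x : R => expR ((x - m) ^+ 2 / (4 * s ^+ 2))).
    apply: measurableT_comp => //; apply: measurable_funM => //.
    by apply: measurable_funX; exact: measurable_funB.
  apply: (@le_trans _ _ (EE (normal_prob m s)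
     (fun x => expR 5 * expR ((x - m) ^+ 2 / (4 * s ^+ 2)))%R)).
    apply: le_EE => //; first exact: measurable_funM.
    move=> x; rewrite -expRD ler_expR.
    have -> : x ^+ 2 / (8 * v) ^+ 2 = (x ^+ 2 / 64) / v ^+ 2.
      by field; rewrite gt_eqF.
    rewrite ler_pdivrMr//.
    set t := (x - m) ^+ 2; have t0 : 0 <= t by exact: sqr_ge0.
    have xt : x ^+ 2 <= 2 * t + 2 * m ^+ 2.
      rewrite -subr_ge0 /t.
      have -> : 2 * (x - m) ^+ 2 + 2 * m ^+ 2 - x ^+ 2 = (x - 2 * m) ^+ 2 by ring.
      exact: sqr_ge0.
    have : t / 32 <= t / (4 * s ^+ 2) * v ^+ 2.
      rewrite [leRHS]mulrAC ler_pdivlMr; last by rewrite mulr_gt0.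
      by have := mulr_ge0 t0 (eq_ind_r is_true s8 (subr_ge0 _ _)); lra.
    rewrite mulrDl; lra.
  rewrite EEZ ?expR_ge0//.
  rewrite /EE normal_exp_sqr// -EFinM lee_fin /subg_const mulrC ler_wpM2r ?expR_ge0//.
  by rewrite -[leRHS](@ger0_norm _ 2)// -sqrtr_sqr ler_sqrt// expr2; lra.
Qed.

Lemma subg_measurable_exp X (s : R) : measurable_fun setT X ->
  measurable_fun setT (fun w => expR (X w ^+ 2 / s ^+ 2)).
Proof.
move=> mX; apply: measurableT_comp => //; apply: measurable_funM => //.
exact: measurable_funX.
Qed.

Lemma sqr_le_expR (y : R) : 0 <= y -> y ^+ 2 <= 4 * expR y.
Proof.
move=> y0; have := expR_ge1Dx (y / 2).
have -> : expR y = expR (y / 2) ^+ 2 by rewrite expr2 -expRD -splitr.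
have := expR_ge0 (y / 2); nra.
Qed.

Lemma subg_pow4 X (s : R) : 0 < s -> subg X s ->
  (EE P (fun w => X w ^+ 4)%R <= (4 * s ^+ 4 * subg_const)%:E)%E.
Proof.
move=> s0 [mX Xs]; have s2 : 0 < s ^+ 2 by rewrite exprn_gt0.
have s4 : 0 < 4 * s ^+ 4 by rewrite mulr_gt0// exprn_gt0.
have me := subg_measurable_exp s mX.
apply: (@le_trans _ _ (EE P (fun w => 4 * s ^+ 4 * expR (X w ^+ 2 / s ^+ 2))%R)).
  apply: le_EE => //.
  - exact: measurable_funX.
  - exact: measurable_funM.
  - by move=> w; rewrite exprn_even_ge0.
  - move=> w.
    have y0 : 0 <= X w ^+ 2 / s ^+ 2 by rewrite divr_ge0// sqr_ge0.
    have -> : X w ^+ 4 = s ^+ 4 * (X w ^+ 2 / s ^+ 2) ^+ 2.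
      by field; rewrite gt_eqF.
    rewrite (mulrC 4) -[leRHS]mulrA ler_wpM2l//; first by rewrite exprn_ge0// ltW.
    exact: sqr_le_expR.
rewrite EEZ//; last exact: ltW.
by rewrite (EFinM (4 * s ^+ 4)); apply: lee_wpmul2l => //; rewrite lee_fin ltW.
Qed.

Lemma measurable_bigmax (I : Type) (r : seq I) (f : I -> T -> R) :
  (forall i, measurable_fun setT (f i)) ->
  measurable_fun setT (fun w => \big[Num.max/0]_(i <- r) f i w).
Proof.
move=> mf; elim: r => [|i r IH].
  by under eq_fun do rewrite big_nil; exact: measurable_cst.
by under eq_fun do rewrite big_cons; exact: measurable_maxr.
Qed.

(** The union bound for an exponential moment turns [N] variables into a cost
    logarithmic in [N], through the choice of [tau]. *)
Lemma subg_max_sqr (I : finType) (X : I -> T -> R) (s tau : R) :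
  0 < s -> 0 <= tau -> (forall i, subg (X i) s) ->
  (EE P (fun w => \big[Num.max/0]_i (X i w ^+ 2))%R <=
   (s ^+ 2 * (tau + expR (- tau) * #|I|%:R * subg_const))%:E)%E.
Proof.
move=> s0 tau0 Xs; have s2 : 0 < s ^+ 2 by rewrite exprn_gt0.
have mX i : measurable_fun setT (X i) by case: (Xs i).
have me i := subg_measurable_exp s (mX i).
have ms : measurable_fun setT
    (fun w => expR (- tau) * \sum_i expR (X i w ^+ 2 / s ^+ 2)).
  by apply: measurable_funM => //; exact: measurable_sum.
have s0' w : 0 <= \sum_i expR (X i w ^+ 2 / s ^+ 2).
  by apply: sumr_ge0 => i _; exact: expR_ge0.
apply: (@le_trans _ _ (EE P (fun w => s ^+ 2 * (tau + expR (- tau) *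
    \sum_i expR (X i w ^+ 2 / s ^+ 2)))%R)).
  apply: le_EE.
  - by apply: measurable_bigmax => i; exact: measurable_funX.
  - by apply: measurable_funM => //; exact: measurable_funD.
  - by move=> w; exact: bigmax_ge_id.
  - move=> w; apply: bigmax_le.
      by apply: mulr_ge0; [exact: ltW|rewrite addr_ge0// mulr_ge0 ?expR_ge0].
    move=> i _; rewrite mulrC -ler_pdivrMr// -lerBlDl.
    apply: (@le_trans _ _ (expR (X i w ^+ 2 / s ^+ 2 - tau))).
      by apply: le_trans (expR_ge1Dx _); rewrite lerDr.
    rewrite addrC expRD ler_wpM2l ?expR_ge0// (bigD1 i)//= lerDl.
    by apply: sumr_ge0 => j _; exact: expR_ge0.
rewrite EEZ; [| |by move=> w; rewrite addr_ge0// mulr_ge0 ?expR_ge0|exact: ltW];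
  last exact: measurable_funD.
rewrite (EFinM (s ^+ 2)); apply: lee_wpmul2l; first by rewrite lee_fin ltW.
rewrite EED//; last by move=> w; rewrite mulr_ge0 ?expR_ge0.
rewrite EE_cst EFinD; apply: leeD => //.
rewrite EEZ//; last exact: measurable_sum.
rewrite -mulrA EFinM; apply: lee_wpmul2l; first by rewrite lee_fin expR_ge0.
rewrite EE_sum//.
apply: (@le_trans _ _ (\sum_(i : I) subg_const%:E)%E).
  by apply: lee_sum => i _; case: (Xs i).
by rewrite sumEFin sumr_const lee_fin mulr_natl.
Qed.

End subgaussian.

(** * Suprema over the parameter box *)

Section row_norm.
Context (R : realType) (n : nat).
Implicit Types x : 'rV[R]_n.+1.

Lemma rv_norm_le x (r : R) : (forall i, `|x ord0 i| <= r) -> `|x| <= r.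
Proof.
move=> H; have -> : `|x| = mx_norm x by []; rewrite mx_normrE; apply: bigmax_le.
  by apply: le_trans (H ord0).
by move=> [i j] _ /=; rewrite (ord1 i); exact: H.
Qed.

Lemma le_rv_norm x i : `|x ord0 i| <= `|x|.
Proof.
have -> : `|x| = mx_norm x by []; rewrite mx_normrE.
by apply: (@le_bigmax _ _ _ (0 : R) (fun ij : 'I_1 * 'I_n.+1 => `|x ij.1 ij.2|) (ord0, i)).
Qed.

End row_norm.

Section grid.
Context (R : realType) (q : nat) (tinf tsup : R).
Hypothesis htheta : tinf < tsup.
Local Notation Rq := 'rV[R]_q.+1.
Local Notation Th := (param_box (q := q.+1) tinf tsup).
Local Notation W := (tsup - tinf).

(** The points [gpt k], for [k : gidx m], form the dyadic grid of level [m] of the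
    box. *)
Definition gidx (m : nat) := {ffun 'I_q.+1 -> 'I_(2 ^ m).+1}.

Definition gpt m (k : gidx m) : Rq :=
  \row_i (tinf + W * ((k i)%:R / 2 ^+ m)).

Lemma card_gidx m : (#|gidx m|%:R : R) <= expR ((m.+1 * q.+1)%:R).
Proof.
rewrite card_ffun !card_ord natrX.
have e2 : 2 <= expR 1 :> R by apply: le_trans (expR_ge1Dx _); rewrite -natr1.
rewrite natrM mulrC expRM_natl lerXn2r ?nnegrE ?expR_ge0//.
rewrite -[_.+1%:R in leRHS]mulr1 expRM_natl.
apply: (@le_trans _ _ (2 ^+ m.+1)); last by rewrite lerXn2r ?nnegrE ?expR_ge0.
rewrite -natrX ler_nat expnS mul2n -addnn -addn1 leq_add2l.
by rewrite expn_gt0.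
Qed.

Lemma gpt_in m (k : gidx m) : Th (gpt k).
Proof.
move=> i; rewrite !mxE.
have W0 : 0 < W by rewrite subr_gt0.
have p0 : 0 < 2 ^+ m :> R by rewrite exprn_gt0.
have H : 0 <= (k i)%:R / (2 ^+ m : R) <= 1.
  rewrite divr_ge0 ?(ltW p0)//= ler_pdivrMr// mul1r -natrX ler_nat.
  by rewrite -ltnS.
by case/andP: H => H1 H2; apply/andP; split; nra.
Qed.

(** The link of the chain from level [m.+1] to level [m]. *)
Definition gpar m (k : gidx m.+1) : gidx m := [ffun i => inord (k i)./2].

Lemma gpar_dist m (k : gidx m.+1) : `|gpt k - gpt (gpar k)| <= W / 2 ^+ m.+1.
Proof.
have W0 : 0 < W by rewrite subr_gt0.
apply: rv_norm_le => i; rewrite !mxE ffunE inordK; last first.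
  rewrite ltnS -(doubleK (2 ^ m)%N) half_leq// -muln2 -expnSr.
  by rewrite -ltnS.
have p0 : 2 ^+ m != 0 :> R by rewrite expf_neq0.
have -> : tinf + W * ((k i)%:R / 2 ^+ m.+1) -
    (tinf + W * (((k i)./2)%:R / 2 ^+ m)) =
    W / 2 ^+ m.+1 * (odd (k i))%:R.
  rewrite -{1}(odd_double_half (k i)) -muln2 natrD natrM exprS.
  by field.
rewrite normrM ger0_norm ?divr_ge0 ?exprn_ge0 ?(ltW W0)//.
rewrite ler_piMr ?divr_ge0 ?exprn_ge0 ?(ltW W0)//.
by case: odd; rewrite ?normr1 ?normr0.
Qed.

Lemma gpt_refine m (k : gidx m) : exists k' : gidx m.+1, gpt k' = gpt k.
Proof.
exists [ffun i => inord (k i).*2]; apply/rowP => i; rewrite !mxE ffunE inordK.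
  by rewrite -muln2 natrM exprS; field; rewrite expf_neq0.
by rewrite ltnS expnS mul2n leq_double -ltnS.
Qed.

Definition gfloor m (th : Rq) : gidx m :=
  [ffun i => inord (Num.truncn ((th ord0 i - tinf) / W * 2 ^+ m))].

Lemma gfloor_dist m th : Th th -> `|th - gpt (gfloor m th)| <= W / 2 ^+ m.
Proof.
have W0 : 0 < W by rewrite subr_gt0.
have p0 : 0 < 2 ^+ m :> R by rewrite exprn_gt0.
move=> hth; apply: rv_norm_le => i; rewrite !mxE ffunE.
set y := _ / _ * _; have /andP[h1 h2] := hth i.
have y0 : 0 <= y by rewrite mulr_ge0 ?divr_ge0 ?subr_ge0 ?(ltW p0)// ltW.
have y1 : y <= 2 ^+ m.
  by rewrite ler_piMl ?(ltW p0)// ler_pdivrMr// mul1r lerD2r.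
have /andP[t1 t2] := truncn_itv y0.
rewrite inordK; last first.
  by rewrite ltnS -(@ler_nat R) natrX (le_trans t1).
have -> : th ord0 i - (tinf + W * ((Num.truncn y)%:R / 2 ^+ m)) =
    W / 2 ^+ m * (y - (Num.truncn y)%:R).
  by rewrite /y; field; rewrite !gt_eqF.
rewrite normrM ger0_norm ?divr_ge0 ?(ltW W0) ?(ltW p0)//.
rewrite ler_piMr ?divr_ge0 ?(ltW W0) ?(ltW p0)//.
rewrite ger0_norm ?subr_ge0// lerBlDr.
by move: t2; rewrite -natr1 => /ltW; rewrite addrC.
Qed.

Definition gmax m (f : Rq -> R) : R := \big[Num.max/0]_(k : gidx m) f (gpt k).

Lemma gmax_ge0 m f : 0 <= gmax m f.
Proof. exact: bigmax_ge_id. Qed.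

Lemma le_gmax m f (k : gidx m) : f (gpt k) <= gmax m f.
Proof. exact: (le_bigmax _ (fun k : gidx m => f (gpt k))). Qed.

Lemma gmaxS m f : gmax m f <= gmax m.+1 f.
Proof.
apply: bigmax_le; first exact: gmax_ge0.
by move=> k _; have [k' <-] := gpt_refine k; exact: le_gmax.
Qed.

Lemma gmax_homo f : {homo (fun m => gmax m f) : m n / (m <= n)%N >-> m <= n}.
Proof.
move=> m n; elim: n => [|n IH]; first by rewrite leqn0 => /eqP ->.
rewrite leq_eqVlt => /predU1P[->//|]; rewrite ltnS => /IH mn.
exact: le_trans mn (gmaxS _ _).
Qed.

End grid.

Section chaining.
Context (R : realType) (disp : measure_display) (T : measurableType disp).
Variable P : probability T R.
Context (q : nat) (tinf tsup : R).
Hypothesis htheta : tinf < tsup.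
Local Notation Rq := 'rV[R]_q.+1.
Local Notation Th := (param_box (q := q.+1) tinf tsup).
Local Notation W := (tsup - tinf).
Local Notation gidx := (gidx q).
Local Notation gpt := (@gpt R q tinf tsup _).
Local Notation gmax := (@gmax R q tinf tsup).
Local Notation K := (subg_const R).

(** The weights [2 ^- i.+1] of this Cauchy-Schwarz inequality sum up to at most
    [1]. *)
Lemma sqr_sum_weighted (j : nat) (d : nat -> R) :
  (\sum_(i < j) d i) ^+ 2 <= \sum_(i < j) 2 ^+ i.+1 * d i ^+ 2.
Proof.
elim: j d => [|j IH] d; first by rewrite !big_ord0 expr0n.
rewrite !big_ord_recl /=.
apply: (@le_trans _ _ (2 * d 0%N ^+ 2 + 2 * (\sum_(i < j) d i.+1) ^+ 2)).
  set a := d 0%N; set b := \sum_(_ < _) _.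
  rewrite -subr_ge0.
  have -> : 2 * a ^+ 2 + 2 * b ^+ 2 - (a + b) ^+ 2 = (a - b) ^+ 2 by ring.
  exact: sqr_ge0.
rewrite expr1 lerD2l.
apply: (@le_trans _ _ (2 * \sum_(i < j) 2 ^+ i.+1 * d i.+1 ^+ 2)).
  by rewrite ler_wpM2l// (IH (fun i => d i.+1)).
rewrite mulr_sumr; apply: ler_sum => i _.
by rewrite mulrA -exprS.
Qed.

Lemma geometric_linear_sum (a b : R) (j : nat) : 0 <= a -> 0 <= b ->
  \sum_(m < j) (m.+2%:R * a + b) / 2 ^+ m <= 6 * a + 2 * b.
Proof.
move=> a0 b0.
suff -> : \sum_(m < j) (m.+2%:R * a + b) / 2 ^+ m =
    6 * a + 2 * b - ((2 * j%:R + 6) * a + 2 * b) / 2 ^+ j.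
  by rewrite gerBl divr_ge0 ?exprn_ge0// addr_ge0 ?mulr_ge0 ?addr_ge0 ?mulr_ge0.
elim: j => [|j IH]; first by rewrite big_ord0 expr0; field.
rewrite big_ord_recr /= IH exprS -(natr1 j) -(natr1 j.+1) -(natr1 j).
by field; rewrite expf_neq0.
Qed.

Definition chain_cst1 (m0 : nat) : R := 2 * ((m0.+1 * q.+1)%:R + K).
Definition chain_cst2 : R := W ^+ 2 * (6 * q.+1%:R + 2 * K).

Lemma chain_cst1_ge0 m : 0 <= chain_cst1 m.
Proof. by rewrite mulr_ge0// addr_ge0// (le_trans _ (subg_const_ge1 R)). Qed.

Lemma chain_cst2_ge0 : 0 <= chain_cst2.
Proof.
by rewrite mulr_ge0 ?sqr_ge0// addr_ge0// mulr_ge0// (le_trans _ (subg_const_ge1 R)).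
Qed.

Variables (X : Rq -> T -> R) (s L : R).
Hypotheses (s0 : 0 < s) (L0 : 0 < L).
Hypothesis Xs : forall th, Th th -> subg P (X th) s.
Hypothesis XL : forall th th' r, Th th -> Th th' -> 0 < r -> `|th - th'| <= r ->
  subg P (fun w => X th w - X th' w) (L * r).

Let inc m (w : T) : R :=
  \big[Num.max/0]_(k : gidx m.+1) (X (gpt k) w - X (gpt (gpar k)) w) ^+ 2.

Lemma card_exp m : expR (- (m.+1 * q.+1)%:R) * #|gidx m|%:R * K <= K.
Proof.
have K0 : 0 <= K by apply: le_trans (subg_const_ge1 R).
rewrite ler_piMl//.
apply: (@le_trans _ _ (expR (- (m.+1 * q.+1)%:R) * expR ((m.+1 * q.+1)%:R))).
  by rewrite ler_wpM2l ?expR_ge0// card_gidx.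
by rewrite -expRD addNr expR0.
Qed.

Lemma EE_inc m : (EE P (inc m) <=
  ((L * (W / 2 ^+ m.+1)) ^+ 2 * ((m.+2 * q.+1)%:R + K))%:E)%E.
Proof.
have W0 : 0 < W by rewrite subr_gt0.
have r0 : 0 < W / 2 ^+ m.+1 by rewrite divr_gt0// exprn_gt0.
have Lr0 : 0 < L * (W / 2 ^+ m.+1) by rewrite mulr_gt0.
apply: le_trans (@subg_max_sqr _ _ _ P (gidx m.+1)
  (fun k w => X (gpt k) w - X (gpt (gpar k)) w) (L * (W / 2 ^+ m.+1))
  ((m.+2 * q.+1)%:R) Lr0 _ _) _ => //.
  move=> k; apply: XL => //; try exact: gpt_in.
  exact: gpar_dist.
rewrite lee_fin ler_wpM2l ?sqr_ge0// lerD2l; exact: card_exp.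
Qed.

Lemma EE_base m : (EE P (fun w => gmax m (fun th => X th w ^+ 2))%R <=
  (s ^+ 2 * ((m.+1 * q.+1)%:R + K))%:E)%E.
Proof.
apply: le_trans (@subg_max_sqr _ _ _ P (gidx m)
  (fun k w => X (gpt k) w) s ((m.+1 * q.+1)%:R) s0 _ _) _ => //.
  by move=> k; apply: Xs; exact: gpt_in.
rewrite lee_fin ler_wpM2l ?sqr_ge0// lerD2l; exact: card_exp.
Qed.

Let chain_sqrt m0 j w (k : gidx (m0 + j)) :
  `|X (gpt k) w| <= Num.sqrt (gmax m0 (fun th => X th w ^+ 2)) +
    \sum_(i < j) Num.sqrt (inc (m0 + i) w).
Proof.
elim: j k => [|j IH].
  rewrite addn0 => k; rewrite big_ord0 addr0 -sqrtr_sqr ler_wsqrtr//.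
  exact: (@le_gmax _ _ _ _ m0 (fun th => X th w ^+ 2)).
rewrite addnS => k.
have -> : X (gpt k) w = X (gpt (gpar k)) w + (X (gpt k) w - X (gpt (gpar k)) w).
  by rewrite addrC subrK.
rewrite big_ord_recr /= [leRHS]addrA; apply: le_trans (ler_normD _ _) _.
apply: lerD; first exact: IH.
rewrite -sqrtr_sqr ler_wsqrtr//.
exact: (le_bigmax _ (fun k : gidx (m0 + j).+1 =>
  (X (gpt k) w - X (gpt (gpar k)) w) ^+ 2)).
Qed.

Let chain_pointwise m0 j w :
  gmax (m0 + j) (fun th => X th w ^+ 2) <=
  2 * gmax m0 (fun th => X th w ^+ 2) +
  \sum_(i < j) 2 ^+ i.+2 * inc (m0 + i) w.
Proof.
have inc0 i : 0 <= inc i w by exact: bigmax_ge_id.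
have g0 : 0 <= gmax m0 (fun th => X th w ^+ 2) by exact: gmax_ge0.
apply: bigmax_le.
  by rewrite addr_ge0 ?mulr_ge0// sumr_ge0// => i _; rewrite mulr_ge0 ?exprn_ge0.
move=> k _; have := chain_sqrt w k.
set a := Num.sqrt _; set b := \sum_(_ < _) _ => H.
apply: (@le_trans _ _ (2 * a ^+ 2 + 2 * b ^+ 2)).
  apply: (@le_trans _ _ ((a + b) ^+ 2)).
    rewrite -(real_normK (num_real (X (gpt k) w))).
    rewrite lerXn2r ?nnegrE//.
    by rewrite addr_ge0 ?sqrtr_ge0// sumr_ge0// => i _; rewrite sqrtr_ge0.
  rewrite -subr_ge0.
  have -> : 2 * a ^+ 2 + 2 * b ^+ 2 - (a + b) ^+ 2 = (a - b) ^+ 2 by ring.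
  exact: sqr_ge0.
rewrite /a sqr_sqrtr// lerD2l.
apply: (@le_trans _ _ (2 * \sum_(i < j) 2 ^+ i.+1 * Num.sqrt (inc (m0 + i) w) ^+ 2)).
  by rewrite ler_wpM2l// (sqr_sum_weighted j (fun i => Num.sqrt (inc (m0 + i) w))).
rewrite mulr_sumr; apply: ler_sum => i _.
by rewrite sqr_sqrtr// mulrA -exprS.
Qed.

Let mX th : Th th -> measurable_fun setT (X th).
Proof. by move=> /Xs[]. Qed.

Lemma measurable_gmax m (f : Rq -> T -> R) :
  (forall th, Th th -> measurable_fun setT (f th)) ->
  measurable_fun setT (fun w => gmax m (fun th => f th w)).
Proof.
move=> mf; apply: measurable_bigmax => k; apply: mf; exact: gpt_in.
Qed.

(** Dudley-type bound along the dyadic chain: the base level costs the size [s]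
    of the variables, the finer levels only their Lipschitz constant [L]. *)
Theorem chaining m0 m :
  (EE P (fun w => gmax m (fun th => X th w ^+ 2))%R <=
   (chain_cst1 m0 * s ^+ 2 + chain_cst2 * L ^+ 2 / 2 ^+ m0)%:E)%E.
Proof.
have W0 : 0 < W by rewrite subr_gt0.
have K0 : 0 <= K by apply: le_trans (subg_const_ge1 R).
have mX2 th : Th th -> measurable_fun setT (fun w => X th w ^+ 2).
  by move=> /mX ?; exact: measurable_funX.
have minc i : measurable_fun setT (inc i).
  apply: measurable_bigmax => k; apply: measurable_funX.
  by apply: measurable_funB; apply: mX; exact: gpt_in.
have inc0 i w : 0 <= inc i w by exact: bigmax_ge_id.
apply: (@le_trans _ _ (EE P (fun w => gmax (m0 + m)%N (fun th => X th w ^+ 2))%R)).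
  apply: le_EE => //.
  - exact: measurable_gmax.
  - exact: measurable_gmax.
  - by move=> w; exact: gmax_ge0.
  - by move=> w; apply: gmax_homo; rewrite leq_addl.
have ms : measurable_fun setT (fun w => \sum_(i < m) 2 ^+ i.+2 * inc (m0 + i) w).
  by apply: measurable_sum => i; exact: measurable_funM.
have ms0 w : 0 <= \sum_(i < m) 2 ^+ i.+2 * inc (m0 + i) w.
  by apply: sumr_ge0 => i _; rewrite mulr_ge0 ?exprn_ge0.
have mg : measurable_fun setT (fun w => gmax m0 (fun th => X th w ^+ 2)).
  exact: measurable_gmax.
apply: (@le_trans _ _ (EE P (fun w => 2 * gmax m0 (fun th => X th w ^+ 2) +
    \sum_(i < m) 2 ^+ i.+2 * inc (m0 + i) w)%R)).
  apply: le_EE => //.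
  - exact: measurable_gmax.
  - by apply: measurable_funD => //; exact: measurable_funM.
  - by move=> w; exact: gmax_ge0.
have g0 w : 0 <= gmax m0 (fun th => X th w ^+ 2) by exact: gmax_ge0.
rewrite EED//; [|exact: measurable_funM|by move=> w; rewrite mulr_ge0].
rewrite EEZ// (EFinD (chain_cst1 m0 * s ^+ 2)); apply: leeD.
  rewrite /chain_cst1 -mulrA (EFinM 2); apply: lee_wpmul2l => //.
  by rewrite mulrC; exact: EE_base.
rewrite EE_sum//; [|by move=> i; exact: measurable_funM|
  by move=> i w; rewrite mulr_ge0 ?exprn_ge0].
pose b (i : nat) := (i.+2%:R * q.+1%:R + K) / 2 ^+ i.
have b0 i : 0 <= b i by rewrite divr_ge0 ?exprn_ge0// addr_ge0// mulr_ge0.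
pose c := (L * W) ^+ 2 / 2 ^+ m0.
have c0 : 0 <= c by rewrite divr_ge0 ?sqr_ge0 ?exprn_ge0.
apply: (@le_trans _ _ (\sum_(i < m) (c * b (m0 + i)%N)%:E)%E).
  apply: lee_sum => i _; rewrite EEZ ?exprn_ge0//.
  apply: (@le_trans _ _ ((2 ^+ i.+2)%:E * ((L * (W / 2 ^+ (m0 + i).+1)) ^+ 2 *
      (((m0 + i).+2 * q.+1)%:R + K))%:E)%E).
    by apply: lee_wpmul2l; [rewrite lee_fin exprn_ge0|exact: EE_inc].
  rewrite -EFinM lee_fin /c /b natrM.
  rewrite le_eqVlt; apply/orP; left; apply/eqP.
  rewrite !exprS exprD.
  by field; rewrite !expf_neq0.
rewrite sumEFin lee_fin -mulr_sumr.
have H : \sum_(i < m) b (m0 + i)%N <= 6 * q.+1%:R + 2 * K.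
  apply: le_trans (geometric_linear_sum (m0 + m) (ler0n R q.+1) K0).
  apply: (@le_trans _ _ (\sum_(i < m0) b i + \sum_(i < m) b (m0 + i)%N)).
    by rewrite lerDr sumr_ge0.
  by rewrite big_split_ord.
apply: (@le_trans _ _ (c * (6 * q.+1%:R + 2 * K))); first by rewrite ler_wpM2l.
rewrite le_eqVlt /chain_cst2 /c; apply/orP; left; apply/eqP.
by field; rewrite expf_neq0.
Qed.

End chaining.

Section cvge0.
Context (R : realType).

Lemma cvge0_small (u : nat -> \bar R) : (forall n, (0 <= u n)%E) ->
  (forall e : R, 0 < e -> exists N, forall n, (N <= n)%N -> (u n <= e%:E)%E) ->
  u n @[n --> \oo] --> 0%E.
Proof.
move=> u0 H; apply/fine_cvgP; split.
  have [N HN] := H _ ltr01; exists N => // n /= /HN un.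
  by rewrite ge0_fin_numE// (le_lt_trans un)// ltry.
apply/cvgrPdist_le => e e0; have [N HN] := H _ e0.
exists N => // n /= /HN un; rewrite sub0r normrN ger0_norm ?fine_ge0//.
by rewrite -lee_fin fineK// ge0_fin_numE// (le_lt_trans un)// ltry.
Qed.

Lemma cvge0_le (u : nat -> \bar R) : (forall n, (0 <= u n)%E) ->
  u n @[n --> \oo] --> 0%E ->
  (forall e : R, 0 < e -> exists N, forall n, (N <= n)%N -> (u n <= e%:E)%E).
Proof.
move=> u0 /fine_cvgP[[N1 _ H1] /cvgrPdist_le H2] e e0.
have [N2 _ HN2] := H2 _ e0; exists (maxn N1 N2) => n.
rewrite geq_max => /andP[n1 n2]; have := HN2 n n2.
rewrite /= sub0r normrN ger0_norm ?fine_ge0// -lee_fin fineK//.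
exact: H1.
Qed.

End cvge0.

Section sup_over_box.
Context (R : realType) (disp : measure_display) (T : measurableType disp).
Variable P : probability T R.
Context (q : nat) (tinf tsup : R).
Hypothesis htheta : tinf < tsup.
Local Notation Rq := 'rV[R]_q.+1.
Local Notation Th := (param_box (q := q.+1) tinf tsup).
Local Notation W := (tsup - tinf).
Local Notation gmax := (@gmax R q tinf tsup).

Lemma continuous_within_dist (f : Rq -> R) (A : set Rq) th (e : R) :
  {within A, continuous f} -> A th -> 0 < e ->
  exists2 d : R, 0 < d & forall th', A th' -> `|th - th'| < d -> `|f th - f th'| < e.
Proof.
move=> cf Ath e0.
have := (subspace_continuousP _ _).1 cf th Ath.
move=> /cvgrPdist_lt /(_ _ e0) /nbhs_ballP[d d0 H].
exists d => // th' Ath' dth; apply: (H th') => //.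
by rewrite -ball_normE.
Qed.

(** Continuity reduces the supremum to a countable one, which is measurable. *)
Lemma ereal_sup_gmax (f : Rq -> R) : {within Th, continuous f} ->
  ereal_sup [set `|f th|%:E | th in Th] =
  ereal_sup (range (fun m => (gmax m (fun th => `|f th|))%:E)).
Proof.
move=> cf; have W0 : 0 < W by rewrite subr_gt0.
apply/eqP; rewrite eq_le; apply/andP; split.
- apply: ge_ereal_sup => _ [th hth <-]; apply/lee_addgt0Pr => e e0.
  have [d d0 Hd] := continuous_within_dist cf hth e0.
  have [m Hm] : exists m, W / 2 ^+ m < d.
    have /cvgrPdist_lt /(_ _ d0) [N _ HN] : W / 2 ^+ n @[n --> \oo] --> (0 : R).
      rewrite -[X in _ --> X](mulr0 W); apply: cvgMr.
      under eq_fun do rewrite -exprVn.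
      by apply: cvg_expr; rewrite ger0_norm// invf_lt1// ltr1n.
    exists N; have := HN N (leqnn _).
    by rewrite sub0r normrN ger0_norm// divr_ge0 ?exprn_ge0 ?ltW.
  apply: (@le_trans _ _ ((gmax m (fun th => `|f th|))%:E + e%:E)%E); last first.
    by apply: leeD2r; apply: ereal_sup_ubound; exists m.
  rewrite -EFinD lee_fin.
  have := @le_gmax _ _ tinf tsup m (fun th => `|f th|) (gfloor tinf tsup m th).
  have : `|f th - f (gpt tinf tsup (gfloor tinf tsup m th))| < e.
    apply: Hd; first exact: gpt_in.
    by apply: le_lt_trans Hm; exact: gfloor_dist.
  set y := f (gpt _ _ _); move=> H1 H2.
  have : `|f th| <= `|f th - y| + `|y| by rewrite -{1}(subrK y (f th)) ler_normD.
  lra.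
- apply: ge_ereal_sup => _ [m _ <-].
  rewrite /gmax; elim/big_ind : _ => [|a b|k _].
  + apply: (@le_trans _ _ `|f (gpt tinf tsup (gfloor tinf tsup m 0))|%:E).
      by rewrite lee_fin.
    apply: ereal_sup_ubound.
    by exists (gpt tinf tsup (gfloor tinf tsup m 0)) => //; exact: gpt_in.
  + by case: (leP a b).
  + by apply: ereal_sup_ubound; exists (gpt tinf tsup k) => //; exact: gpt_in.
Qed.

(** Markov's inequality holds on each grid with the same bound, and the events
    increase with the level of the grid. *)
Lemma op1_sup (V : nat -> Rq -> T -> R) :
  (forall n th, Th th -> measurable_fun setT (V n th)) ->
  (forall n w, {within Th, continuous (fun th => V n th w)}) ->
  (forall e : R, 0 < e -> exists N, forall n, (N <= n)%N -> forall m,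
     (EE P (fun w => gmax m (fun th => `|V n th w|))%R <= e%:E)%E) ->
  op1 P (fun n w => ereal_sup [set `|V n th w|%:E | th in Th]).
Proof.
move=> mV cV HV.
have supE n : (fun w => ereal_sup [set `|V n th w|%:E | th in Th]) =
    (fun w => ereal_sup (range (fun m => (gmax m (fun th => `|V n th w|))%:E))).
  by apply/funext => w; exact: ereal_sup_gmax.
have mg n m : measurable_fun setT (fun w => gmax m (fun th => `|V n th w|)).
  by apply: (measurable_gmax htheta) => th hth; apply: measurableT_comp => //; exact: mV.
split=> [n|eps eps0].
  rewrite supE.
  have -> : (fun w => ereal_sup (range (fun m => (gmax m (fun th => `|V n th w|))%:E))) =
      (fun w => esups (fun m => (gmax m (fun th => `|V n th w|))%:E) 0).
    apply/funext => w; rewrite /esups /sdrop; congr ereal_sup.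
    by apply/seteqP; split=> y [m _ <-]; exists m.
  apply: (@measurable_fun_esups _ _ _ _ (fun m w => (gmax m (fun th => `|V n th w|))%:E) _ 0).
  by move=> m; exact/measurable_EFinP.
apply: cvge0_small => // e e0.
have [N HN] := HV (e * eps) (mulr_gt0 e0 eps0).
exists N => n Nn.
pose B m := [set w | (eps < gmax m (fun th => `|V n th w|))%R].
have mB m : measurable (B m).
  have -> : B m = setT `&` (fun w => gmax m (fun th => `|V n th w|)) @^-1` `]eps, +oo[%classic.
    by rewrite setTI; apply/seteqP; split=> w /=; rewrite in_itv/= andbT.
  exact: mg.
have ndB : {homo B : m m' / (m <= m')%N >-> (m <= m')%O}.
  move=> m m' mm'; apply/subsetPset => w /= Bw; apply: (lt_le_trans Bw).
  exact: gmax_homo.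
have -> : [set w | (eps%:E < `|ereal_sup [set `|V n th w|%:E | th in Th]|)%E] =
    \bigcup_m B m.
  apply/seteqP; split=> w /=.
    have -> : ereal_sup [set `|V n th w|%:E | th in Th] =
        ereal_sup (range (fun m => (gmax m (fun th => `|V n th w|))%:E)).
      exact: ereal_sup_gmax.
    rewrite gee0_abs; last first.
      apply: (@le_trans _ _ (gmax 0 (fun th => `|V n th w|))%:E).
        by rewrite lee_fin gmax_ge0.
      by apply: ereal_sup_ubound; exists 0%N.
    move=> /ereal_sup_gt[_ [m _ <-]]; rewrite lte_fin => Bm.
    by exists m.
  move=> [m _ Bm]; rewrite ereal_sup_gmax//.
  rewrite gee0_abs; last first.
    apply: (@le_trans _ _ (gmax 0 (fun th => `|V n th w|))%:E).
      by rewrite lee_fin gmax_ge0.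
    by apply: ereal_sup_ubound; exists 0%N.
  apply: (@lt_le_trans _ _ (gmax m (fun th => `|V n th w|))%:E); first by rewrite lte_fin.
  by apply: ereal_sup_ubound; exists m.
have cB := nondecreasing_cvg_mu (mu := P) mB (bigcupT_measurable _ mB) ndB.
rewrite -(cvg_lim _ cB)//; apply: lime_le.
  by apply/cvg_ex; exists (P (\bigcup_n0 B n0)).
apply: nearW => m /=.
have -> : e%:E = (e * eps / eps)%:E by rewrite mulfK// gt_eqF.
by apply: EE_markov => //; [move=> w; exact: gmax_ge0|exact: HN].
Qed.

End sup_over_box.

(** * Quadratic forms bounded below *)

Lemma cvg_sumR (R : realType) (T : Type) (F : set_system T) (FF : Filter F)
    (I : Type) (r : seq I) (f : I -> T -> R) (a : I -> R) :
  (forall i, f i x @[x --> F] --> a i) ->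
  \sum_(i <- r) f i x @[x --> F] --> \sum_(i <- r) a i.
Proof. by move=> H; apply: cvg_big => //; exact: add_continuous. Qed.

Section quadratic_forms.
Context (R : realType).

Definition sqn (m n : nat) (A : 'M[R]_(m, n)) : R := \sum_i \sum_j A i j ^+ 2.

Lemma sqn_ge0 m n (A : 'M[R]_(m, n)) : 0 <= sqn A.
Proof. by apply: sumr_ge0 => i _; apply: sumr_ge0 => j _; exact: sqr_ge0. Qed.

Lemma sqn_tr m n (A : 'M[R]_(m, n)) : sqn A^T = sqn A.
Proof.
rewrite /sqn exchange_big; apply: eq_bigr => i _; apply: eq_bigr => j _.
by rewrite mxE.
Qed.

Lemma sqnZ m n (a : R) (A : 'M[R]_(m, n)) : sqn (a *: A) = a ^+ 2 * sqn A.
Proof.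
rewrite /sqn mulr_sumr; apply: eq_bigr => i _; rewrite mulr_sumr.
by apply: eq_bigr => j _; rewrite mxE exprMn.
Qed.

Lemma sqn_row n (v : 'rV[R]_n) : sqn v = (v *m v^T) ord0 ord0.
Proof.
rewrite /sqn big_ord1 mxE; apply: eq_bigr => j _.
by rewrite mxE expr2.
Qed.

Lemma sqn_col n (v : 'cV[R]_n) : sqn v = \sum_i v i ord0 ^+ 2.
Proof. by apply: eq_bigr => i _; rewrite big_ord1. Qed.

Lemma sqn_eq0 m n (A : 'M[R]_(m, n)) : sqn A = 0 -> A = 0.
Proof.
move=> /psumr_eq0P A0; apply/matrixP => i j; rewrite mxE.
have Ai : \sum_j A i j ^+ 2 = 0.
  by apply: A0 => // k _; apply: sumr_ge0 => l _; exact: sqr_ge0.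
have := psumr_eq0P (fun k _ => sqr_ge0 (A i k)) Ai.
by move=> /(_ j isT) /eqP; rewrite expf_eq0 => /andP[_ /eqP].
Qed.

Lemma sqnD_le m n (A B : 'M[R]_(m, n)) : sqn (A + B) <= 2 * sqn A + 2 * sqn B.
Proof.
rewrite /sqn !mulr_sumr -big_split; apply: ler_sum => i _ /=.
rewrite !mulr_sumr -big_split; apply: ler_sum => j _ /=.
rewrite mxE -subr_ge0.
have -> : 2 * A i j ^+ 2 + 2 * B i j ^+ 2 - (A i j + B i j) ^+ 2 =
  (A i j - B i j) ^+ 2 by ring.
exact: sqr_ge0.
Qed.

Lemma sqnN m n (A : 'M[R]_(m, n)) : sqn (- A) = sqn A.
Proof. by rewrite -scaleN1r sqnZ sqrrN expr1n mul1r. Qed.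

Lemma sqnB_le m n (A B : 'M[R]_(m, n)) : sqn (A - B) <= 2 * sqn A + 2 * sqn B.
Proof. by rewrite -(sqnN B) sqnD_le. Qed.

Lemma addmxE m n (A B : 'M[R]_(m, n)) i j : (A + B) i j = A i j + B i j.
Proof. by rewrite mxE. Qed.

Lemma scalemxE m n a (A : 'M[R]_(m, n)) i j : (a *: A) i j = a * A i j.
Proof. by rewrite mxE. Qed.

(** The form is nonnegative at [c + t *: (c *m M)] for all [t], and the term of
    first order in [t] is twice the squared norm of [c *m M]. *)
Lemma psd_kernel n (M : 'M[R]_n) (c : 'rV[R]_n) : M^T = M ->
  (forall v : 'rV[R]_n, 0 <= (v *m M *m v^T) ord0 ord0) ->
  (c *m M *m c^T) ord0 ord0 = 0 -> c *m M = 0.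
Proof.
move=> symM psd c0; pose w := c *m M; apply: sqn_eq0; rewrite -/w.
pose S := sqn w; pose q := (w *m M *m w^T) ord0 ord0.
have S0 : 0 <= S by exact: sqn_ge0.
have q0 : 0 <= q by exact: psd.
have Q t : 0 <= 2 * t * S + t ^+ 2 * q.
  have := psd (c + t *: w).
  have -> : ((c + t *: w) *m M *m (c + t *: w)^T) =
      c *m M *m c^T + t *: (w *m w^T) + t *: (w *m M *m c^T) +
      t ^+ 2 *: (w *m M *m w^T).
    rewrite linearD linearZ /= !mulmxDl !mulmxDr -!scalemxAl -!scalemxAr.
    by rewrite scalerA addrA.
  have -> : w *m M *m c^T = w *m w^T.
    by rewrite /w trmx_mul symM !mulmxA.
  rewrite !addmxE !scalemxE -sqn_row -/S -/q c0; lra.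
apply/eqP; rewrite eq_le S0 andbT leNgt; apply/negP => Spos.
have q1 : 0 < 1 + q by rewrite ltr_pwDl.
have := Q (- S / (1 + q)).
have -> : 2 * (- S / (1 + q)) * S + (- S / (1 + q)) ^+ 2 * q =
   - (S ^+ 2 * (2 + q) / (1 + q) ^+ 2).
  by field; rewrite gt_eqF.
rewrite oppr_ge0 leNgt divr_gt0 ?exprn_gt0// mulr_gt0 ?exprn_gt0//.
by rewrite ltr_pwDl.
Qed.

Lemma continuous_quadratic n (M : 'M[R]_n) :
  continuous (fun v : 'rV[R]_n => (v *m M *m v^T) ord0 ord0 : R).
Proof.
have -> : (fun v : 'rV[R]_n => (v *m M *m v^T) ord0 ord0 : R) =
    (fun v => \sum_j (\sum_i v ord0 i * M i j) * v ord0 j).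
  apply/funext => v; rewrite mxE; apply: eq_bigr => j _; rewrite !mxE.
  by congr (_ * _).
move=> v; apply: (@cvg_sumR _ _ (nbhs v) (nbhs_filter v)) => j.
apply: cvgM; last exact: coord_continuous.
apply: (@cvg_sumR _ _ (nbhs v) (nbhs_filter v)) => i.
by apply: cvgM; [exact: coord_continuous|exact: cvg_cst].
Qed.

(** Were [eigvals A] the default value [::], then [lambda] would be [0], against
    [0 < delta]. *)
Lemma eigvals_min n (A : 'M[R]_n.+1) (delta : R) : 0 < delta ->
  delta <= lambda A n.+1 -> forall a, eigenvalue A a -> delta <= a.
Proof.
move=> d0; rewrite /lambda /=.
set s := eigvals A => H a; rewrite eigenvalue_root_char.
have [E|E] := pselect (exists s : seq R, sorted (fun a b => b <= a) s /\
    char_poly A = \prod_(a <- s) ('X - a%:P)).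
  have [ss cs] : sorted (fun a b => b <= a) s /\
    char_poly A = \prod_(a <- s) ('X - a%:P).
    exact: (@xgetPex _ [::] _ E).
  rewrite cs root_prod_XsubC => sa; apply: (le_trans H).
  have sz : size s = n.+1.
    have := size_char_poly A; rewrite cs size_prod_XsubC => /eqP.
    by rewrite eqSS => /eqP.
  have tr : transitive (fun a b : R => b <= a).
    by move=> x y z yx zx; exact: le_trans zx yx.
  have rf : reflexive (fun a b : R => b <= a) by move=> x; exact: lexx.
  rewrite -(nth_index 0 sa).
  have ia : (index a s < n.+1)%N by rewrite -sz index_mem.
  apply: (sorted_leq_nth tr rf 0 ss); rewrite ?inE ?sz//.
suff s0 : s = [::] by move: H; rewrite s0 nth_nil leNgt d0.
by rewrite /s /eigvals; apply: xgetPN => t tP; apply: E; exists t.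
Qed.

(** The form reaches its minimum [mu] over the unit sphere at some [c]; since the
    form of [A - mu] is nonnegative and vanishes at [c], [c] is an eigenvector
    with eigenvalue [mu]. *)
Lemma eigvals_quadratic n (A : 'M[R]_n) (delta : R) : A^T = A -> 0 < delta ->
  ((0 < n)%N -> delta <= lambda A n) ->
  forall v : 'rV[R]_n, delta * sqn v <= (v *m A *m v^T) ord0 ord0.
Proof.
case: n A => [|n] A symA d0 H v.
  by rewrite /sqn big_ord1 big_ord0 mulr0 mxE big_ord0.
have {}H := H isT.
pose f (v : 'rV[R]_n.+1) : R := (v *m A *m v^T) ord0 ord0.
pose S := [set v : 'rV[R]_n.+1 | sqn v = 1].
have csq : continuous (fun v : 'rV[R]_n.+1 => sqn v : R).
  have -> : (fun v : 'rV[R]_n.+1 => sqn v : R) =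
      (fun v => (v *m 1%:M *m v^T) ord0 ord0).
    by apply/funext => u; rewrite mulmx1 sqn_row.
  exact: continuous_quadratic.
have cS : compact S.
  apply: bounded_closed_compact.
    exists 1; split => // M M1 u /= uS; apply: rv_norm_le => i.
    apply: le_trans (ltW M1).
    have ui : u ord0 i ^+ 2 <= 1.
      rewrite -uS /sqn big_ord1 (bigD1 i)//= lerDl.
      by apply: sumr_ge0 => j _; exact: sqr_ge0.
    rewrite -(@ler_pXn2r _ 2)// ?nnegrE// expr1n real_normK ?num_real//.
  have -> : S = (fun v : 'rV[R]_n.+1 => sqn v : R) @^-1` [set 1] by [].
  by apply: closed_comp => [x _|]; [exact: csq|exact: closed_eq].
have S0 : S !=set0.
  exists (delta_mx ord0 ord0); rewrite /S /= /sqn big_ord1 (bigD1 ord0)//=.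
  rewrite mxE !eqxx expr1n big1 ?addr0// => j j0.
  by rewrite mxE (negbTE j0) andbF expr0n.
have [c] := EVT_min_rV S0 cS (continuous_subspaceT (@continuous_quadratic _ A)).
rewrite inE => cS1 cmin; pose mu := f c.
have Q u : mu * sqn u <= f u.
  have [u0|u0] := eqVneq (sqn u) 0.
    by rewrite u0 mulr0 /f (sqn_eq0 u0) !mul0mx mxE.
  have su : 0 < sqn u by rewrite lt0r u0 sqn_ge0.
  pose r := (Num.sqrt (sqn u))^-1.
  have r2 : r ^+ 2 = (sqn u)^-1 by rewrite exprVn sqr_sqrtr ?sqn_ge0.
  have /cmin : r *: u \in S by rewrite inE /S /= sqnZ r2 mulVf.
  rewrite -/(f c) -/mu linearZ /= -scalemxAl -scalemxAr -scalemxAl scalerA -expr2.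
  by rewrite mxE r2 mulrC ler_pdivlMr.
have Muv u : (u *m (A - mu%:M) *m u^T) ord0 ord0 = f u - mu * sqn u.
  rewrite mulmxBr mulmxBl mxE; congr (_ + _).
  by rewrite mxE mul_mx_scalar -scalemxAl mxE sqn_row.
have cM : c *m (A - mu%:M) = 0.
  apply: psd_kernel.
  - by rewrite linearB /= symA tr_scalar_mx.
  - by move=> u; rewrite Muv subr_ge0.
  - by rewrite Muv cS1 mulr1 subrr.
have ev : eigenvalue A mu.
  apply/eigenvalueP; exists c.
    by apply/eqP; rewrite -subr_eq0 -mul_mx_scalar -mulmxBr cM.
  apply/eqP => c0; move: cS1; rewrite /S /= c0.
  rewrite /sqn big1 => [|i _]; last by rewrite big1// => j _; rewrite mxE expr0n.
  by move/eqP; rewrite eq_sym oner_eq0.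
apply: le_trans (Q v); rewrite ler_wpM2r ?sqn_ge0//.
exact: eigvals_min H _ ev.
Qed.

Lemma cauchy_schwarz_row n (u v : 'rV[R]_n) :
  (u *m v^T) ord0 ord0 ^+ 2 <= sqn u * sqn v.
Proof.
set b := (u *m v^T) ord0 ord0.
have Q (t : R) : 0 <= sqn u + 2 * t * b + t ^+ 2 * sqn v.
  have -> : sqn u + 2 * t * b + t ^+ 2 * sqn v = sqn (u + t *: v).
    rewrite !sqn_row linearD linearZ /= !mulmxDl !mulmxDr -!scalemxAl -!scalemxAr.
    rewrite !addmxE !scalemxE -/b -(trmxK (v *m u^T)) trmx_mul trmxK.
    rewrite [X in _ + (t * X + _)]mxE -/b; ring.
  exact: sqn_ge0.
have [v0|v0] := eqVneq (sqn v) 0.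
  rewrite v0 mulr0 /b (sqn_eq0 v0) trmx0 mulmx0 mxE expr0n //=.
have sv : 0 < sqn v by rewrite lt0r v0 sqn_ge0.
have := Q (- b / sqn v).
have -> : sqn u + 2 * (- b / sqn v) * b + (- b / sqn v) ^+ 2 * sqn v =
  sqn u - b ^+ 2 / sqn v by field.
by rewrite subr_ge0 ler_pdivrMr.
Qed.

Lemma quadratic_sqn_ge n (A : 'M[R]_n) (delta : R) : A^T = A -> 0 < delta ->
  (forall v : 'rV[R]_n, delta * sqn v <= (v *m A *m v^T) ord0 ord0) ->
  forall v : 'cV[R]_n, delta ^+ 2 * sqn v <= sqn (A *m v).
Proof.
move=> symA d0 H v.
have Hv := H v^T.
have := cauchy_schwarz_row (v^T *m A) v^T.
rewrite sqn_tr in Hv *.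
have -> : sqn (v^T *m A) = sqn (A *m v) by rewrite -sqn_tr trmx_mul trmxK symA.
have [v0|v0] := eqVneq (sqn v) 0; first by rewrite v0 !mulr0 => _; exact: sqn_ge0.
have sv : 0 < sqn v by rewrite lt0r v0 sqn_ge0.
move: Hv => + H2; set y := (_ *m _) ord0 ord0 in H2 * => Hv.
have : (delta * sqn v) ^+ 2 <= sqn (A *m v) * sqn v.
  apply: le_trans H2; rewrite lerXn2r// nnegrE.
    by rewrite mulr_ge0// ltW.
  by apply: le_trans Hv; rewrite mulr_ge0// ltW.
by rewrite exprMn (expr2 (sqn v)) mulrA ler_pM2r.
Qed.

Lemma quadratic_unitmx n (A : 'M[R]_n) (delta : R) : A^T = A -> 0 < delta ->
  (forall v : 'rV[R]_n, delta * sqn v <= (v *m A *m v^T) ord0 ord0) ->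
  A \in unitmx.
Proof.
move=> symA d0 H; rewrite -row_free_unit -kermx_eq0.
apply/eqP/row_matrixP => i; rewrite row0.
have := H (row i (kermx A)).
rewrite -row_mul mulmx_ker row0 mul0mx mxE pmulr_rle0// => r0.
by apply: sqn_eq0; apply/eqP; rewrite eq_le r0 sqn_ge0.
Qed.

(** Schur's test: Cauchy-Schwarz with the weights [`|A i j|] along each row; by
    symmetry the column sums satisfy the same bound. *)
Lemma schur_test n (A : 'M[R]_n) (S : R) : A^T = A ->
  (forall i, \sum_j `|A i j| <= S) ->
  forall v : 'cV[R]_n, sqn (A *m v) <= S ^+ 2 * sqn v.
Proof.
move=> symA rowS v.
have [n0|n0] := posnP n.
  by subst n; rewrite !sqn_col !big_ord0 mulr0.
have S0 : 0 <= S.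
  by apply: le_trans (rowS (Ordinal n0)); exact: sumr_ge0.
have colS j : \sum_i `|A i j| <= S.
  apply: le_trans (rowS j); apply: ler_sum => i _.
  by rewrite -[in leLHS]symA mxE.
rewrite !sqn_col.
apply: (@le_trans _ _ (\sum_i S * \sum_j `|A i j| * v j ord0 ^+ 2)).
  apply: ler_sum => i _; rewrite mxE.
  set a := \sum_j _ * _.
  (* (sum |A| |v|)^2 <= (sum |A|) (sum |A| v^2), by nonnegativity of
     sum |A| (|v| - t)^2 in t *)
  pose s := \sum_j `|A i j|; pose b := \sum_j `|A i j| * `|v j ord0|.
  pose c := \sum_j `|A i j| * v j ord0 ^+ 2.
  have ab : `|a| <= b.
    apply: le_trans (ler_norm_sum _ _ _) _; apply: ler_sum => j _.
    by rewrite normrM.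
  have s0 : 0 <= s by exact: sumr_ge0.
  have c0 : 0 <= c by apply: sumr_ge0 => j _; rewrite mulr_ge0 ?sqr_ge0.
  have b0 : 0 <= b by apply: sumr_ge0 => j _; rewrite mulr_ge0.
  have Q t : 0 <= c - 2 * t * b + t ^+ 2 * s.
    have -> : c - 2 * t * b + t ^+ 2 * s =
        \sum_j `|A i j| * (`|v j ord0| - t) ^+ 2.
      rewrite /c /b /s !mulr_sumr -sumrN -!big_split; apply: eq_bigr => j _ /=.
      rewrite -(real_normK (num_real (v j ord0))); ring.
    by apply: sumr_ge0 => j _; rewrite mulr_ge0 ?sqr_ge0.
  have b2 : b ^+ 2 <= s * c.
    have [z|nz] := eqVneq s 0.
      have b00 : b = 0.
        have A0 := psumr_eq0P (fun j _ => normr_ge0 (A i j)) z.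
        by rewrite /b big1// => j _; rewrite A0 ?mul0r.
      by rewrite b00 z mul0r expr0n.
    have sp : 0 < s by rewrite lt0r nz.
    have := Q (b / s).
    have -> : c - 2 * (b / s) * b + (b / s) ^+ 2 * s = c - b ^+ 2 / s by field.
    by rewrite subr_ge0 ler_pdivrMr// mulrC.
  apply: (@le_trans _ _ (b ^+ 2)).
    by rewrite -(real_normK (num_real a)) lerXn2r ?nnegrE.
  by apply: (le_trans b2); rewrite ler_wpM2r// rowS.
rewrite -mulr_sumr expr2 -mulrA ler_wpM2l//.
rewrite exchange_big /= mulr_sumr; apply: ler_sum => j _.
by rewrite -mulr_suml ler_wpM2r ?sqr_ge0.
Qed.

End quadratic_forms.

(** * Sums over separated points *)

Section lattice_sums.
Context (R : realType) (d : nat).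
Local Notation Rd := 'rV[R]_d.+1.
Local Notation dd := (d.+1%:R : R).

Definition decay (beta : R) (h : Rd) : R := (1 + `|h| `^ (dd + beta))^-1.

Lemma decay_den_gt0 beta (h : Rd) : 0 < 1 + `|h| `^ (dd + beta).
Proof. by rewrite ltr_pwDl// powR_ge0. Qed.

Lemma decay_ge0 beta h : 0 <= decay beta h.
Proof. by rewrite invr_ge0 ltW// decay_den_gt0. Qed.

Lemma decay_le1 beta h : decay beta h <= 1.
Proof. by rewrite invf_le1 ?decay_den_gt0// lerDl powR_ge0. Qed.

Lemma decayN beta h : decay beta (- h) = decay beta h.
Proof. by rewrite /decay normrN. Qed.

Variables (x : nat -> Rd) (Delta : R).
Hypothesis Delta0 : 0 < Delta.
Hypothesis sep : forall a b : nat, a != b -> Delta <= `|x a - x b|.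

Lemma rv_norm_lt (n : nat) (y : 'rV[R]_n.+1) (r : R) :
  (forall i, `|y ord0 i| < r) -> `|y| < r.
Proof.
move=> H; have -> : `|y| = mx_norm y by []; rewrite mx_normrE; apply: bigmax_lt.
  by apply: le_lt_trans (H ord0).
by move=> [i j] _ /=; rewrite (ord1 i); exact: H.
Qed.

(** Cells of side [Delta] contain at most one observation point each. *)
Lemma card_points_ball (n : nat) (u : Rd) (m : nat) :
  (#|[set b : 'I_n | (`|u - x b| < Delta * 2 ^+ m)%R]%SET| <= 2 ^ (m.+2 * d.+1))%N.
Proof.
pose N := (2 ^ m.+2)%N.
pose y (b : 'I_n) (i : 'I_d.+1) : R :=
  (x b ord0 i - u ord0 i + Delta * 2 ^+ m) / Delta.
pose cell (b : 'I_n) : {ffun 'I_d.+1 -> 'I_N.-1.+1} :=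
  [ffun i => inord (Num.truncn (y b i))].
have N0 : (0 < N)%N by rewrite expn_gt0.
have -> : (2 ^ (m.+2 * d.+1))%N = #|{ffun 'I_d.+1 -> 'I_N.-1.+1}|.
  by rewrite card_ffun !card_ord prednK// expnM.
apply: (leq_card_in cell) => b b'; rewrite !inE => ub ub' /ffunP cE.
have yb (c : 'I_n) i : `|u - x c| < Delta * 2 ^+ m -> 0 <= y c i /\ (Num.truncn (y c i) < N)%N.
  move=> uc; have := le_lt_trans (le_rv_norm (u - x c) i) uc.
  rewrite !mxE ltr_norml => /andP[h1 h2].
  have y0 : 0 <= y c i by rewrite divr_ge0 ?(ltW Delta0)//; lra.
  split => //; have /andP[t1 _] := truncn_itv y0.
  rewrite -(ltr_nat R); apply: le_lt_trans t1 _.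
  rewrite /y ltr_pdivrMr// /N natrX !exprS.
  have p0 : 0 < 2 ^+ m :> R by rewrite exprn_gt0.
  have := mulr_gt0 Delta0 p0; lra.
apply/eqP/negPn/negP => bb'.
have := sep bb'; rewrite leNgt => /negP; apply.
apply: rv_norm_lt => i; have := cE i; rewrite !ffunE.
have [yb0 ybN] := yb b i ub; have [yb'0 yb'N] := yb b' i ub'.
move=> /(congr1 val); rewrite /= !inordK ?prednK// => tE.
have /andP[t1 t2] := truncn_itv yb0; have /andP[t1' t2'] := truncn_itv yb'0.
rewrite tE -natr1 in t1 t2; rewrite -natr1 in t2'.
rewrite !mxE.
have -> : x b ord0 i - x b' ord0 i = Delta * (y b i - y b' i).
  by rewrite /y; field; rewrite gt_eqF.
rewrite normrM gtr0_norm// gtr_pMr// ltr_norml; apply/andP; split; lra.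
Qed.

(** The smallest of the balls of radii [Delta * 2 ^+ m] that contains [h] gives a
    sufficient term of the sum: [h] lies outside the previous ball. *)
Lemma decay_dyadic (beta : R) (h : Rd) (M : nat) : 0 < beta ->
  `|h| < Delta * 2 ^+ M ->
  decay beta h <= \sum_(m < M.+1)
    (`|h| < Delta * 2 ^+ m)%R%:R *
      ((1 + ((Delta / 2) `^ (dd + beta))^-1) * (2 `^ (- (dd + beta))) ^+ m).
Proof.
move=> b0 hM.
set K := 1 + _; have p0 : 0 < (Delta / 2) `^ (dd + beta) by rewrite powR_gt0 ?divr_gt0.
have K0 : 0 <= K by rewrite addr_ge0// invr_ge0 ltW.
pose Q m := `|h| < Delta * 2 ^+ m.
have exQ : exists m, Q m by exists M.
case: (ex_minnP exQ) => m Qm mmin.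
have mM : (m < M.+1)%N by rewrite ltnS mmin.
rewrite (bigD1 (Ordinal mM))//= -/(Q m) Qm mul1r.
apply: (@le_trans _ _ (K * 2 `^ (- (dd + beta)) ^+ m)); last first.
  rewrite lerDl; apply: sumr_ge0 => i _; rewrite mulr_ge0// mulr_ge0//.
case: m Qm mmin mM => [|m] Qm mmin mM.
  by rewrite expr0 mulr1 (le_trans (decay_le1 _ _))// lerDl invr_ge0 ltW.
have hm : Delta * 2 ^+ m <= `|h|.
  by rewrite leNgt; apply/negP => /mmin; rewrite ltnn.
have e0 : 0 <= dd + beta by rewrite addr_ge0// ltW.
have q0 : 0 < 2 `^ (dd + beta) ^+ m.+1 by rewrite exprn_gt0// powR_gt0.
apply: (@le_trans _ _ ((`|h| `^ (dd + beta))^-1)).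
  have h0 : 0 < `|h| by apply: lt_le_trans hm; rewrite mulr_gt0// exprn_gt0.
  by rewrite lef_pV2 ?posrE ?decay_den_gt0 ?powR_gt0// lerDr.
apply: (@le_trans _ _ (((Delta / 2) `^ (dd + beta))^-1 * (2 `^ (- (dd + beta))) ^+ m.+1)).
  rewrite powRN exprVn -invfM lef_pV2 ?posrE ?mulr_gt0//; last first.
    by rewrite powR_gt0// (lt_le_trans _ hm)// mulr_gt0// exprn_gt0.
  rewrite -powR_mulrn ?powR_ge0// -powRrM mulrC (mulrC (dd + beta)) powRrM.
  rewrite powR_mulrn// -powRM ?exprn_ge0 ?divr_ge0 ?(ltW Delta0)//.
  apply: ge0_ler_powR => //; rewrite ?nnegrE ?mulr_ge0 ?exprn_ge0 ?divr_ge0 ?(ltW Delta0)//.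
  by apply: le_trans hm; rewrite exprS; lra.
by rewrite ler_wpM2r ?exprn_ge0 ?powR_ge0// lerDr.
Qed.

Lemma geometric_sum_le (eta : R) (M : nat) : 0 <= eta -> eta < 1 ->
  \sum_(m < M) eta ^+ m <= (1 - eta)^-1.
Proof.
move=> e0 e1; have H : 0 < 1 - eta by rewrite subr_gt0.
rewrite -[leRHS]mul1r ler_pdivlMr//.
have -> : (\sum_(m < M) eta ^+ m) * (1 - eta) = 1 - eta ^+ M.
  by have := subrX1 eta M; set s := \sum_(_ < _) _; lra.
by rewrite gerBl exprn_ge0.
Qed.

(** The balls contain at most [4 ^+ d.+1 * 2 ^+ (m * d.+1)] points each: against
    the decay of order [d.+1 + beta] this leaves a geometric series of ratio
    [2 `^ (- beta)]. *)
Definition lattice_cst (beta : R) : R :=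
  (1 + ((Delta / 2) `^ (dd + beta))^-1) * (4 ^+ d.+1 / (1 - 2 `^ (- beta))).

Lemma lattice_sum_le (beta : R) : 0 < beta -> forall (n : nat) (u : Rd),
  \sum_(b < n) decay beta (u - x b) <= lattice_cst beta.
Proof.
move=> b0 n u.
have [M HM] : exists M, forall b : 'I_n, `|u - x b| < Delta * 2 ^+ M.
  pose s := \sum_(b < n) `|u - x b| / Delta.
  have s0 : 0 <= s by apply: sumr_ge0 => b _; rewrite divr_ge0// ltW.
  exists (Num.truncn s).+1 => b.
  rewrite mulrC -ltr_pdivrMr//.
  apply: (@le_lt_trans _ _ s).
    by rewrite /s (bigD1 b)//= lerDl sumr_ge0// => c _; rewrite divr_ge0// ltW.
  have /andP[_ h] := truncn_itv s0; apply: lt_le_trans h _.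
  by rewrite -natrX ler_nat ltnW// ltn_expl.
set K := 1 + ((Delta / 2) `^ (dd + beta))^-1.
set rho := 2 `^ (- (dd + beta)).
have K0 : 0 <= K by rewrite addr_ge0// invr_ge0 powR_ge0.
have rho0 : 0 <= rho by exact: powR_ge0.
have eta1 : 2 `^ (- beta) < 1 :> R.
  rewrite powRN invf_lt1 ?powR_gt0// /powR pnatr_eq0 /= expR_gt1.
  by rewrite mulr_gt0// ln_gt0// ltr1n.
apply: (@le_trans _ _ (\sum_(b < n) \sum_(m < M.+1)
    (`|u - x b| < Delta * 2 ^+ m)%R%:R * (K * rho ^+ m))).
  by apply: ler_sum => b _; exact: decay_dyadic.
rewrite exchange_big /=.
apply: (@le_trans _ _ (\sum_(m < M.+1) K * 4 ^+ d.+1 * (2 `^ (- beta)) ^+ m)).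
  apply: ler_sum => m _; rewrite -mulr_suml -natr_sum.
  have c := card_points_ball n u m.
  have -> : (\sum_(i < n) (`|u - x i| < Delta * 2 ^+ m)%R)%N =
      #|[set b : 'I_n | (`|u - x b| < Delta * 2 ^+ m)%R]%SET|.
    by rewrite -sum1_card [RHS]big_mkcond; apply: eq_bigr => i _; rewrite inE; case: ltP.
  apply: (@le_trans _ _ ((2 ^ (m.+2 * d.+1))%:R * (K * rho ^+ m))).
    by rewrite ler_wpM2r ?mulr_ge0 ?exprn_ge0// ler_nat.
  rewrite le_eqVlt; apply/orP; left; apply/eqP.
  have -> : rho = (2 ^+ d.+1)^-1 * 2 `^ (- beta).
    rewrite /rho opprD powRD; last by rewrite pnatr_eq0 implybT.
    by congr (_ * _); rewrite powRN powR_mulrn.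
  have -> : (2 ^ (m.+2 * d.+1))%:R = 4 ^+ d.+1 * (2 ^+ d.+1) ^+ m :> R.
    have -> : 4 = 2 ^+ 2 :> R by rewrite -natrX.
    rewrite natrX -!exprM -exprD; congr (_ ^+ _).
    by rewrite -addn2 mulnDl addnC (mulnC m).
  rewrite exprMn exprVn; set a := 2 ^+ d.+1.
  by field; rewrite expf_neq0// expf_neq0.
rewrite -mulr_sumr /lattice_cst -/K -mulrA ler_wpM2l//.
rewrite ler_wpM2l ?exprn_ge0//; exact: geometric_sum_le.
Qed.

Lemma lattice_cst_ge0 beta : 0 < beta -> 0 <= lattice_cst beta.
Proof. by move=> /lattice_sum_le /(_ 0%N 0); rewrite big_ord0. Qed.

(** Half of the exponent [alpha] is enough for summability; the other half makes
    the tail small. *)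
Lemma decay_tail (alpha r : R) (h : Rd) : 0 < alpha -> 1 <= r -> r < `|h| ->
  decay alpha h <= 2 * r `^ (- (alpha / 2)) * decay (alpha / 2) h.
Proof.
move=> a0 r1 rh; have r0 : 0 < r by apply: lt_le_trans r1.
have h0 : 0 < `|h| by exact: lt_trans rh.
have h1 : 1 <= `|h| by apply: le_trans r1 (ltW rh).
set e := dd + alpha / 2.
have E : `|h| `^ (dd + alpha) = `|h| `^ e * `|h| `^ (alpha / 2).
  rewrite -powRD; last by rewrite (gt_eqF h0) implybT.
  by congr powR; rewrite /e -addrA -splitr.
have hr : r `^ (alpha / 2) <= `|h| `^ (alpha / 2).
  apply: ge0_ler_powR; rewrite ?nnegrE ?divr_ge0 ?(ltW a0) ?(ltW r0)//.
  exact: ltW.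
have he1 : 1 <= `|h| `^ e.
  rewrite -(powRr0 `|h|); apply: ler_powR => //.
  by rewrite /e addr_ge0// divr_ge0// ltW.
have rp : 0 < r `^ (alpha / 2) by rewrite powR_gt0.
rewrite /decay E powRN -/e.
have p1 : 0 < 1 + `|h| `^ e * `|h| `^ (alpha / 2).
  by rewrite ltr_pwDl// mulr_ge0 ?powR_ge0.
have p2 : 0 < 1 + `|h| `^ e by rewrite ltr_pwDl// powR_ge0.
rewrite -[leLHS]mul1r ler_pdivrMr//.
set a := `|h| `^ e in he1 p1 p2 *; set b := `|h| `^ _ in hr p1 *.
set c := r `^ _ in hr rp *.
have -> : 2 / c / (1 + a) * (1 + a * b) = 2 * (1 + a * b) / (c * (1 + a)).
  by field; rewrite !gt_eqF.
rewrite ler_pdivlMr ?mulr_gt0// mul1r; nra.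
Qed.

Variables (t : Rd -> R) (gamma : nat -> R).
Hypothesis tc : {for 0, continuous t}.
Hypothesis t01 : t 0 = 1.
Hypothesis tle1 : forall u, `|t u| <= 1.
Hypothesis gamma0 : forall n, 0 < gamma n.
Hypothesis gammay : gamma n @[n --> \oo] --> +oo.

(** Near pairs of points are almost untouched by the taper once [gamma n] is
    large, and far ones carry a small total weight. *)
Lemma taper_sum_small (alpha eps : R) : 0 < alpha -> 0 < eps ->
  exists N : nat, forall n, (N <= n)%N -> forall (k : nat) (u : Rd),
    \sum_(b < k) decay alpha (u - x b) * `|1 - t ((gamma n)^-1 *: (u - x b))| <= eps.
Proof.
move=> a0 eps0; have a20 : 0 < alpha / 2 by rewrite divr_gt0.
pose S1 := lattice_cst alpha; pose S2 := lattice_cst (alpha / 2).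
have S10 : 0 <= S1 by exact: lattice_cst_ge0.
have S20 : 0 <= S2 by exact: lattice_cst_ge0.
(* the radius separating near and far points is such that
   4 r^(-alpha/2) S2 <= eps / 2 *)
pose r := 1 + (8 * (S2 + 1) / eps) `^ (2 / alpha).
have r1 : 1 <= r by rewrite lerDl powR_ge0.
have r0 : 0 < r by apply: lt_le_trans r1.
have rS : 4 * r `^ (- (alpha / 2)) * S2 <= eps / 2.
  have e8 : 0 < 8 * (S2 + 1) / eps by rewrite divr_gt0// mulr_gt0// ltr_wpDl.
  have : 8 * (S2 + 1) / eps <= r `^ (alpha / 2).
    have -> : 8 * (S2 + 1) / eps = ((8 * (S2 + 1) / eps) `^ (2 / alpha)) `^ (alpha / 2).
      rewrite -powRrM (_ : 2 / alpha * (alpha / 2) = 1) ?powRr1 ?(ltW e8)//.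
      by field; rewrite gt_eqF.
    apply: ge0_ler_powR; rewrite ?nnegrE ?powR_ge0 ?(ltW a20) ?(ltW r0)//.
    by rewrite lerDr.
  rewrite ler_pdivrMr// powRN => H.
  have rp : 0 < r `^ (alpha / 2) by rewrite powR_gt0.
  rewrite mulrAC ler_pdivrMr//; nra.
have e1 : 0 < eps / (2 * (S1 + 1)) by rewrite divr_gt0// mulr_gt0// ltr_wpDl.
have /cvgrPdist_lt /(_ _ e1) /nbhs_ballP[dl dl0 Hdl] := tc.
have /cvgryPge /(_ (2 * r / dl)) [N _ HN] := gammay.
exists N => n /HN /= gn k u.
apply: (@le_trans _ _ (\sum_(b < k) ((eps / (2 * (S1 + 1))) * decay alpha (u - x b) +
   4 * r `^ (- (alpha / 2)) * decay (alpha / 2) (u - x b)))).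
  apply: ler_sum => b _; set h := u - x b.
  have k0 := decay_ge0 alpha h; have k20 := decay_ge0 (alpha / 2) h.
  have rr0 : 0 <= r `^ (- (alpha / 2)) by exact: powR_ge0.
  have [hr|hr] := leP `|h| r.
    apply: (@le_trans _ _ ((eps / (2 * (S1 + 1))) * decay alpha h)).
      rewrite mulrC ler_wpM2r// ltW//.
      have := Hdl ((gamma n)^-1 *: h); rewrite /= t01; apply.
      rewrite -ball_normE /ball_ /= sub0r normrN normrZ.
      rewrite gtr0_norm ?invr_gt0// mulrC ltr_pdivrMr//.
      apply: le_lt_trans hr _.
      have : r < dl * (2 * r / dl).
        by rewrite mulrCA mulfV ?gt_eqF// mulr1; lra.
      by move=> /lt_le_trans; apply; rewrite ler_wpM2l// ltW.
    by rewrite lerDl mulr_ge0// mulr_ge0.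
  apply: (@le_trans _ _ (4 * r `^ (- (alpha / 2)) * decay (alpha / 2) h)); last first.
    by rewrite lerDr mulr_ge0// ltW.
  have H := decay_tail a0 r1 hr.
  have t2 : `|1 - t ((gamma n)^-1 *: h)| <= 2.
    apply: le_trans (ler_normB _ _) _; rewrite normr1.
    have := tle1 ((gamma n)^-1 *: h); lra.
  apply: (@le_trans _ _ (decay alpha h * 2)); first by rewrite ler_wpM2l.
  by lra.
rewrite big_split /= -!mulr_sumr.
have L1 := lattice_sum_le a0 k u; have L2 := lattice_sum_le a20 k u.
rewrite -/S1 -/S2 in L1 L2.
apply: (@le_trans _ _ ((eps / (2 * (S1 + 1))) * S1 + 4 * r `^ (- (alpha / 2)) * S2)).
  apply: lerD; first by rewrite ler_wpM2l// ltW.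
  by rewrite ler_wpM2l// mulr_ge0// powR_ge0.
have : eps / (2 * (S1 + 1)) * S1 <= eps / 2.
  rewrite mulrAC ler_pdivrMr ?mulr_gt0 ?ltr_wpDl//; nra.
lra.
Qed.

End lattice_sums.

(** * Lipschitz dependence on the parameter *)

Section lipschitz.
Context (R : realType) (q : nat) (tinf tsup : R).
Local Notation Rq := 'rV[R]_q.+1.
Local Notation Th := (param_box (q := q.+1) tinf tsup).

Definition upd (th : Rq) (i : 'I_q.+1) (s : R) : Rq :=
  \row_k (if k == i then s else th ord0 k).

Lemma upd_in th i s : Th th -> tinf <= s <= tsup -> Th (upd th i s).
Proof. by move=> hth hs k; rewrite mxE; case: eqP. Qed.

Lemma updD th i s h : upd th i (s + h) = upd th i s + h *: delta_mx ord0 i.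
Proof.
apply/rowP => k; rewrite !mxE !eqxx /=.
by case: eqP => _; rewrite ?mulr1 ?mulr0 ?addr0.
Qed.

Variables (f : Rq -> R) (B : R).
Hypothesis fC1 : C1_on Th f.
Hypothesis fB : forall i th, Th th -> `|partial_on Th f i th| <= B.

(** Mean value theorem along one coordinate: strictly inside the box,
    [partial_filter] is the full punctured neighbourhood filter, and at the end
    points the existence of one-sided derivatives gives continuity. *)
Lemma lipschitz_coord th i s s' : Th th -> tinf <= s <= tsup -> tinf <= s' <= tsup ->
  s <= s' -> `|f (upd th i s') - f (upd th i s)| <= B * (s' - s).
Proof.
move=> hth hs hs' ss'.
pose g (y : R) : R := f (upd th i y).
pose dg (y : R) : R := partial_on Th f i (upd th i y).
have inner y : y \in `]s, s'[ -> tinf < y < tsup.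
  rewrite in_itv/= => /andP[h1 h2]; case/andP: hs => hs1 hs2; case/andP: hs' => hs1' hs2'.
  by rewrite (le_lt_trans hs1 h1) (lt_le_trans h2 hs2').
have cvgq y : tinf <= y <= tsup ->
    partial_quot f i (upd th i y) h @[h --> partial_filter Th i (upd th i y)] --> dg y.
  by move=> hy; apply: (fC1 i).1; exact: upd_in.
have dgP y : y \in `]s, s'[ -> is_derive y 1 g (dg y).
  move=> /inner /andP[y1 y2].
  have hy : tinf <= y <= tsup by rewrite !ltW.
  have H : h^-1 *: ((g \o shift y) (h *: (1 : R)) - g y) @[h --> (0:R)^'] --> dg y.
    have := cvgq y hy.
    have -> : partial_filter Th i (upd th i y) = (0 : R)^'.
      apply/seteqP; split=> A; rewrite /partial_filter /within /=.
      - move=> HA.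
        suff HS : \forall h \near (0 : R)^', Th (upd th i y + h *: delta_mx ord0 i).
          by apply: filterS2 HS HA => h hS; exact.
        have : \forall h \near (0 : R)^', tinf < y + h < tsup.
          apply: nbhs_dnbhs.
          have e0 : 0 < Num.min (y - tinf) (tsup - y) by rewrite lt_min !subr_gt0 y1.
          apply/nbhs_ballP; exists (Num.min (y - tinf) (tsup - y)) => // h.
          rewrite -ball_normE /ball_ /= sub0r normrN lt_min !ltr_norml.
          by move=> /andP[/andP[h1 h2] /andP[h3 h4]]; apply/andP; split; lra.
        apply: filterS => h /andP[h1 h2]; rewrite -updD.
        by apply: upd_in => //; rewrite !ltW.
      - by move=> HA; apply: filterS HA.
    apply: cvg_trans; apply: near_eq_cvg; apply: nearW => h.
    rewrite /partial_quot /g /= -updD.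
    have -> : h *: (1 : R) = h by rewrite /GRing.scale /= mulr1.
    by rewrite (addrC y).
  split; first by apply/cvg_ex; exists (dg y).
  exact: cvg_lim H.
have gc : {within `[s, s'], continuous g}.
  apply/subspace_continuousP => y; rewrite /= in_itv/= => /andP[sy ys'].
  have hy : tinf <= y <= tsup.
    case/andP: hs => hs1 hs2; case/andP: hs' => hs1' hs2'.
    by rewrite (le_trans hs1 sy) (le_trans ys' hs2').
  have /cvgrPdist_lt /(_ _ ltr01) := cvgq y hy.
  rewrite near_withinE /= => H.
  have {}H : \forall h \near (0:R), h != 0 -> Th (upd th i y + h *: delta_mx ord0 i) ->
     `|dg y - partial_quot f i (upd th i y) h| < 1.
    exact: H.
  apply/cvgrPdist_le => e e0.
  pose c := `|dg y| + 1; have c0 : 0 < c by rewrite ltr_wpDl.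
  have /nbhs_ballP[r r0 Hr] := H.
  rewrite near_withinE; apply/nbhs_ballP.
  exists (Num.min r (e / c)); first by rewrite /= lt_min r0 divr_gt0.
  move=> z; rewrite -ball_normE /ball_ /= lt_min => /andP[zr ze].
  rewrite in_itv/= => /andP[sz zs'].
  have [->|zy] := eqVneq z y; first by rewrite subrr normr0 ltW.
  have hz : Th (upd th i y + (z - y) *: delta_mx ord0 i).
    rewrite -updD addrC subrK; apply: upd_in => //.
    case/andP: hs => hs1 hs2; case/andP: hs' => hs1' hs2'.
    by rewrite (le_trans hs1 sz) (le_trans zs' hs2').
  have zy0 : z - y != 0 by rewrite subr_eq0.
  have := Hr (z - y) _ zy0 hz.
  rewrite -ball_normE /ball_ /= sub0r normrN distrC => /(_ zr) Hq.
  have -> : g y - g z = - ((z - y) * partial_quot f i (upd th i y) (z - y)).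
    have yz : y + (z - y) = z by rewrite addrC subrK.
    by rewrite /partial_quot -updD yz mulrA divff// mul1r opprB.
  rewrite normrN normrM.
  apply: (@le_trans _ _ (`|z - y| * c)).
    rewrite ler_wpM2l//; set w := partial_quot _ _ _ _ in Hq *.
    have := ler_normD (w - dg y) (dg y); rewrite subrK.
    rewrite -(distrC (dg y)) /c => h; apply: (le_trans h); rewrite addrC lerD2l.
    exact: ltW.
  by rewrite -ler_pdivlMr// distrC ltW.
have [c cs ->] := MVT_segment ss' dgP gc.
rewrite normrM (@ger0_norm _ (s' - s)) ?subr_ge0// ler_wpM2r ?subr_ge0//.
apply: fB; apply: upd_in => //.
move: cs; rewrite in_itv/= => /andP[sc cs'].
case/andP: hs => hs1 hs2; case/andP: hs' => hs1' hs2'.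
by rewrite (le_trans hs1 sc) (le_trans cs' hs2').
Qed.

Lemma lipschitz_box th th' : Th th -> Th th' ->
  `|f th - f th'| <= q.+1%:R * B * `|th - th'|.
Proof.
move=> hth hth'.
have B0 : 0 <= B by apply: le_trans (fB ord0 hth).
(* from th to th', one coordinate at a time *)
pose z (j : nat) : Rq := \row_k (if (k < j)%N then th' ord0 k else th ord0 k).
have hz j : Th (z j) by move=> k; rewrite mxE; case: ifP.
have step (j : 'I_q.+1) : `|f (z j) - f (z j.+1)| <= B * `|th - th'|.
  have zj : z j = upd (z j) j (th ord0 j).
    by apply/rowP => k; rewrite !mxE; case: eqP => // ->; rewrite ltnn.
  have zj1 : z j.+1 = upd (z j) j (th' ord0 j).
    apply/rowP => k; rewrite !mxE ltnS; case: eqP => [->|kj]; first by rewrite leqnn.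
    by rewrite leq_eqVlt; case: eqP => // /val_inj.
  have d : `|th ord0 j - th' ord0 j| <= `|th - th'|.
    by have := le_rv_norm (th - th') j; rewrite !mxE.
  rewrite zj1 {1}zj.
  apply: le_trans (_ : B * `|th ord0 j - th' ord0 j| <= _); last by rewrite ler_wpM2l.
  have [h|h] := leP (th ord0 j) (th' ord0 j).
    rewrite distrC (distrC (th ord0 j)) (@ger0_norm _ (_ - th ord0 j)) ?subr_ge0//.
    exact: lipschitz_coord.
  rewrite (@ger0_norm _ (th ord0 j - _)) ?subr_ge0 ?(ltW h)//.
  by apply: lipschitz_coord => //; exact: ltW.
have -> : f th - f th' = \sum_(j < q.+1) (f (z j) - f (z j.+1)).
  have -> : th = z 0%N by apply/rowP => k; rewrite !mxE.
  have -> : th' = z q.+1 by apply/rowP => k; rewrite !mxE ltn_ord.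
  rewrite -(big_mkord xpredT (fun j => f (z j) - f (z j.+1))).
  rewrite (@telescope_sumr_eq _ 0 q.+1 (fun j => - f (z j)))//; first by rewrite opprK addrC.
  by move=> i _; rewrite opprK addrC.
apply: le_trans (ler_norm_sum _ _ _) _.
rewrite -mulrA mulr_natl -[X in _ *+ X](card_ord q.+1) -sumr_const.
by apply: ler_sum => j _; exact: step.
Qed.

End lipschitz.

(** * Lebesgue measurable sets of R^(d+1) *)

(** [phi] is continuous on [D] for the topology spanned by countably many
    measurable cells. *)
Lemma cell_measurable (R : realType) (dU : measure_display) (U : measurableType dU)
    (cells : nat -> set U) (D : set U) (phi : U -> R) :
  (forall k, measurable (cells k)) -> measurable D ->
  (forall u, D u -> forall e : R, 0 < e -> exists k, cells k u /\
     forall v, D v -> cells k v -> `|phi u - phi v| <= e) ->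
  measurable_fun D phi.
Proof.
move=> mcells mD cphi _; apply: (measurability _ (RGenOInfty.measurableE R)) => //.
move=> _ [_ [r ->] <-].
pose good k := `[< forall v, D v -> cells k v -> r < phi v >].
rewrite [X in measurable X](_ : _ =
    D `&` \bigcup_k (if good k then cells k else set0)).
  apply: measurableI => //; apply: bigcupT_measurable => k.
  by case: ifP.
apply/seteqP; split=> u /=.
- move=> [Du]; rewrite /= in_itv/= andbT => ru; split=> //.
  have e0 : 0 < (phi u - r) / 2 by rewrite divr_gt0 ?subr_gt0.
  have [k [ku kb]] := cphi u Du _ e0; exists k => //.
  rewrite ifT//; apply/asboolP => v Dv /(kb _ Dv).
  by rewrite ler_norml => /andP[_ h]; lra.
- move=> [Du [k _]]; case: ifP => // /asboolP gk ku; split=> //.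
  by rewrite /= in_itv/= andbT; exact: gk.
Qed.

Section lebesgue_Rd_borel.
Context (R : realType) (d : nat).
Local Notation Rd := 'rV[R]_d.+1.
Local Notation mu := (@lebesgue_outer R d).
Local Notation leb := (@lebesgue_Rd R d).

Let side (ab : Rd * Rd) (i : 'I_d.+1) : R := Num.max 0 (ab.2 ord0 i - ab.1 ord0 i).
Let others (ab : Rd * Rd) (i : 'I_d.+1) : R := \prod_(j | j != i) side ab j.

Let box_volE ab i : box_vol ab = side ab i * others ab i.
Proof. by rewrite /box_vol (bigD1 i). Qed.

Let side_ge0 ab i : 0 <= side ab i. Proof. by rewrite le_max lexx. Qed.

Let others_ge0 ab i : 0 <= others ab i.
Proof. by apply: prodr_ge0 => j _; exact: side_ge0. Qed.

Let set_coord (y : Rd) (i : 'I_d.+1) (s : R) : Rd :=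
  \row_k (if k == i then s else y ord0 k).

Let others_lower ab i s : others (ab.1, set_coord ab.2 i s) i = others ab i.
Proof.
by apply: eq_bigr => j ji; rewrite /side /= mxE (negbTE ji).
Qed.

Let others_upper ab i s : others (set_coord ab.1 i s, ab.2) i = others ab i.
Proof.
by apply: eq_bigr => j ji; rewrite /side /= mxE (negbTE ji).
Qed.

(** A hyperplane cuts a box into two boxes; overlapping them slightly makes
    both of them open at an arbitrarily small cost. *)
Lemma halfspace_caratheodory (i : 'I_d.+1) (c : R) :
  mu.-caratheodory [set y : Rd | y ord0 i < c].
Proof.
apply: le_caratheodory_measurable => X; set H := [set y | _].
apply: le_ereal_inf_tmp => _ [ab Xab <-].
apply/lee_addgt0Pr => e e0.
pose eta k := e / (2 ^ k.+1)%:R / (others (ab k) i + 1).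
have p2 k : 0 < (2 ^ k.+1)%:R :> R by rewrite ltr0n expn_gt0.
have o1 k : 0 < others (ab k) i + 1 by rewrite ltr_wpDl.
have eta0 k : 0 < eta k by rewrite divr_gt0// divr_gt0.
pose lo k : Rd * Rd := ((ab k).1, set_coord (ab k).2 i (Num.min ((ab k).2 ord0 i) c)).
pose up k : Rd * Rd := (set_coord (ab k).1 i (Num.max ((ab k).1 ord0 i) (c - eta k)), (ab k).2).
have vol k : box_vol (lo k) + box_vol (up k) <= box_vol (ab k) + e / (2 ^ k.+1)%:R.
  rewrite !(box_volE _ i) others_lower others_upper -mulrDl.
  apply: (@le_trans _ _ ((side (ab k) i + eta k) * others (ab k) i)).
    rewrite ler_wpM2r// /side /= !mxE !eqxx.
    set a := (ab k).1 ord0 i; set b := (ab k).2 ord0 i; have := eta0 k.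
    rewrite !maxEle !minEle.
    by repeat (case: ifPn; rewrite -?ltNge); lra.
  rewrite mulrDl lerD2l /eta mulrAC ler_pdivrMr//.
  by rewrite ler_wpM2l ?divr_ge0 ?(ltW e0)// lerDl.
apply: (@le_trans _ _ (\sum_(k <oo) (box_vol (lo k))%:E + \sum_(k <oo) (box_vol (up k))%:E)%E).
  apply: leeD; apply: ereal_inf_lbound.
  - exists lo => // y [Xy Hy]; have [k _ Bk] := Xab _ Xy; exists k => // j.
    have := Bk j; rewrite /lo /= mxE; case: eqP => [->|//] /andP[-> h] /=.
    by rewrite lt_min h.
  - exists up => // y [Xy /negP Hy]; have [k _ Bk] := Xab _ Xy; exists k => // j.
    have := Bk j; rewrite /up /= mxE; case: eqP => [->|//] /andP[h ->]; rewrite andbT.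
    rewrite gt_max h /= ltrBlDr (le_lt_trans _ (_ : y ord0 i < _))//.
      by rewrite leNgt.
    by rewrite ltrDl.
rewrite -nneseriesD//; last 2 first.
- by move=> k _ _; rewrite lee_fin box_vol_ge0.
- by move=> k _ _; rewrite lee_fin box_vol_ge0.
apply: le_trans (epsilon_trick _ _ (ltW e0)); last first.
  by move=> k; rewrite lee_fin box_vol_ge0.
apply: lee_nneseries => [k _ _|k _].
  by rewrite -EFinD lee_fin addr_ge0// box_vol_ge0.
by rewrite -!EFinD lee_fin.
Qed.

Lemma measurable_halfspace (i : 'I_d.+1) (c : R) :
  measurable ([set y : Rd | y ord0 i < c] : set (lebRd R d)).
Proof. exact: halfspace_caratheodory. Qed.

Lemma measurable_halfspace' (i : 'I_d.+1) (c : R) :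
  measurable ([set y : Rd | c < y ord0 i] : set (lebRd R d)).
Proof.
have -> : [set y : Rd | c < y ord0 i] =
    \bigcup_n ~` [set y : Rd | y ord0 i < c + n.+1%:R^-1].
  apply/seteqP; split=> y /=.
    move=> cy; have [n Hn] : exists n : nat, (n.+1%:R)^-1 < y ord0 i - c.
      have yc : 0 < y ord0 i - c by rewrite subr_gt0.
      exists (Num.truncn (y ord0 i - c)^-1).
      rewrite invf_plt ?posrE//.
      by have /andP[_] := truncn_itv (ltW (eq_ind_r is_true yc (invr_gt0 _))).
    by exists n => //=; apply/negP; rewrite -leNgt addrC -lerBrDr ltW.
  move=> [n _ /negP]; rewrite -leNgt; apply: lt_le_trans.
  by rewrite ltrDl invr_gt0.
apply: bigcupT_measurable => n; apply: measurableC; exact: measurable_halfspace.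
Qed.

Lemma measurable_rv_ball (u : Rd) (r : R) :
  measurable ([set y : Rd | `|u - y| < r] : set (lebRd R d)).
Proof.
have [r0|r0] := leP r 0.
  rewrite [X in measurable X](_ : _ = set0)//.
  by apply/seteqP; split=> y //= /lt_le_trans /(_ r0); rewrite normr_lt0.
have -> : [set y : Rd | `|u - y| < r] =
    \bigcap_(i in [set: 'I_d.+1])
      ([set y : Rd | y ord0 i < u ord0 i + r] `&` [set y : Rd | u ord0 i - r < y ord0 i]).
  apply/seteqP; split=> y /=.
    move=> uy i _ /=; have := le_lt_trans (le_rv_norm (u - y) i) uy.
    by rewrite !mxE ltr_norml => /andP[h1 h2]; split; lra.
  move=> H; apply: rv_norm_lt => i; have [h1 h2] := H i I.
  by rewrite /= in h1 h2; rewrite !mxE ltr_norml; apply/andP; split; lra.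
apply: fin_bigcap_measurable => // i _.
by apply: measurableI; [exact: measurable_halfspace|exact: measurable_halfspace'].
Qed.

(** Balls of radius [m.+1%:R^-1] with centres on the grid of that step: they are
    countably many and form a base of the topology. *)
Definition cell (k : nat) : set (lebRd R d) :=
  if unpickle k is Some (z, m) then
    [set y : Rd | `|(\row_i (((z : 'rV[int]_d.+1) ord0 i)%:~R / (m : nat).+1%:R) : Rd) - y|
       < (m : nat).+1%:R^-1]
  else set0.

Lemma measurable_cell k : measurable (cell k).
Proof.
by rewrite /cell; case: unpickle => [[z m]|//]; exact: measurable_rv_ball.
Qed.

Lemma cell_base (u : Rd) (r : R) : 0 < r ->
  exists k, cell k u /\ cell k `<=` [set y : Rd | `|u - y| < r].
Proof.
move=> r0; pose m := Num.truncn (2 / r).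
have mr : 2 * m.+1%:R^-1 < r.
  rewrite ltr_pdivrMr// mulrC -ltr_pdivrMr//.
  by have /andP[_] := truncn_itv (divr_ge0 (ler0n R 2) (ltW r0)).
pose z : 'rV[int]_d.+1 := \row_i Num.floor (u ord0 i * m.+1%:R).
exists (pickle (z, m)); rewrite /cell pickleK.
have zu : `|(\row_i ((z ord0 i)%:~R / m.+1%:R) : Rd) - u| < m.+1%:R^-1.
  apply: rv_norm_lt => i; rewrite !mxE.
  have /andP[f1 f2] := floor_itv (u ord0 i * m.+1%:R).
  have m0 : 0 < m.+1%:R :> R by [].
  have -> : (Num.floor (u ord0 i * m.+1%:R))%:~R / m.+1%:R - u ord0 i =
      - ((u ord0 i * m.+1%:R - (Num.floor (u ord0 i * m.+1%:R))%:~R) / m.+1%:R).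
    by field; rewrite gt_eqF.
  rewrite normrN ger0_norm; last by rewrite divr_ge0// subr_ge0.
  rewrite -[ltRHS]mul1r ltr_pM2r ?invr_gt0// ltrBlDr.
  by move: f2; rewrite intrD addrC.
split=> // y /= zy; apply: le_lt_trans (_ : 2 * m.+1%:R^-1 < r) => //.
rewrite distrC in zu.
move: zu zy; set c := \row_i _ => zu zy.
apply: (le_trans (ler_distD (c : Rd) u (y : Rd))).
by rewrite mulr_natl mulr2n lerD// ltW.
Qed.

Lemma lebesgue_Rd_ball (r : R) : (leb [set y : Rd | (`|y| < r)%R] < +oo)%E.
Proof.
pose ab : Rd * Rd := (\row__ (- r), \row__ r).
pose cov (k : nat) : Rd * Rd := if k is 0 then ab else (0, 0).
apply: (@le_lt_trans _ _ (\sum_(k <oo) (box_vol (cov k))%:E)%E).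
  apply: ereal_inf_lbound; exists cov => // y /= yr; exists 0%N => // i.
  by rewrite /= !mxE -ltr_norml (le_lt_trans (le_rv_norm y i)).
rewrite (nneseries_split 0 1); last by move=> k _; rewrite lee_fin box_vol_ge0.
rewrite add0n big_nat1 eseries0 ?adde0 ?ltry// => -[//|k] _ _ /=.
by rewrite /box_vol (bigD1 ord0)//= mxE subrr maxxx mul0r.
Qed.

Definition continuous_on (D : set Rd) (phi : Rd -> R) : Prop :=
  forall u, D u -> forall e : R, 0 < e ->
    exists2 r : R, 0 < r & forall v, D v -> `|u - v| < r -> `|phi u - phi v| < e.

Lemma continuous_on_measurable (D : set Rd) (phi : Rd -> R) :
  measurable (D : set (lebRd R d)) -> continuous_on D phi ->
  measurable_fun (D : set (lebRd R d)) (phi : lebRd R d -> R).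
Proof.
move=> mD cphi; apply: (cell_measurable measurable_cell mD) => u Du e e0.
have [r r0 Hr] := cphi u Du e e0; have [k [ku kb]] := cell_base u r0.
by exists k; split=> // v Dv /kb uv; apply: ltW; exact: Hr.
Qed.

End lebesgue_Rd_borel.

(** * Square integrable variables *)

Section square_integrable.
Context (R : realType) (disp : measure_display) (T : measurableType disp).
Variable P : probability T R.
Implicit Types X Y Z : T -> R.
Local Notation L2 := (Lfun P 2%:E).

Lemma L2norm_sqrE X : (L2norm P X `^ 2 = EE P (fun w => X w ^+ 2)%R)%E.
Proof.
rewrite /L2norm powR_Lnorm//; apply: eq_integral => w _ /=.
by rewrite powR_mulrn// real_normK ?num_real.
Qed.

Lemma L2P X : X \in L2 <->
  measurable_fun setT X /\ (EE P (fun w => X w ^+ 2)%R < +oo)%E.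
Proof.
have N0 : (0 <= L2norm P X)%E by exact: Lnorm_ge0.
have E : (L2norm P X < +oo)%E = (EE P (fun w => X w ^+ 2)%R < +oo)%E.
  rewrite -L2norm_sqrE; move: N0; case: (L2norm P X) => [r| |]//= _.
    by rewrite !ltry.
  by rewrite pnatr_eq0.
split.
  by rewrite inE => /andP[]; rewrite !inE /= => mX fX; rewrite -E.
move=> [mX fX]; rewrite inE; apply/andP; split; rewrite inE//= /finite_norm.
by rewrite -[X in (X < _)%E]/(L2norm P X) E.
Qed.

Lemma L2_measurable X : X \in L2 -> measurable_fun setT X.
Proof. by move=> /L2P[]. Qed.

Lemma L2_le X Y : measurable_fun setT X -> Y \in L2 ->
  (forall w, X w ^+ 2 <= Y w ^+ 2) -> X \in L2.
Proof.
move=> mX /L2P[mY fY] XY; apply/L2P; split => //.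
apply: le_lt_trans fY; apply: le_EE => //; try exact: measurable_funX.
by move=> w; exact: sqr_ge0.
Qed.

Lemma L2Z a X : X \in L2 -> (fun w => a * X w) \in L2.
Proof.
move=> /L2P[mX fX]; apply/L2P; split; first exact: measurable_funM.
have -> : EE P (fun w => (a * X w) ^+ 2)%R = ((a ^+ 2)%:E * EE P (fun w => X w ^+ 2)%R)%E.
  rewrite -EEZ ?sqr_ge0//; last 2 first.
  - exact: measurable_funX.
  - by move=> w; exact: sqr_ge0.
  by apply: eq_EE => w; rewrite exprMn.
have f0 : (0 <= EE P (fun w => X w ^+ 2)%R)%E by apply: EE_ge0 => w; exact: sqr_ge0.
by rewrite lte_mul_pinfty// lee_fin sqr_ge0.
Qed.

Lemma L2D X Y : X \in L2 -> Y \in L2 -> (fun w => X w + Y w) \in L2.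
Proof.
move=> /L2P[mX fX] /L2P[mY fY]; apply/L2P; split; first exact: measurable_funD.
have mX2 : measurable_fun setT (fun w => X w ^+ 2) by exact: measurable_funX.
have mY2 : measurable_fun setT (fun w => Y w ^+ 2) by exact: measurable_funX.
apply: (@le_lt_trans _ _ (EE P (fun w => 2 * X w ^+ 2 + 2 * Y w ^+ 2)%R)).
  apply: le_EE.
  - by apply: measurable_funX; exact: measurable_funD.
  - by apply: measurable_funD; exact: measurable_funM.
  - by move=> w; exact: sqr_ge0.
  - move=> w; rewrite -subr_ge0.
    have -> : 2 * X w ^+ 2 + 2 * Y w ^+ 2 - (X w + Y w) ^+ 2 = (X w - Y w) ^+ 2 by ring.
    exact: sqr_ge0.
rewrite EED; [|exact: measurable_funM|exact: measurable_funM|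
  by move=> w; rewrite mulr_ge0 ?sqr_ge0|by move=> w; rewrite mulr_ge0 ?sqr_ge0].
rewrite !EEZ//; [|by move=> w; exact: sqr_ge0|by move=> w; exact: sqr_ge0].
have fX0 : (0 <= EE P (fun w => X w ^+ 2)%R)%E by apply: EE_ge0 => w; exact: sqr_ge0.
have fY0 : (0 <= EE P (fun w => Y w ^+ 2)%R)%E by apply: EE_ge0 => w; exact: sqr_ge0.
by apply: lte_add_pinfty; apply: lte_mul_pinfty.
Qed.

Lemma L2B X Y : X \in L2 -> Y \in L2 -> (fun w => X w - Y w) \in L2.
Proof.
move=> LX LY; have -> : (fun w => X w - Y w) = (fun w => X w + (-1) * Y w).
  by apply/funext => w; rewrite mulN1r.
by apply: L2D => //; exact: L2Z.
Qed.

Lemma L2_cst a : (fun=> a) \in L2.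
Proof. by apply/L2P; split => //; rewrite EE_cst ltry. Qed.

Lemma L2_sum (I : Type) (r : seq I) (X : I -> T -> R) :
  (forall i, X i \in L2) -> (fun w => \sum_(i <- r) X i w) \in L2.
Proof.
move=> LX; elim: r => [|i r IH].
  by under eq_fun do rewrite big_nil; exact: L2_cst.
by under eq_fun do rewrite big_cons; exact: L2D.
Qed.

Lemma L2_mul_integrable X Y : X \in L2 -> Y \in L2 ->
  P.-integrable setT (EFin \o (fun w => X w * Y w)).
Proof. by move=> LX LY; apply/Lfun1_integrable; exact: Lfun2_mul_Lfun1. Qed.

(** Inner product, and below its norm [n2], as real numbers: [L2norm] takes its
    values in [\bar R]. *)
Definition ip X Y : R := \int[P]_w (X w * Y w).

Lemma ipC X Y : ip X Y = ip Y X.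
Proof. by apply: eq_Rintegral => w _; rewrite mulrC. Qed.

Lemma eq_ipr X Y Z : Y =1 Z -> ip X Y = ip X Z.
Proof. by move=> YZ; apply: eq_Rintegral => w _; rewrite YZ. Qed.

Lemma ipDr X Y Z : X \in L2 -> Y \in L2 -> Z \in L2 ->
  ip X (fun w => Y w + Z w) = ip X Y + ip X Z.
Proof.
move=> LX LY LZ; rewrite /ip -RintegralD//; try exact: L2_mul_integrable.
by apply: eq_Rintegral => w _; rewrite mulrDr.
Qed.

Lemma ipZr a X Y : X \in L2 -> Y \in L2 ->
  ip X (fun w => a * Y w) = a * ip X Y.
Proof.
move=> LX LY; rewrite /ip -RintegralZl//; try exact: L2_mul_integrable.
by apply: eq_Rintegral => w _; rewrite mulrCA.
Qed.

Lemma ipBr X Y Z : X \in L2 -> Y \in L2 -> Z \in L2 ->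
  ip X (fun w => Y w - Z w) = ip X Y - ip X Z.
Proof.
move=> LX LY LZ; rewrite -mulN1r -ipZr// -ipDr//; last exact: L2Z.
by apply: eq_ipr => w; rewrite mulN1r.
Qed.

Lemma ip_sumr (I : Type) (r : seq I) X (Y : I -> T -> R) :
  X \in L2 -> (forall i, Y i \in L2) ->
  ip X (fun w => \sum_(i <- r) Y i w) = \sum_(i <- r) ip X (Y i).
Proof.
move=> LX LY; elim: r => [|i r IH].
  rewrite big_nil /ip -[RHS](mul0r (fine (P setT))) -(Rintegral_cst P measurableT 0).
  by apply: eq_Rintegral => w _; rewrite big_nil mulr0.
rewrite big_cons -IH -ipDr//; last exact: L2_sum.
by apply: eq_ipr => w; rewrite big_cons.
Qed.

Lemma ip_ge0 X : 0 <= ip X X.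
Proof. by apply: Rintegral_ge0 => w _; rewrite -expr2 sqr_ge0. Qed.

Lemma ip_EE X : X \in L2 -> EE P (fun w => X w ^+ 2) = (ip X X)%:E.
Proof.
move=> LX; rewrite /ip /Rintegral fineK.
  by apply: eq_integral => w _; rewrite expr2.
by apply: integrable_fin_num => //; exact: L2_mul_integrable.
Qed.

Definition n2 X : R := Num.sqrt (ip X X).

Lemma n2_ge0 X : 0 <= n2 X. Proof. exact: sqrtr_ge0. Qed.

Lemma n2_sqr X : n2 X ^+ 2 = ip X X.
Proof. by rewrite sqr_sqrtr// ip_ge0. Qed.

Lemma eq_n2 X Y : X =1 Y -> n2 X = n2 Y.
Proof. by move=> /funext ->. Qed.

Lemma L2normE X : X \in L2 -> L2norm P X = (n2 X)%:E.
Proof.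
move=> LX; have N0 : (0 <= L2norm P X)%E by exact: Lnorm_ge0.
have := L2norm_sqrE X; rewrite ip_EE// -n2_sqr.
move: N0; case: (L2norm P X) => [r| |]//=; last by rewrite pnatr_eq0.
rewrite lee_fin => r0 [].
rewrite powR_mulrn// => /eqP; rewrite eqrXn2 ?n2_ge0//.
by move=> /eqP ->.
Qed.

Lemma cauchy_schwarz X Y : X \in L2 -> Y \in L2 -> `|ip X Y| <= n2 X * n2 Y.
Proof.
move=> LX LY.
have Q t : 0 <= ip X X + 2 * t * ip X Y + t ^+ 2 * ip Y Y.
  have LtY := L2Z t LY.
  have -> : ip X X + 2 * t * ip X Y + t ^+ 2 * ip Y Y =
      ip (fun w => X w + t * Y w) (fun w => X w + t * Y w).
    rewrite ipDr ?L2D// ipZr ?L2D// !(ipC (fun w => X w + t * Y w)).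
    by rewrite !ipDr// !ipZr// (ipC Y X); ring.
  exact: ip_ge0.
rewrite -(@ler_pXn2r _ 2)// ?nnegrE ?mulr_ge0 ?n2_ge0//.
rewrite real_normK ?num_real// exprMn !n2_sqr.
have [y0|y0] := eqVneq (ip Y Y) 0.
  rewrite y0 mulr0.
  have [->|b0] := eqVneq (ip X Y) 0; first by rewrite expr0n.
  have := Q (- (ip X X + 1) / (2 * ip X Y)).
  rewrite y0 mulr0 addr0.
  have -> : 2 * (- (ip X X + 1) / (2 * ip X Y)) * ip X Y = - (ip X X + 1) by field.
  lra.
have yp : 0 < ip Y Y by rewrite lt0r y0 ip_ge0.
have := Q (- ip X Y / ip Y Y).
have -> : ip X X + 2 * (- ip X Y / ip Y Y) * ip X Y + (- ip X Y / ip Y Y) ^+ 2 * ip Y Y =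
   ip X X - ip X Y ^+ 2 / ip Y Y by field.
by rewrite subr_ge0 ler_pdivrMr.
Qed.

Lemma n2D X Y : X \in L2 -> Y \in L2 -> n2 (fun w => X w + Y w) <= n2 X + n2 Y.
Proof.
move=> LX LY; rewrite -(@ler_pXn2r _ 2)// ?nnegrE ?addr_ge0 ?n2_ge0//.
rewrite n2_sqr ipDr ?L2D// !(ipC (fun w => X w + Y w)) !ipDr// (ipC Y X).
have := cauchy_schwarz LX LY; rewrite sqrrD !n2_sqr => /(le_trans (ler_norm _)).
by rewrite -mulr_natr; lra.
Qed.

Lemma n2Z a X : X \in L2 -> n2 (fun w => a * X w) = `|a| * n2 X.
Proof.
move=> LX; have LaX := L2Z a LX.
rewrite /n2 ipZr// ipC ipZr// mulrA -expr2 sqrtrM ?sqr_ge0//.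
by rewrite sqrtr_sqr.
Qed.

Lemma n2B X Y : X \in L2 -> Y \in L2 -> n2 (fun w => X w - Y w) <= n2 X + n2 Y.
Proof.
move=> LX LY; have := n2D LX (L2Z (-1) LY); rewrite n2Z// normrN1 mul1r.
by congr (_ <= _); apply: eq_n2 => w; rewrite mulN1r.
Qed.

Lemma n2BC X Y : X \in L2 -> Y \in L2 -> n2 (fun w => X w - Y w) = n2 (fun w => Y w - X w).
Proof.
move=> LX LY; rewrite -[RHS]mul1r -normrN1 -n2Z; last exact: L2B.
by apply: eq_n2 => w; rewrite mulN1r opprB.
Qed.

Lemma n2_triangle X Y Z : X \in L2 -> Y \in L2 -> Z \in L2 ->
  n2 (fun w => X w - Z w) <= n2 (fun w => X w - Y w) + n2 (fun w => Y w - Z w).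
Proof.
move=> LX LY LZ; apply: le_trans (n2D (L2B LX LY) (L2B LY LZ)).
by rewrite le_eqVlt; apply/orP; left; apply/eqP/eq_n2 => w; rewrite addrA subrK.
Qed.

Lemma n2_le X (c : R) : 0 <= c -> X \in L2 ->
  (EE P (fun w => X w ^+ 2)%R <= (c ^+ 2)%:E)%E -> n2 X <= c.
Proof.
move=> c0 LX; rewrite ip_EE// lee_fin -n2_sqr => H.
by rewrite -(@ler_pXn2r _ 2)// nnegrE n2_ge0.
Qed.

Lemma EE_abs_le X : X \in L2 -> (EE P (fun w => `|X w|)%R <= (n2 X)%:E)%E.
Proof.
move=> LX; have mX := L2_measurable LX.
have LaX : (fun w => `|X w|) \in L2.
  apply: L2_le LX _; first exact: measurableT_comp.
  by move=> w; rewrite real_normK ?num_real.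
have -> : EE P (fun w => `|X w|) = (ip (fun=> 1) (fun w => `|X w|))%:E.
  rewrite /ip /Rintegral fineK; last first.
    by apply: integrable_fin_num => //; exact: (L2_mul_integrable (L2_cst 1) LaX).
  by apply: eq_integral => w _; rewrite mul1r.
rewrite lee_fin; apply: le_trans (ler_norm _) _.
apply: le_trans (cauchy_schwarz (L2_cst 1) LaX) _.
have -> : n2 (fun=> 1) = 1.
  have : (n2 (fun=> 1) ^+ 2)%:E = 1%:E.
    by rewrite n2_sqr -ip_EE ?L2_cst// expr1n EE_cst.
  move=> [] /eqP; rewrite -[X in _ == X](expr1n _ 2) eqrXn2 ?n2_ge0//.
  by move=> /eqP.
rewrite mul1r; rewrite le_eqVlt; apply/orP; left; apply/eqP.
rewrite /n2; congr Num.sqrt; apply: eq_Rintegral => w _.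
by rewrite -normrM ger0_norm// -expr2 sqr_ge0.
Qed.

End square_integrable.

(** * Expected maxima of integrals of random functions *)

Section nonneg_integrals.
Context (R : realType) (dU : measure_display) (U : measurableType dU).
Variable mu : {measure set U -> \bar R}.

Lemma ge0_integrable (D : set U) (f : U -> \bar R) : measurable D ->
  measurable_fun D f -> (forall u, D u -> (0 <= f u)%E) ->
  (\int[mu]_(u in D) f u < +oo)%E -> mu.-integrable D f.
Proof.
move=> mD mf f0 fi; apply/integrableP; split => //.
rewrite (eq_integral f)//; move=> u; rewrite inE => Du.
by rewrite gee0_abs// f0.
Qed.

Lemma integral_tail_small (D : set U) (h : U -> R) (A : nat -> set U) (k : R) :
  measurable D -> measurable_fun D h -> (forall u, D u -> 0 <= h u) ->
  (\int[mu]_(u in D) (h u)%:E < +oo)%E ->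
  (forall n, measurable (A n)) -> (forall n m, (n <= m)%N -> A n `<=` A m) ->
  D `<=` \bigcup_n A n -> 0 < k ->
  exists n, (\int[mu]_(u in D) (h u * \1_(~` A n) u)%:E <= k%:E)%E.
Proof.
move=> mD mh h0 hi mA ndA DA k0.
have mhE : measurable_fun D (EFin \o h) by exact/measurable_EFinP.
have ih : mu.-integrable D (EFin \o h).
  by apply: ge0_integrable => // u Du; rewrite /= lee_fin h0.
pose f n u := (h u * \1_(~` A n) u)%:E.
have mf n : measurable_fun D (f n).
  apply/measurable_EFinP; apply: measurable_funM => //.
  by apply: measurable_indic; exact: measurableC.
have f0 n u : D u -> (0 <= f n u)%E by move=> Du; rewrite lee_fin mulr_ge0 ?h0.
have fcv : {ae mu, forall u, D u -> f n u @[n --> \oo] --> cst 0%E u}.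
  apply: nearW => u Du; have [N _ ANu] := DA _ Du.
  apply: cvg_near_cst; exists N => // n /= Nn; rewrite /f indicE.
  by rewrite memNset ?mulr0//= => /(_ (ndA _ _ Nn _ ANu)).
have fle : {ae mu, forall u n, D u -> (`|f n u| <= (EFin \o h) u)%E}.
  apply: nearW => u n Du; rewrite /f /= lee_fin normrM (ger0_norm (h0 _ Du)).
  by rewrite ger0_norm// ler_piMr ?h0// indicE; case: (_ \in _).
have [_ _] := dominated_convergence mD mf (measurable_cst _) fcv ih fle.
rewrite integral_cst// mul0e => H.
have {}H : (\int[mu]_(u in D) f n u)%E @[n --> \oo] --> 0%E by exact: H.
have p1 n : (0 <= \int[mu]_(u in D) f n u)%E by apply: integral_ge0 => u /f0.
have [N HN] := cvge0_le p1 H k0.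
by exists N; exact: HN.
Qed.

End nonneg_integrals.

Section L2_integral_duality.
Context (R : realType) (disp : measure_display) (T : measurableType disp).
Variable P : probability T R.
Context (dU : measure_display) (U : measurableType dU).
Variable mu : {measure set U -> \bar R}.
Local Notation L2 := (Lfun P 2%:E).
Local Notation ip := (ip P).
Local Notation n2 := (n2 P).

Lemma sf_eval_L2 (S : simple_field P mu) u : sf_eval S u \in L2.
Proof. by apply: L2_sum => j; apply: L2Z; exact: sf_L2. Qed.

Lemma sf_integral_L2 (S : simple_field P mu) D : sf_integral S D \in L2.
Proof. by apply: L2_sum => j; apply: L2Z; exact: sf_L2. Qed.

Lemma L2distE (G : U -> T -> R) (S : simple_field P mu) u : G u \in L2 ->
  L2dist G S u = (n2 (fun w => G u w - sf_eval S u w))%:E.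
Proof. by move=> LG; rewrite /L2dist L2normE// L2B// sf_eval_L2. Qed.

Lemma L2dist_ge0 (G : U -> T -> R) (S : simple_field P mu) u : (0 <= L2dist G S u)%E.
Proof. exact: Lnorm_ge0. Qed.

Lemma simple_field_pairing (S : simple_field P mu) (D : set U) (eta : T -> R) :
  measurable D -> eta \in L2 ->
  mu.-integrable D (fun u => (ip eta (sf_eval S u))%:E) /\
  (\int[mu]_(u in D) (ip eta (sf_eval S u))%:E = (ip eta (sf_integral S D))%:E)%E.
Proof.
move=> mD Leta.
have E u : (ip eta (sf_eval S u))%:E =
    (\sum_j (ip eta (sf_val j))%:E * (\1_(sf_set (s := S) j) u)%:E)%E.
  rewrite /sf_eval ip_sumr => [|//|j]; last by apply: L2Z; exact: sf_L2.
  rewrite -sumEFin; apply: eq_bigr => j _.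
  by rewrite ipZr ?sf_L2// -EFinM mulrC.
have i1 (j : 'I_(sf_size S)) : mu.-integrable D (fun u => (\1_(sf_set j) u)%:E).
  apply: ge0_integrable => //.
  - by apply/measurable_EFinP/measurable_indic; exact: sf_measurable.
  - rewrite integral_indic//; last exact: sf_measurable.
    apply: le_lt_trans (sf_finite j); apply: le_measure; rewrite ?inE.
    + by apply: measurableI => //; exact: sf_measurable.
    + exact: sf_measurable.
    + exact: subIsetl.
have i2 (j : 'I_(sf_size S)) : mu.-integrable D
    (fun u => (ip eta (sf_val j))%:E * (\1_(sf_set j) u)%:E)%E.
  exact: integrableZl.
have {}E := funext E; split; first by rewrite E; exact: integrable_sum.
  rewrite E.
  rewrite integral_sum// /sf_integral ip_sumr => [|//|j]; last by apply: L2Z; exact: sf_L2.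
  rewrite -sumEFin; apply: eq_bigr => j _.
  rewrite integralZl// integral_indic//; last exact: sf_measurable.
  rewrite ipZr ?sf_L2// EFinM muleC; congr (_ * _)%E.
  rewrite fineK// ge0_fin_numE//; apply: le_lt_trans (sf_finite j).
  apply: le_measure; rewrite ?inE.
  + by apply: measurableI => //; exact: sf_measurable.
  + exact: sf_measurable.
  + exact: subIsetl.
Qed.

Lemma L2_integral_approx (D : set U) (G : U -> T -> R) (I : T -> R) (k : R) :
  measurable D -> is_L2_integral P mu D G I -> 0 < k ->
  exists S : simple_field P mu,
    [/\ measurable_fun D (L2dist G S),
        (\int[mu]_(u in D) L2dist G S u <= k%:E)%E &
        n2 (fun w => I w - sf_integral S D w) <= k].
Proof.
move=> mD [LG [LI [S [mS S1 S2]]]] k0.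
have p1 m : (0 <= \int[mu]_(u in D) L2dist G (S m) u)%E.
  by apply: integral_ge0 => u _; exact: L2dist_ge0.
have [N1 H1] := cvge0_le p1 S1 k0.
have [N2 H2] := cvge0_le (fun m => Lnorm_ge0 _ _ _) S2 k0.
exists (S (maxn N1 N2)); split => //; first by apply: H1; rewrite leq_maxl.
have : (L2norm P (fun w => I w - sf_integral (S (maxn N1 N2)) D w)%R <= k%:E)%E.
  by apply: H2; rewrite leq_maxr.
rewrite L2normE ?lee_fin//.
by apply: L2B => //; exact: sf_integral_L2.
Qed.

(** The pairing commutes with the integral of a simple field, and both
    approximation errors are bounded through the norms of the [eta l]. *)
Lemma L2_integral_duality (L : finType) (D : set U) (G : L -> U -> T -> R)
    (I : L -> T -> R) (eta : L -> T -> R) (f : U -> R) (M : R) :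
  measurable D -> (forall l, is_L2_integral P mu D (G l) (I l)) ->
  (forall l, eta l \in L2) -> measurable_fun D f ->
  (forall u, D u -> 0 <= f u) -> (\int[mu]_(u in D) (f u)%:E = 1)%E -> 0 <= M ->
  (forall u, D u -> \sum_l ip (eta l) (G l u) <= M * f u) ->
  \sum_l ip (eta l) (I l) <= M.
Proof.
move=> mD HI Leta mf f0 f1 M0 H; apply/ler_addgt0Pr => e e0.
pose c := \sum_l n2 (eta l).
have c0 : 0 <= c by apply: sumr_ge0 => l _; exact: n2_ge0.
pose k := e / (2 * (c + 1)).
have k0 : 0 < k by rewrite divr_gt0// mulr_gt0// ltr_wpDl.
have /choice[S HS] : forall l, exists S : simple_field P mu,
    [/\ measurable_fun D (L2dist (G l) S),
        (\int[mu]_(u in D) L2dist (G l) S u <= k%:E)%E &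
        n2 (fun w => I l w - sf_integral S D w) <= k].
  by move=> l; exact: L2_integral_approx.
have LG l u : D u -> G l u \in L2 by move=> Du; have [h _] := HI l; exact: h.
have LI l : I l \in L2 by have [_ [h _]] := HI l.
have LS l := sf_integral_L2 (S l) D.
have ci l : mu.-integrable D (L2dist (G l) (S l)).
  have [h1 h2 _] := HS l; apply: ge0_integrable => //.
    by move=> u _; exact: L2dist_ge0.
  by apply: le_lt_trans h2 _; rewrite ltry.
have fi : mu.-integrable D (fun u => (M%:E * (f u)%:E)%E).
  apply: integrableZl => //; apply: ge0_integrable => //.
  - exact/measurable_EFinP.
  - by rewrite f1 ltry.
have B1 : \sum_l ip (eta l) (sf_integral (S l) D) <= M + c * k.
  rewrite -lee_fin -sumEFin.
  under eq_bigr => l _ do rewrite -(simple_field_pairing (S l) mD (Leta l)).2.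
  rewrite -integral_sum//; last by move=> l; exact: (simple_field_pairing (S l) mD (Leta l)).1.
  apply: (@le_trans _ _ (\int[mu]_(u in D) (M%:E * (f u)%:E +
      \sum_l (n2 (eta l))%:E * L2dist (G l) (S l) u))%E).
    apply: le_integral => //.
    - by apply: integrable_sum => // l _; exact: (simple_field_pairing (S l) mD (Leta l)).1.
    - apply: integrableD => //; apply: integrable_sum => // l _; exact: integrableZl.
    - move=> u; rewrite inE => Du.
      under [X in (_ <= _ + X)%E]eq_bigr => l _ do rewrite L2distE ?LG// -EFinM.
      rewrite !sumEFin -EFinM -EFinD lee_fin.
      apply: le_trans (_ : \sum_l (ip (eta l) (G l u) +
         n2 (eta l) * n2 (fun w => G l u w - sf_eval (S l) u w)) <= _).
        apply: ler_sum => l _.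
        have LGu := LG l u Du; have LSu := sf_eval_L2 (S l) u.
        have := cauchy_schwarz (Leta l) (L2B LGu LSu).
        rewrite ipBr// ler_norml => /andP[h _]; lra.
      by rewrite big_split /= lerD2r; exact: H.
  rewrite integralD//; last by apply: integrable_sum => // l _; exact: integrableZl.
  rewrite integralZl//; last first.
    apply: ge0_integrable => //.
    - exact/measurable_EFinP.
    - by rewrite f1 ltry.
  rewrite f1 mule1 EFinD; apply: leeD => //.
  rewrite integral_sum//; last by move=> l; exact: integrableZl.
  rewrite /c mulr_suml -sumEFin; apply: lee_sum => l _.
  rewrite integralZl// EFinM; apply: lee_wpmul2l; first by rewrite lee_fin n2_ge0.
  by case: (HS l).
have B2 : \sum_l ip (eta l) (I l) <= \sum_l ip (eta l) (sf_integral (S l) D) + c * k.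
  rewrite /c mulr_suml -big_split; apply: ler_sum => l _ /=.
  have := cauchy_schwarz (Leta l) (L2B (LI l) (LS l)).
  rewrite ipBr// ler_norml => /andP[_ h].
  have [_ _ h2] := HS l.
  have := ler_wpM2l (n2_ge0 P (eta l)) h2; lra.
have ck : 2 * (c * k) <= e.
  rewrite /k mulrA mulrCA mulrA ler_pdivrMr ?mulr_gt0 ?ltr_wpDl//; nra.
lra.
Qed.

(** The index of the maximum has to depend measurably on [w]: entries are added
    one at a time, and the new one takes over, with its sign, on the event where it
    dominates the others. *)
Lemma max_selector (K : finType) (V : K -> T -> R) :
  (forall k, measurable_fun setT (V k)) ->
  exists xi : K -> T -> R, [/\ forall k, measurable_fun setT (xi k),
    forall k w, `|xi k w| <= 1,
    forall w, \sum_k xi k w * V k w = \big[Num.max/0]_k `|V k w| &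
    forall w (a : K -> R), \sum_k xi k w * a k <= \big[Num.max/0]_k `|a k|].
Proof.
move=> mV.
suff : forall r : seq K, uniq r -> exists xi : K -> T -> R,
  [/\ forall k, measurable_fun setT (xi k),
    forall k w, `|xi k w| <= 1,
    forall w, \sum_(k <- r) xi k w * V k w = \big[Num.max/0]_(k <- r) `|V k w| &
    forall w (a : K -> R), \sum_(k <- r) xi k w * a k <=
      \big[Num.max/0]_(k <- r) `|a k|].
  move=> /(_ (index_enum K) (index_enum_uniq K))[xi [h1 h2 h3 h4]].
  by exists xi; split.
elim=> [_|k0 r IH /= /andP[k0r /IH[xi [m1 b1 e1 l1]]]].
  exists (fun _ _ => 0); split=> //.
  - by move=> k w; rewrite normr0.
  - by move=> w; rewrite !big_nil.
  - by move=> w a; rewrite !big_nil.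
pose m w := \big[Num.max/0]_(k <- r) `|V k w|.
have mm : measurable_fun setT m.
  by apply: measurable_bigmax => k; exact: measurableT_comp.
pose C := [set w | m w <= `|V k0 w|].
have mC : measurable C.
  rewrite -[X in measurable X]setTI; apply: measurable_fun_le => //.
  exact: measurableT_comp.
have mpos : measurable [set w | 0 <= V k0 w].
  by rewrite -[X in measurable X]setTI; exact: measurable_fun_le.
pose sgn w : R := 2 * \1_([set w | 0 <= V k0 w]) w - 1.
have sgnE w : sgn w * V k0 w = `|V k0 w|.
  rewrite /sgn indicE; have [h|h] := leP 0 (V k0 w).
    by rewrite mem_set//= ger0_norm// mulr1n; lra.
  by rewrite memNset /= ?ltr0_norm// ?mulr0n; [lra|rewrite leNgt h].
have sgn1 w : `|sgn w| = 1.
  rewrite /sgn indicE; case: (_ \in _) => /=.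
    by rewrite mulr1n (_ : 2 * 1 - 1 = 1) ?normr1//; lra.
  by rewrite mulr0n mulr0 sub0r normrN normr1.
have msgn : measurable_fun setT sgn.
  by apply: measurable_funB => //; exact: measurable_funM.
have iC w : (\1_C w : R) = 1 \/ (\1_C w : R) = 0.
  by rewrite indicE; case: (_ \in _); [left|right].
exists (fun k w => if k == k0 then \1_C w * sgn w else (1 - \1_C w) * xi k w).
have sumE w (a : K -> R) : \sum_(k <- k0 :: r)
    (if k == k0 then \1_C w * sgn w else (1 - \1_C w) * xi k w) * a k =
    \1_C w * (sgn w * a k0) + (1 - \1_C w) * \sum_(k <- r) xi k w * a k.
  rewrite big_cons eqxx mulrA; congr (_ + _); rewrite mulr_sumr.
  apply: eq_big_seq => k kr; case: eqP => [kk|_]; first by rewrite -kk kr in k0r.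
  by rewrite mulrA.
split.
- have mIC : measurable_fun setT (fun w => \1_C w : R) by exact: measurable_indic.
  by move=> k; case: eqP => _; apply: measurable_funM => //; exact: measurable_funB.
- move=> k w; case: eqP => _.
    by rewrite normrM sgn1 mulr1; case: (iC w) => ->; rewrite ?normr1 ?normr0.
  by case: (iC w) => ->; rewrite ?subrr ?subr0 ?mul0r ?mul1r ?normr0.
- move=> w; rewrite sumE big_cons -/(m w) sgnE e1 -/(m w) indicE.
  have [h|h] := leP (m w) `|V k0 w|.
    by rewrite mem_set// mul1r subrr mul0r addr0.
  by rewrite memNset ?mul0r ?subr0 ?mul1r ?add0r// /C /=; rewrite leNgt h.
- move=> w a; rewrite sumE big_cons le_max.
  case: (iC w) => ->; rewrite ?mul1r ?subrr ?mul0r ?addr0 ?subr0 ?add0r.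
    by rewrite (le_trans (ler_norm _))// normrM sgn1 mul1r.
  by rewrite mul1r (l1 w a) orbT.
Qed.

(** Once the maximum is written as a sum with random weights [xi], it becomes a
    pairing of the integrals with fixed variables; the same weights, used under
    the integral, give at most the maximum of the integrands. *)
Lemma L2_integral_max (K L : finType) (D : set U) (G : L -> U -> T -> R)
    (I : L -> T -> R) (alpha : K -> L -> R) (f : U -> R) (M : R) :
  measurable D -> (forall l, is_L2_integral P mu D (G l) (I l)) ->
  measurable_fun D f ->
  (forall u, D u -> 0 <= f u) -> (\int[mu]_(u in D) (f u)%:E = 1)%E -> 0 <= M ->
  (forall u, D u -> (EE P (fun w => \big[Num.max/0]_k `|(\sum_l alpha k l * G l u w)%R|)%R
      <= (M * f u)%:E)%E) ->
  (EE P (fun w => \big[Num.max/0]_k `|(\sum_l alpha k l * I l w)%R|)%R <= M%:E)%E.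
Proof.
move=> mD HI mf f0 f1 M0 H.
have LG l u : D u -> G l u \in L2 by move=> Du; have [h _] := HI l; exact: h.
have LI l : I l \in L2 by have [_ [h _]] := HI l.
pose V k w := \sum_l alpha k l * I l w.
have LV k : V k \in L2 by apply: L2_sum => l; exact: L2Z.
have [xi [mxi xi1 xiE xile]] := max_selector (fun k => L2_measurable (LV k)).
have Lxi k : xi k \in L2.
  apply: L2_le (mxi k) (L2_cst P 1) _ => w.
  by rewrite expr1n -(real_normK (num_real _)) expr_le1.
pose eta l w := \sum_k alpha k l * xi k w.
have Leta l : eta l \in L2 by apply: L2_sum => k; exact: L2Z.
have etaE (X : L -> T -> R) (w : T) : \sum_l eta l w * X l w =
    \sum_k xi k w * \sum_l alpha k l * X l w.
  under eq_bigr do rewrite mulr_suml.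
  rewrite exchange_big; apply: eq_bigr => k _; rewrite mulr_sumr.
  by apply: eq_bigr => l _; ring.
have ipsum (X : L -> T -> R) : (forall l, X l \in L2) ->
    P.-integrable setT (EFin \o (fun w => \sum_l eta l w * X l w)) /\
    \sum_l ip (eta l) (X l) = \int[P]_w (\sum_l eta l w * X l w).
  move=> LX.
  have iX l : P.-integrable setT (fun w => (eta l w * X l w)%:E).
    exact: (L2_mul_integrable (Leta l) (LX l)).
  have -> : EFin \o (fun w => \sum_l eta l w * X l w) =
      (fun w => \sum_l (eta l w * X l w)%:E)%E.
    by apply/funext => w /=; rewrite sumEFin.
  split; first exact: integrable_sum.
  apply: EFin_inj; rewrite -sumEFin /Rintegral fineK; last first.
    under eq_integral do rewrite -sumEFin.
    by apply: integrable_fin_num => //; exact: integrable_sum.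
  under [RHS]eq_integral do rewrite -sumEFin.
  rewrite integral_sum//; apply: eq_bigr => l _.
  by rewrite /ip /Rintegral fineK//; exact: integrable_fin_num.
have -> : EE P (fun w => \big[Num.max/0]_k `|(\sum_l alpha k l * I l w)%R|) =
    (\sum_l ip (eta l) (I l))%:E.
  have [iI ->] := ipsum I LI.
  rewrite /Rintegral fineK; last exact: integrable_fin_num.
  by apply: eq_integral => w _; rewrite etaE xiE.
rewrite lee_fin; apply: (L2_integral_duality mD HI Leta mf f0 f1 M0) => u Du.
have [iG ->] := ipsum (fun l => G l u) (fun l => LG l u Du).
rewrite -lee_fin; apply: le_trans (H u Du).
rewrite /Rintegral fineK; last exact: integrable_fin_num.
have mGu k : measurable_fun setT (fun w => \sum_l alpha k l * G l u w).
  by apply: L2_measurable; apply: L2_sum => l; apply: L2Z; exact: LG.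
apply: le_integral => //.
- apply: ge0_integrable => //.
  + by apply/measurable_EFinP; apply: measurable_bigmax => k; exact: measurableT_comp.
  + by move=> w _; rewrite lee_fin bigmax_ge_id.
  + by apply: le_lt_trans (H u Du) _; rewrite ltry.
- by move=> w _ /=; rewrite lee_fin (etaE (fun l => G l u)); exact: xile.
Qed.

End L2_integral_duality.

(** * Existence of integrals of random functions *)

Lemma half_pow_small (R : realType) (e : R) : 0 < e -> exists N, (2 ^+ N)^-1 <= e.
Proof.
move=> e0; exists (Num.truncn e^-1).+1.
rewrite invf_ple ?posrE ?exprn_gt0//; apply: ltW.
have e1 : 0 <= e^-1 by rewrite invr_ge0 ltW.
have /andP[_ h] := truncn_itv e1; apply: lt_le_trans h _.
by rewrite -natrX ler_nat ltnW// ltn_expl.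
Qed.

Section L2_completeness.
Context (R : realType) (disp : measure_display) (T : measurableType disp).
Variable P : probability T R.
Local Notation L2 := (Lfun P 2%:E).
Local Notation n2 := (n2 P).

Lemma summable_increments_cvg (x : nat -> R) :
  (\sum_(k <oo) `|x k.+1 - x k|%:E < +oo)%E -> cvgn x.
Proof.
move=> fin.
have cn : cvgn [normed series (fun k => x k.+1 - x k)].
  apply: nondecreasing_is_cvgn.
    by apply: nondecreasing_series => *; exact: normr_ge0.
  exists (fine (\sum_(k <oo) `|x k.+1 - x k|%:E)) => _ [n _ <-].
  rewrite -lee_fin fineK; last first.
    by rewrite ge0_fin_numE// nneseries_ge0.
  rewrite /series /= -sumEFin.
  by apply: nneseries_lim_ge => k _; rewrite lee_fin.
have cs : cvgn (series (fun k => x k.+1 - x k)) := normed_cvg cn.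
have -> : x = (fun n => x 0%N + series (fun k => x k.+1 - x k) n).
  by apply/funext => n; rewrite /series /= telescope_sumr// addrC subrK.
by apply: is_cvgD => //; exact: is_cvg_cst.
Qed.

Lemma nneseries_geometric_lt (c : R) : 0 <= c ->
  (\sum_(k <oo) (c / 2 ^+ k)%:E < +oo)%E.
Proof.
move=> c0; apply: (@le_lt_trans _ _ (2 * c)%:E); last by rewrite ltry.
apply: lime_le.
  by apply: is_cvg_nneseries => k _ _; rewrite lee_fin divr_ge0 ?exprn_ge0.
apply: nearW => n; rewrite sumEFin lee_fin -mulr_sumr mulrC ler_wpM2r//.
have := @geometric_sum_le R 2^-1 n _ _; rewrite big_mkord.
under eq_bigr do rewrite exprVn.
move=> H; apply: le_trans (H _ _) _ => //; first by rewrite invf_lt1// ltr1n.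
have -> : 1 - 2^-1 = 2^-1 :> R by lra.
by rewrite invrK.
Qed.

Lemma geometric_increments_cvg (x : nat -> R) (c : R) :
  (forall m, `|x m.+1 - x m| <= c / 2 ^+ m) -> cvgn x.
Proof.
move=> H; have c0 : 0 <= c.
  by have := le_trans (normr_ge0 _) (H 0%N); rewrite expr0 divr1.
apply: summable_increments_cvg; apply: le_lt_trans (nneseries_geometric_lt c0).
by apply: lee_nneseries => [k _ _|k _]; rewrite lee_fin.
Qed.

(** Completeness of [L^2] for fast Cauchy sequences: they converge almost
    surely, and Fatou's lemma identifies the limit. *)
Lemma L2_complete (X : nat -> T -> R) (c : R) : (forall m, X m \in L2) ->
  (forall m k, (m <= k)%N -> n2 (fun w => X k w - X m w) <= c / 2 ^+ m) ->
  exists Y, Y \in L2 /\ forall m, n2 (fun w => Y w - X m w) <= c / 2 ^+ m.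
Proof.
move=> LX HX; have mX m := L2_measurable (LX m).
have c0 : 0 <= c by have := le_trans (n2_ge0 P _) (HX 0%N 0%N (leqnn _)); rewrite expr0 divr1.
pose Y w := fine (limn_esup (fun m => (X m w)%:E)).
have mY : measurable_fun setT Y.
  apply: (measurableT_comp (fine_measurable measurableT)).
  by apply: measurable_fun_limn_esup => n; exact/measurable_EFinP.
have aeY : {ae P, forall w, (X k w)%:E @[k --> \oo] --> (Y w)%:E}.
  have mD k : measurable_fun setT (fun w => `|X k.+1 w - X k w|%:E).
    apply/measurable_EFinP; apply: measurableT_comp => //; exact: measurable_funB.
  have D0 k w : setT w -> (0 <= `|X k.+1 w - X k w|%:E)%E by rewrite lee_fin.
  have fin : (\int[P]_w (\sum_(k <oo) `|X k.+1 w - X k w|%:E) < +oo)%E.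
    rewrite integral_nneseries//.
    apply: (@le_lt_trans _ _ (\sum_(k <oo) (c / 2 ^+ k)%:E)%E).
      apply: lee_nneseries => [k _ _|k _]; first exact: integral_ge0.
      apply: le_trans (EE_abs_le (L2B (LX k.+1) (LX k))) _.
      by rewrite lee_fin; exact: HX.
    exact: nneseries_geometric_lt.
  have mS : measurable_fun setT (fun w => \sum_(k <oo) `|X k.+1 w - X k w|%:E)%E.
    by apply: ge0_emeasurable_sum => // k w _ _; exact: D0.
  have iS : P.-integrable setT (fun w => \sum_(k <oo) `|X k.+1 w - X k w|%:E)%E.
    apply: ge0_integrable => // w _; exact: nneseries_ge0.
  have := integrable_ae measurableT iS.
  apply: filterS => w /(_ I) Sw.
  have cX : cvgn (fun k => X k w).
    apply: summable_increments_cvg; rewrite ltey_eq.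
    by rewrite Sw.
  have cE : (X k w)%:E @[k --> \oo] --> (limn (fun k => X k w))%:E.
    by apply: cvg_EFin => //; apply: nearW.
  by rewrite /Y (cvg_limn_einf_sup cE).2 /=.
have HE m : (EE P (fun w => (Y w - X m w) ^+ 2)%R <= ((c / 2 ^+ m) ^+ 2)%:E)%E.
  have -> : EE P (fun w => (Y w - X m w) ^+ 2) =
      (\int[P]_w limn_einf (fun k => ((X k w - X m w) ^+ 2)%:E))%E.
    apply: ae_eq_integral => //.
    - apply/measurable_EFinP; apply: measurable_funX; exact: measurable_funB.
    - apply: measurableT_comp => //; apply: measurable_fun_limn_esup => k.
      apply: measurableT_comp => //; apply/measurable_EFinP.
      by apply: measurable_funX; exact: measurable_funB.
    - apply: filterS aeY => w /fine_cvgP[_ cw] _.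
      have {}cw : X k w @[k --> \oo] --> Y w by exact: cw.
      have cE : ((X k w - X m w) ^+ 2)%:E @[k --> \oo] --> ((Y w - X m w) ^+ 2)%:E.
        apply: cvg_EFin; first exact: nearW.
        rewrite /comp /=.
        under eq_fun do rewrite expr2.
        rewrite expr2; apply: cvgM; apply: cvgB => //; exact: cvg_cst.
      by rewrite (cvg_limn_einf_sup cE).1.
  apply: le_trans (fatou P measurableT _ _) _.
  - move=> k; apply/measurable_EFinP.
    by apply: measurable_funX; exact: measurable_funB.
  - by move=> k w _; rewrite lee_fin sqr_ge0.
  apply: (@le_trans _ _ (limn_esup (fun k => EE P (fun w => (X k w - X m w) ^+ 2)%R))).
    exact: limn_einf_sup.
  rewrite limn_esup_lim; apply: lime_le; first exact: is_cvg_esups.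
  exists m => // k /= mk; apply: ge_ereal_sup => _ [j /= kj <-].
  have Lj := L2B (LX j) (LX m).
  rewrite ip_EE// -n2_sqr lee_fin lerXn2r ?nnegrE ?n2_ge0 ?divr_ge0 ?exprn_ge0//.
  by apply: HX; exact: leq_trans mk kj.
have LD m : (fun w => Y w - X m w) \in L2.
  apply/L2P; split; first exact: measurable_funB.
  by apply: le_lt_trans (HE m) _; rewrite ltry.
exists Y; split.
  have -> : Y = (fun w => (Y w - X 0%N w) + X 0%N w) by apply/funext => w; rewrite subrK.
  exact: L2D.
by move=> m; apply: n2_le => //; rewrite divr_ge0 ?exprn_ge0.
Qed.

End L2_completeness.

Section L2_integral_existence.
Context (R : realType) (disp : measure_display) (T : measurableType disp).
Variable P : probability T R.
Context (dU : measure_display) (U : measurableType dU).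
Variable mu : {measure set U -> \bar R}.
Local Notation L2 := (Lfun P 2%:E).
Local Notation n2 := (n2 P).
Local Notation ip := (ip P).

(** Continuity of [G] in [L2] is expressed through the countable family [cells];
    the sets [ex n] exhaust [U] with finite measure, and [h] dominates [G]. *)
Variables (cells ex : nat -> set U).
Hypothesis mcells : forall k, measurable (cells k).
Hypothesis mex : forall k, measurable (ex k).
Hypothesis ndex : forall n m, (n <= m)%N -> ex n `<=` ex m.
Hypothesis exT : forall u, exists n, ex n u.
Hypothesis exfin : forall n, (mu (ex n) < +oo)%E.

Variables (D : set U) (G : U -> T -> R) (h : U -> R).
Hypothesis mD : measurable D.
Hypothesis LG : forall u, D u -> G u \in L2.
Hypothesis mh : measurable_fun D h.
Hypothesis Gh : forall u, D u -> n2 (G u) <= h u.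
Hypothesis hfin : (\int[mu]_(u in D) (h u)%:E < +oo)%E.
Hypothesis Gc : forall u, D u -> forall e : R, 0 < e -> exists k, cells k u /\
  forall v, D v -> cells k v -> n2 (fun w => G u w - G v w) <= e.

Let h0 u : D u -> 0 <= h u.
Proof. by move=> Du; apply: le_trans (Gh Du); exact: n2_ge0. Qed.

Let measurable_dist (v : T -> R) : v \in L2 ->
  measurable_fun D (fun u => n2 (fun w => G u w - v w)).
Proof.
move=> Lv; apply: (cell_measurable mcells mD) => u Du e e0.
have [k [ku Hk]] := Gc Du e0; exists k; split=> // u' Du' ku'.
apply: le_trans (Hk _ Du' ku').
have t1 := n2_triangle (LG Du) (LG Du') Lv.
have t2 := n2_triangle (LG Du') (LG Du) Lv.
rewrite (n2BC (LG Du') (LG Du)) in t2.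
by rewrite ler_norml; apply/andP; split; lra.
Qed.

(** The value of [G] at [v] can replace [G] on the cell [k]. *)
Let good (e : R) k v := D v /\
  forall v', D v' -> cells k v' -> n2 (fun w => G v w - G v' w) <= e.

Let value (e : R) (k : nat) : T -> R :=
  if pselect (exists v, good e k v) is left H then G (sval (cid H)) else fun=> 0.

Let good_cell (e : R) (k : nat) : set U :=
  if pselect (exists v, good e k v) is left H then cells k else set0.

Let value_L2 e k : value e k \in L2.
Proof.
rewrite /value; case: pselect => [H|_]; last exact: L2_cst.
by case: (cid H) => v [Dv _] /=; exact: LG.
Qed.

Let good_cell_dist e k u : D u -> good_cell e k u ->
  n2 (fun w => G u w - value e k w) <= e.
Proof.
rewrite /value /good_cell; case: pselect => [H|//] Du ku.
case: (cid H) => v [Dv Hv] /=; rewrite n2BC ?LG//; exact: Hv.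
Qed.

Let m_good_cell e k : measurable (good_cell e k).
Proof. by rewrite /good_cell; case: pselect. Qed.

Let good_cell_cover e u : 0 < e -> D u -> exists k, good_cell e k u.
Proof.
move=> e0 Du; have [k [ku Hk]] := Gc Du e0; exists k.
rewrite /good_cell; case: pselect => // -[]; by exists u.
Qed.

Let piece (e : R) (r : nat) (j : nat) : set U := seqDU (good_cell e) j `&` ex r.

Let m_piece e r j : measurable (piece e r j).
Proof.
apply: measurableI => //; apply: measurableD => //.
by apply: bigsetU_measurable => i _.
Qed.

Let piece_uniq e r i j u : piece e r i u -> piece e r j u -> i = j.
Proof.
move=> [pi _] [pj _]; have := @trivIset_seqDU _ (good_cell e) i j I I.
by apply; exists u.
Qed.

Let fin_piece e r j : (mu (piece e r j) < +oo)%E.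
Proof.
apply: le_lt_trans (exfin r); apply: le_measure; rewrite ?inE//.
by move=> u [].
Qed.

Let approx (e : R) (r J : nat) : simple_field P mu :=
  @SimpleField _ _ _ P _ _ mu J (fun j => piece e r j) (fun j => value e j)
    (fun j => m_piece e r j) (fun j => fin_piece e r j) (fun j => value_L2 e j).

Let approx_in e r J (j : nat) u w : (j < J)%N -> piece e r j u ->
  sf_eval (approx e r J) u w = value e j w.
Proof.
move=> jJ pu; rewrite /sf_eval /= (bigD1 (Ordinal jJ))//= indicE mem_set// mul1r.
rewrite big1 ?addr0// => i ij; rewrite indicE memNset ?mul0r// => pi.
by move/eqP: ij; apply; apply: val_inj; exact: piece_uniq pi pu.
Qed.

Let approx_out e r J u w : (forall j, (j < J)%N -> ~ piece e r j u) ->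
  sf_eval (approx e r J) u w = 0.
Proof.
move=> H; rewrite /sf_eval /= big1// => i _; rewrite indicE memNset ?mul0r//.
by apply: H.
Qed.

Let measurable_approx e r J : measurable_fun D (L2dist G (approx e r J)).
Proof.
pose rest := ~` \bigcup_(j in [set j | (j < J)%N]) piece e r j.
have mrest : measurable rest.
  apply: measurableC; apply: bigcup_measurable => j _; exact: m_piece.
pose E (i : nat) := D `&` (if (i < J)%N then piece e r i else
   if i == J then rest else set0).
have DE : D = \bigcup_i E i.
  apply/seteqP; split=> u; last by case=> i _ [].
  move=> Du; have [[j jJ pj]|nj] := pselect (exists2 j, (j < J)%N & piece e r j u).
    by exists j => //; split=> //; rewrite jJ.
  exists J => //; split=> //; rewrite ltnn eqxx => -[j /= jJ pj].
  by apply: nj; exists j.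
have mE i : measurable (E i).
  apply: measurableI => //; case: ifP => _; first exact: m_piece.
  by case: ifP.
rewrite DE; apply/(measurable_fun_bigcup _ mE) => i.
rewrite /E; case: ifP => [iJ|_].
  apply: (eq_measurable_fun (fun u => (n2 (fun w => G u w - value e i w))%:E)).
    move=> u; rewrite inE => -[Du pu]; rewrite L2distE ?LG//; congr EFin.
    by apply: eq_n2 => w; rewrite (approx_in _ iJ).
  apply: (@measurable_funS _ _ _ _ D) => //.
  by apply/measurable_EFinP; apply: measurable_dist; exact: value_L2.
case: ifP => _; last by rewrite setI0; exact: measurable_fun_set0.
apply: (eq_measurable_fun (fun u => (n2 (fun w => G u w - 0))%:E)).
  move=> u; rewrite inE => -[Du pu]; rewrite L2distE ?LG//; congr EFin.
  apply: eq_n2 => w; rewrite approx_out// => j jJ pj; apply: pu.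
  by exists j.
apply: (@measurable_funS _ _ _ _ D) => //.
by apply/measurable_EFinP; apply: (measurable_dist (L2_cst P 0)).
Qed.

(** The step field takes the value of [G] at one point of each of finitely many
    good cells, within some [ex r]; elsewhere it vanishes, at the cost of tails of
    the integral of [h]. *)
Lemma L2_approx (k : R) : 0 < k -> exists S : simple_field P mu,
  measurable_fun D (L2dist G S) /\ (\int[mu]_(u in D) L2dist G S u <= k%:E)%E.
Proof.
move=> k0; have k3 : 0 < k / 3 by rewrite divr_gt0.
have [r Hr] : exists r, (\int[mu]_(u in D) (h u * \1_(~` ex r) u)%:E <= (k / 3)%:E)%E.
  apply: integral_tail_small => // u _.
  by have [n nu] := exT u; exists n.
pose e := k / 3 / (fine (mu (ex r)) + 1).
have m0 : 0 <= fine (mu (ex r)) by rewrite fine_ge0.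
have e0 : 0 < e by rewrite divr_gt0// ltr_wpDl.
pose A J := \bigcup_(j in [set j | (j < J)%N]) good_cell e j.
have mA J : measurable (A J) by apply: bigcup_measurable.
have [J HJ] : exists J, (\int[mu]_(u in D) (h u * \1_(~` A J) u)%:E <= (k / 3)%:E)%E.
  apply: integral_tail_small => //.
    move=> n m nm u [j /= jn cj]; exists j => //=; exact: leq_trans jn nm.
  by move=> u Du; have [j cj] := good_cell_cover e0 Du; exists j.+1 => //; exists j => /=.
exists (approx e r J); split; first exact: measurable_approx.
have mterm (B : set U) : measurable B -> measurable_fun D (fun u => (h u * \1_(~` B) u)%:E).
  move=> mB; apply/measurable_EFinP; apply: measurable_funM => //.
  by apply: measurable_indic; exact: measurableC.
have mterm0 (B : set U) u : D u -> (0 <= (h u * \1_(~` B) u)%:E)%E.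
  by move=> Du; rewrite lee_fin mulr_ge0// h0.
apply: (@le_trans _ _ (\int[mu]_(u in D) ((e * \1_(ex r) u)%:E +
    ((h u * \1_(~` ex r) u)%:E + (h u * \1_(~` A J) u)%:E)))%E).
  apply: ge0_le_integral => //.
  - by move=> u _; exact: L2dist_ge0.
  - apply: emeasurable_funD; last by apply: emeasurable_funD; exact: mterm.
    by apply/measurable_EFinP; apply: measurable_funM => //; exact: measurable_indic.
  move=> u Du; rewrite L2distE ?LG// -!EFinD lee_fin.
  have hu := h0 Du.
  have i0 (B : set U) : 0 <= \1_B u :> R by [].
  have [[j jJ pj]|nj] := pselect (exists2 j, (j < J)%N & piece e r j u).
    have pj' := pj; case: pj => -[cj _] exu.
    rewrite (@eq_n2 _ _ _ _ _ (fun w => G u w - value e j w)); last first.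
      by move=> w; rewrite (approx_in _ jJ pj').
    apply: (le_trans (good_cell_dist Du cj)).
    by rewrite [\1_(ex r) u]indicE mem_set// mulr1 lerDl addr_ge0// mulr_ge0.
  rewrite (@eq_n2 _ _ _ _ _ (G u)); last first.
    move=> w; rewrite approx_out ?subr0// => j jJ pj; apply: nj; by exists j.
  apply: (le_trans (Gh Du)).
  have [exu|nexu] := pselect (ex r u); last first.
    rewrite [\1_(~` ex r) u]indicE mem_set// mulr1.
    by rewrite addrCA lerDl addr_ge0// mulr_ge0// ltW.
  have nA : ~ A J u.
    move=> [j /= jJ cj].
    have : (\bigcup_(i in [set i | (i < J)%N]) seqDU (good_cell e) i) u.
      have exj : exists i, `[< good_cell e i u >] by exists j; exact/asboolP.
      case: (ex_minnP exj) => i /asboolP ci imin.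
      exists i => /=; first by apply: leq_ltn_trans jJ; apply: imin; exact/asboolP.
      split=> //; rewrite -bigcup_mkord => -[l /= li cl].
      by have := imin l (asboolT cl); rewrite leqNgt li.
    move=> [i /= iJ ci]; apply: nj; exists i => //.
  rewrite [\1_(~` A J) u]indicE mem_set// mulr1.
  by rewrite addrA lerDr addr_ge0// mulr_ge0// ltW.
have mer : measurable_fun D (fun u => (e * \1_(ex r) u)%:E).
  by apply/measurable_EFinP; apply: measurable_funM => //; exact: measurable_indic.
rewrite ge0_integralD//; [|by move=> u _; rewrite lee_fin mulr_ge0// ltW|
  by move=> u Du; apply: adde_ge0; exact: mterm0|
  by apply: emeasurable_funD; exact: mterm].
rewrite ge0_integralD//; [|by move=> u; exact: mterm0|exact: mterm|
  by move=> u; exact: mterm0|exact: mterm].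
have -> : (k%:E = (k / 3)%:E + ((k / 3)%:E + (k / 3)%:E))%E.
  by rewrite -!EFinD; congr EFin; lra.
apply: leeD; last exact: leeD.
under eq_integral do rewrite EFinM.
rewrite ge0_integralZl// ?lee_fin ?(ltW e0)//; last first.
  by apply/measurable_EFinP; exact: measurable_indic.
rewrite integral_indic//.
apply: (@le_trans _ _ (e%:E * mu (ex r))%E).
  apply: lee_wpmul2l; first by rewrite lee_fin ltW.
  by apply: le_measure; rewrite ?inE//; exact: measurableI.
rewrite -(fineK (x := mu (ex r))); last by rewrite ge0_fin_numE.
rewrite -EFinM lee_fin /e mulrAC ler_pdivrMr ?ltr_wpDl//.
by rewrite ler_wpM2l ?(ltW k3)// lerDl.
Qed.

(** The difference [X] of both integrals is paired with itself. *)
Lemma sf_integral_dist (S S' : simple_field P mu) (a b : R) :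
  measurable_fun D (L2dist G S) -> measurable_fun D (L2dist G S') ->
  (\int[mu]_(u in D) L2dist G S u <= a%:E)%E ->
  (\int[mu]_(u in D) L2dist G S' u <= b%:E)%E ->
  n2 (fun w => sf_integral S D w - sf_integral S' D w) <= a + b.
Proof.
move=> mS mS' Sa Sb.
have LS := sf_integral_L2 S D; have LS' := sf_integral_L2 S' D.
pose X w := sf_integral S D w - sf_integral S' D w.
have LX : X \in L2 by exact: L2B.
have [iS eS] := simple_field_pairing S mD LX.
have [iS' eS'] := simple_field_pairing S' mD LX.
have X2 : (ip X X)%:E = (\int[mu]_(u in D) ((ip X (sf_eval S u))%:E - (ip X (sf_eval S' u))%:E))%E.
  rewrite integralB// eS eS' -EFinB; congr EFin.
  by rewrite -ipBr.
have iL (S0 : simple_field P mu) c : measurable_fun D (L2dist G S0) ->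
    (\int[mu]_(u in D) L2dist G S0 u <= c%:E)%E -> mu.-integrable D (L2dist G S0).
  move=> m0 H; apply: ge0_integrable => //; first by move=> u _; exact: L2dist_ge0.
  by apply: le_lt_trans H _; rewrite ltry.
have iL1 := iL _ _ mS Sa; have iL2 := iL _ _ mS' Sb.
have nX0 := n2_ge0 P X.
have H : ((ip X X)%:E <= (n2 X)%:E * (a%:E + b%:E))%E.
  rewrite X2; apply: (@le_trans _ _ (\int[mu]_(u in D)
      ((n2 X)%:E * (L2dist G S u + L2dist G S' u)))%E).
    apply: le_integral => //; first exact: integrableB.
      by apply: integrableZl => //; exact: integrableD.
    move=> u; rewrite inE => Du; rewrite !L2distE ?LG// -EFinB -EFinD -EFinM lee_fin.
    have L1 := sf_eval_L2 S u; have L2' := sf_eval_L2 S' u.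
    rewrite -ipBr//; apply: le_trans (ler_norm _) _.
    apply: le_trans (cauchy_schwarz LX (L2B L1 L2')) _.
    rewrite ler_wpM2l//.
    by rewrite (n2BC (LG Du) L1); apply: n2_triangle => //; exact: LG.
  rewrite integralZl//; last exact: integrableD.
  apply: lee_wpmul2l; first by rewrite lee_fin.
  by rewrite integralD//; exact: leeD.
move: H; rewrite -EFinD -EFinM lee_fin -n2_sqr expr2.
have [->|nX] := eqVneq (n2 X) 0; last by rewrite ler_pM2l// lt0r nX.
move=> _; rewrite -lee_fin EFinD; apply: adde_ge0.
  by apply: le_trans Sa; apply: integral_ge0 => u _; exact: L2dist_ge0.
by apply: le_trans Sb; apply: integral_ge0 => u _; exact: L2dist_ge0.
Qed.

Theorem L2_integral_exists : exists I, is_L2_integral P mu D G I.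
Proof.
have p2 m : 0 < (2 ^+ m)^-1 :> R by rewrite invr_gt0 exprn_gt0.
have /choice[S HS] : forall m, exists S : simple_field P mu,
  measurable_fun D (L2dist G S) /\ (\int[mu]_(u in D) L2dist G S u <= ((2 ^+ m)^-1)%:E)%E.
  by move=> m; exact: L2_approx.
have LS m := sf_integral_L2 (S m) D.
have HX m k : (m <= k)%N ->
    n2 (fun w => sf_integral (S k) D w - sf_integral (S m) D w) <= 2 / 2 ^+ m.
  move=> mk.
  apply: le_trans (sf_integral_dist (HS k).1 (HS m).1 (HS k).2 (HS m).2) _.
  have : (2 ^+ k)^-1 <= (2 ^+ m)^-1 :> R.
    rewrite lef_pV2 ?posrE ?exprn_gt0//.
    by rewrite ler_weXn2l// ler1n.
  lra.
have [I [LI HI]] := L2_complete LS HX.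
exists I; split; [exact: LG|split=> //; exists S; split].
- by move=> m; case: (HS m).
- apply: cvge0_small => [m|e e0].
    by apply: integral_ge0 => u _; exact: L2dist_ge0.
  have [N HN] := half_pow_small e0.
  exists N => n Nn; apply: le_trans (HS n).2 _; rewrite lee_fin.
  apply: le_trans HN; rewrite lef_pV2 ?posrE ?exprn_gt0//.
  by rewrite ler_weXn2l// ler1n.
- apply: cvge0_small => [m|e e0]; first exact: Lnorm_ge0.
  have [N HN] := half_pow_small (divr_gt0 e0 (ltr0n R 2)).
  exists N => n Nn; rewrite L2normE ?L2B// lee_fin; apply: le_trans (HI n) _.
  rewrite mulrC -ler_pdivlMr//; apply: le_trans HN.
  rewrite lef_pV2 ?posrE ?exprn_gt0//.
  by rewrite ler_weXn2l// ler1n.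
Qed.

End L2_integral_existence.

(** * Continuous versions of parametrized integrals *)

Section L2_integral_ae.
Context (R : realType) (disp : measure_display) (T : measurableType disp).
Variable P : probability T R.
Context (dU : measure_display) (U : measurableType dU).
Variable mu : {measure set U -> \bar R}.
Local Notation L2 := (Lfun P 2%:E).

Lemma ae_EE_sqr (X Y : T -> R) : measurable_fun setT X -> measurable_fun setT Y ->
  {ae P, forall w, X w = Y w} ->
  EE P (fun w => X w ^+ 2) = EE P (fun w => Y w ^+ 2).
Proof.
move=> mX mY XY; apply: ae_eq_integral => //.
- by apply/measurable_EFinP; exact: measurable_funX.
- by apply/measurable_EFinP; exact: measurable_funX.
- by apply: filterS XY => w XYw _; rewrite XYw.
Qed.

Lemma is_L2_integral_ae (D : set U) (G : U -> T -> R) (I J : T -> R) :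
  is_L2_integral P mu D G I -> measurable_fun setT J ->
  {ae P, forall w, J w = I w} -> is_L2_integral P mu D G J.
Proof.
move=> [LG [LI [S [mS cS iS]]]] mJ JI; have mI := L2_measurable LI.
have LJ : J \in L2.
  by apply/L2P; split=> //; rewrite (ae_EE_sqr mJ mI JI); move/L2P: LI => [].
split=> //; split=> //; exists S; split=> //.
apply: cvg_trans iS; apply: near_eq_cvg; apply: nearW => m.
have LS := sf_integral_L2 (S m) D.
have L1 := L2B LI LS; have L2' := L2B LJ LS.
rewrite !L2normE//; congr EFin; congr Num.sqrt; apply: EFin_inj; rewrite -!ip_EE//.
apply: ae_EE_sqr; [exact: (L2_measurable L1)|exact: (L2_measurable L2')|].
by apply: filterS JI => w ->.
Qed.

End L2_integral_ae.

Lemma lipschitz_within_continuous (R : realType) (n : nat) (A : set 'rV[R]_n.+1)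
    (g : 'rV[R]_n.+1 -> R) (B : R) :
  (forall x y, A x -> A y -> `|g x - g y| <= B * `|x - y|) ->
  {within A, continuous g}.
Proof.
move=> H; apply: (subspace_continuousP _ _).2 => x Ax.
apply/cvgrPdist_lt => e e0; apply/nbhs_ballP.
have B1 : 0 < `|B| + 1 by rewrite ltr_wpDl.
exists (e / (`|B| + 1)) => /=; first exact: divr_gt0.
move=> y; rewrite -ball_normE /= ltr_pdivlMr// => xy Ay.
apply: (le_lt_trans (H x y Ax Ay)); apply: le_lt_trans xy.
rewrite mulrC ler_wpM2l//; have := ler_norm B; lra.
Qed.

Section continuous_version.
Context (R : realType) (disp : measure_display) (T : measurableType disp).
Variable P : probability T R.
Context (dU : measure_display) (U : measurableType dU).
Variable mu : {measure set U -> \bar R}.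
Context (q : nat) (tinf tsup : R).
Hypothesis htheta : tinf < tsup.
Local Notation Rq := 'rV[R]_q.+1.
Local Notation Th := (param_box (q := q.+1) tinf tsup).
Local Notation W := (tsup - tinf).
Local Notation gidx := (gidx q).
Local Notation gpt := (@gpt R q tinf tsup _).
Local Notation gfloor := (@gfloor R q tinf tsup).
Local Notation L2 := (Lfun P 2%:E).

Variables (D : set U) (G : Rq -> U -> T -> R) (psi : U -> T -> R) (f : U -> R) (M : R).
Hypothesis mD : measurable D.
Hypothesis mpsi : forall u, D u -> measurable_fun setT (psi u).
Hypothesis Gpsi : forall th th' u w, Th th -> Th th' -> D u ->
  `|G th u w - G th' u w| <= `|th - th'| * psi u w.
Hypothesis psi0 : forall u w, 0 <= psi u w.
Hypothesis psiM : forall u, D u -> (EE P (psi u) <= (M * f u)%:E)%E.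
Hypothesis M0 : 0 <= M.
Hypothesis mf : measurable_fun D f.
Hypothesis f0 : forall u, D u -> 0 <= f u.
Hypothesis f1 : (\int[mu]_(u in D) (f u)%:E = 1)%E.

Variable I : Rq -> T -> R.
Hypothesis HI : forall th, Th th -> is_L2_integral P mu D (G th) (I th).

Let LI th : Th th -> I th \in L2. Proof. by move=> hth; have [_ []] := HI hth. Qed.
Let mI th : Th th -> measurable_fun setT (I th).
Proof. by move=> hth; apply: L2_measurable; exact: LI. Qed.

Let gth m (k : gidx m) : Th (gpt k). Proof. exact: gpt_in. Qed.

Let slopes m (w : T) : R := \big[Num.max/0]_(kk : gidx m * gidx m)
  `|(I (gpt kk.1) w - I (gpt kk.2) w) / `|gpt kk.1 - gpt kk.2| |.

Let sum_pair m (kk : gidx m * gidx m) (c : R) (X : gidx m -> R) :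
  \sum_l ((l == kk.1)%:R - (l == kk.2)%:R) / c * X l = (X kk.1 - X kk.2) / c.
Proof.
have sum1 (k0 : gidx m) : \sum_l (l == k0)%:R * X l = X k0.
  rewrite (bigD1 k0)//= eqxx mul1r big1 ?addr0// => l /negbTE ->.
  by rewrite mul0r.
rewrite -[X kk.1]sum1 -[X kk.2]sum1 -sumrB mulr_suml; apply: eq_bigr => l _.
by rewrite mulrAC mulrBl.
Qed.

(** The slopes of the integrands are at most [psi], whose expectation is at most
    [M * f u]; the bound on the maximum passes to the integrals. *)
Let EE_slopes m : (EE P (slopes m) <= M%:E)%E.
Proof.
have := @L2_integral_max _ _ _ P _ _ mu (gidx m * gidx m)%type (gidx m) D
  (fun l => G (gpt l)) (fun l => I (gpt l))
  (fun kk l => ((l == kk.1)%:R - (l == kk.2)%:R) / `|gpt kk.1 - gpt kk.2|) f M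
  mD (fun l => HI (gth l)) mf f0 f1 M0.
move=> H; apply: le_trans (H _); last first.
  move=> u Du; apply: le_trans (psiM Du); apply: le_EE => //.
  - apply: measurable_bigmax => kk; apply: measurableT_comp => //.
    apply: measurable_sum => l; apply: measurable_funM => //.
    apply: L2_measurable; have [LG _] := HI (gth l); exact: LG.
  - by apply: mpsi.
  - by move=> w; exact: bigmax_ge_id.
  move=> w; apply: bigmax_le => // kk _.
  rewrite (sum_pair kk _ (fun l => G (gpt l) u w)).
  have [e|e] := eqVneq (gpt kk.1) (gpt kk.2); first by rewrite e subrr mul0r normr0.
  rewrite normrM normfV normr_id ler_pdivrMr ?normr_gt0 ?subr_eq0//.
  by rewrite mulrC; exact: Gpsi.
rewrite le_eqVlt; apply/orP; left; apply/eqP; apply: eq_EE => w.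
by apply: eq_bigr => kk _; rewrite (sum_pair kk _ (fun l => I (gpt l) w)).
Qed.

Let m_slopes m : measurable_fun setT (slopes m).
Proof.
apply: measurable_bigmax => kk; apply: measurableT_comp => //.
by apply: measurable_funM => //; apply: measurable_funB; exact: mI.
Qed.

Let slopes0 m w : 0 <= slopes m w. Proof. exact: bigmax_ge_id. Qed.

Let slopes_homo w : nondecreasing_seq (fun m => slopes m w).
Proof.
apply/nondecreasing_seqP => m; apply: bigmax_le => // -[k k'] _ /=.
have [j <-] := gpt_refine tinf tsup k; have [j' <-] := gpt_refine tinf tsup k'.
exact: (le_bigmax _ (fun kk : gidx m.+1 * gidx m.+1 =>
  `|(I (gpt kk.1) w - I (gpt kk.2) w) / `|gpt kk.1 - gpt kk.2| |) (j, j')).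
Qed.

Let lipschitz_at w B := forall m (k k' : gidx m),
  `|I (gpt k) w - I (gpt k') w| <= B * `|gpt k - gpt k'|.

Let ae_lipschitz : {ae P, forall w, exists B, 0 <= B /\ lipschitz_at w B}.
Proof.
have ms m : measurable_fun setT (fun w => (slopes m w)%:E) by exact/measurable_EFinP.
have s0 m w : setT w -> (0 <= (slopes m w)%:E)%E by rewrite lee_fin.
have nd w : setT w -> nondecreasing_seq (fun m => (slopes m w)%:E).
  by move=> _ m m' mm'; rewrite lee_fin; exact: slopes_homo.
have cv := cvg_monotone_convergence measurableT ms s0 nd; move: (cv P) => {}cv.
have mlim : measurable_fun setT (fun w => limn (fun m => (slopes m w)%:E)).
  apply: (emeasurable_fun_cvg (fun m w => (slopes m w)%:E)) => // w _.
  by apply: ereal_nondecreasing_is_cvgn; exact: nd.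
have lim0 w : setT w -> (0 <= limn (fun m => (slopes m w)%:E))%E.
  move=> _; apply: lime_ge; first by apply: ereal_nondecreasing_is_cvgn; exact: nd.
  by apply: nearW => m; rewrite lee_fin.
have il : P.-integrable setT (fun w => limn (fun m => (slopes m w)%:E)).
  apply: ge0_integrable => //; rewrite -(cvg_lim _ cv)//.
  apply: (@le_lt_trans _ _ M%:E); last by rewrite ltry.
  apply: lime_le; first by apply/cvg_ex; eexists; exact: cv.
  by apply: nearW => m; exact: EE_slopes.
have := integrable_ae measurableT il; apply: filterS => w /(_ Logic.I) fw.
have sB m : slopes m w <= fine (limn (fun m => (slopes m w)%:E)).
  rewrite -lee_fin fineK//.
  apply: lime_ge; first by apply: ereal_nondecreasing_is_cvgn; exact: nd.
  by exists m => // m' /= mm'; exact: nd.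
exists (fine (limn (fun m => (slopes m w)%:E))); split; first exact: le_trans (sB 0%N).
move=> m k k'; have [e|e] := eqVneq (gpt k) (gpt k').
  by rewrite e !subrr !normr0 mulr0.
rewrite -ler_pdivrMr ?normr_gt0 ?subr_eq0//; apply: le_trans (sB m).
have := le_bigmax 0 (fun kk : gidx m * gidx m =>
  `|(I (gpt kk.1) w - I (gpt kk.2) w) / `|gpt kk.1 - gpt kk.2| |) (k, k').
by rewrite /= normrM normfV normr_id.
Qed.

(** Approximation of the version from the grid of level [m], set to [0] on the
    null event [N] where the slopes are unbounded. *)
Let X (N : set T) (th : Rq) m (w : T) : R := I (gpt (gfloor m th)) w * \1_(~` N) w.

Let gap_small (e : R) : 0 < e -> exists N, forall m, (N <= m)%N -> W / 2 ^+ m <= e.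
Proof.
move=> e0; have W0 : 0 < W by rewrite subr_gt0.
have [N HN] := half_pow_small (divr_gt0 e0 W0); exists N => m Nm.
rewrite mulrC -ler_pdivlMr//; apply: le_trans HN.
by rewrite lef_pV2 ?posrE ?exprn_gt0// ler_weXn2l// ler1n.
Qed.

Let X_lip (N : set T) w th th' m B : 0 <= B -> lipschitz_at w B -> Th th -> Th th' ->
  `|X N th m w - X N th' m w| <= B * (`|th - th'| + 2 * (W / 2 ^+ m)).
Proof.
move=> B0 lB hth hth'; rewrite /X -mulrBl normrM.
apply: (@le_trans _ _ `|I (gpt (gfloor m th)) w - I (gpt (gfloor m th')) w|).
  by rewrite ler_piMr// indicE; case: (_ \in _); rewrite ?normr1 ?normr0.
apply: le_trans (lB _ _ _) _; rewrite ler_wpM2l//.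
have d1 := gfloor_dist htheta m hth; have d2 := gfloor_dist htheta m hth'.
rewrite distrC in d1.
apply: le_trans (ler_distD th _ _) _.
have := ler_distD th' th (gpt (gfloor m th')); lra.
Qed.

Let X_cvg (N : set T) w th B : 0 <= B -> lipschitz_at w B -> Th th ->
  cvgn (fun m => X N th m w).
Proof.
move=> B0 lB hth; apply: (@geometric_increments_cvg _ _ (2 * (B * W))) => m.
rewrite /X -mulrBl normrM.
have [k ek] := gpt_refine tinf tsup (gfloor m th).
apply: (@le_trans _ _ `|I (gpt (gfloor m.+1 th)) w - I (gpt (gfloor m th)) w|).
  by rewrite ler_piMr// indicE; case: (_ \in _); rewrite ?normr1 ?normr0.
rewrite -ek; apply: le_trans (lB _ _ _) _; rewrite ek.
have -> : 2 * (B * W) / 2 ^+ m = B * (2 * (W / 2 ^+ m)) by ring.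
rewrite ler_wpM2l//.
have d1 := gfloor_dist htheta m.+1 hth; have d2 := gfloor_dist htheta m hth.
rewrite distrC in d1.
have d3 := ler_distD th (gpt (gfloor m.+1 th)) (gpt (gfloor m th)).
have h : W / 2 ^+ m.+1 <= W / 2 ^+ m.
  rewrite ler_wpM2l ?subr_ge0 ?(ltW htheta)// lef_pV2 ?posrE ?exprn_gt0//.
  by rewrite ler_weXn2l// ler1n.
lra.
Qed.

Let EE_dist th th' : Th th -> Th th' ->
  (EE P (fun w => `|I th w - I th' w|)%R <= (M * `|th - th'|)%:E)%E.
Proof.
move=> hth hth'.
have bmax1 (x : R) : \big[Num.max/0]_(k : 'I_1) `|x| = `|x|.
  by rewrite big_ord_recl big_ord0 max_l.
have HIb (l : bool) : is_L2_integral P mu D (G (if l then th else th')) (I (if l then th else th')).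
  by case: l; exact: HI.
have := @L2_integral_max _ _ _ P _ _ mu 'I_1 bool D
  (fun l => G (if l then th else th')) (fun l => I (if l then th else th'))
  (fun _ l => if l then 1 else -1) f (M * `|th - th'|) mD HIb mf f0 f1
  (mulr_ge0 M0 (normr_ge0 _)).
have bE (F : Rq -> R) :
    \sum_(l : bool) (if l then 1 else -1) * F (if l then th else th') = F th - F th'.
  by rewrite big_bool /= mul1r mulN1r.
move=> H; apply: le_trans (H _).
  rewrite le_eqVlt; apply/orP; left; apply/eqP; apply: eq_EE => w.
  by rewrite (bE (fun th => I th w)) bmax1.
move=> u Du; under eq_EE do rewrite (bE (fun th => G th u _)) bmax1.
apply: (@le_trans _ _ (EE P (fun w => `|th - th'| * psi u w)%R)).
  apply: le_EE.
  - apply: measurableT_comp => //; apply: measurable_funB.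
      by apply: L2_measurable; have [LG _] := HI hth; exact: LG.
    by apply: L2_measurable; have [LG _] := HI hth'; exact: LG.
  - by apply: measurable_funM => //; exact: mpsi.
  - by [].
  - by move=> w; exact: Gpsi.
rewrite EEZ//; last exact: mpsi.
rewrite mulrAC mulrC EFinM; apply: lee_wpmul2l; first by rewrite lee_fin.
exact: psiM.
Qed.

(** Along the chain of grids the integrals converge in mean to [I th], hence
    almost surely to the same limit, by Fatou's lemma. *)
Let ae_limit (N : set T) (J : T -> R) th : measurable N -> P N = 0%E -> Th th ->
  (forall w, X N th m w @[m --> \oo] --> J w) -> {ae P, forall w, J w = I th w}.
Proof.
move=> mN N0 hth cJ.
have mX m : measurable_fun setT (X N th m).
  apply: measurable_funM; first exact: mI.
  by apply: measurable_indic; exact: measurableC.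
have mJ : measurable_fun setT J by apply: (measurable_fun_cvg mX) => w _; exact: cJ.
have mdist m : measurable_fun setT (fun w => `|X N th m w - I th w|).
  by apply: measurableT_comp => //; apply: measurable_funB => //; exact: mI.
have aeN : {ae P, forall w, (~` N) w} by exists N; split=> // w /= /contrapT.
have EX m : (EE P (fun w => `|X N th m w - I th w|)%R <= (M * (W / 2 ^+ m))%:E)%E.
  have -> : EE P (fun w => `|X N th m w - I th w|) =
      EE P (fun w => `|I (gpt (gfloor m th)) w - I th w|).
    apply: ae_eq_integral => //; first exact/measurable_EFinP.
      apply/measurable_EFinP; apply: measurableT_comp => //.
      by apply: measurable_funB => //; exact: mI.
    by apply: filterS aeN => w Nw _; rewrite /X indicE mem_set// mulr1.
  apply: le_trans (EE_dist _ hth) _ => //.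
  by rewrite lee_fin ler_wpM2l// distrC gfloor_dist.
have E0 : EE P (fun w => `|J w - I th w|) = 0%E.
  apply/eqP; rewrite eq_le EE_ge0 ?andbT//.
  have -> : EE P (fun w => `|J w - I th w|) =
      (\int[P]_w limn_einf (fun m => `|X N th m w - I th w|%:E))%E.
    apply: eq_integral => w _.
    have cw : `|X N th m w - I th w|%:E @[m --> \oo] --> `|J w - I th w|%:E.
      apply: cvg_EFin; first exact: nearW.
      by apply: cvg_norm; apply: cvgB => //; exact: cvg_cst.
    by rewrite (cvg_limn_einf_sup cw).1.
  apply: le_trans (fatou P measurableT _ _) _.
  - by move=> m; exact/measurable_EFinP.
  - by move=> m w _; rewrite lee_fin.
  have c0 : EE P (fun w => `|X N th m w - I th w|) @[m --> \oo] --> 0%E.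
    apply: cvge0_small => [m|e e0]; first exact: EE_ge0.
    have M1 : 0 < M + 1 by rewrite ltr_wpDl.
    have [n0 Hn0] := gap_small (divr_gt0 e0 M1); exists n0 => m nm.
    apply: le_trans (EX m) _; rewrite lee_fin.
    apply: (@le_trans _ _ (M * (e / (M + 1)))); first by rewrite ler_wpM2l// Hn0.
    by rewrite mulrCA ler_piMr ?(ltW e0)// ler_pdivrMr// mul1r lerDl.
  by rewrite (cvg_limn_einf_sup c0).1.
have mJI : measurable_fun setT (fun w => (J w - I th w)%:E).
  by apply/measurable_EFinP; apply: measurable_funB => //; exact: mI.
have : (\int[P]_w `|(J w - I th w)%:E| = 0)%E by rewrite -[RHS]E0.
move/(ae_eq_integral_abs P measurableT mJI); apply: filterS => w /(_ Logic.I)/= [] /eqP.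
by rewrite subr_eq0 => /eqP.
Qed.

(** Outside a null event the integrals are Lipschitz on the union of the grids;
    the extension by continuity agrees almost surely with [I th] for each [th]. *)
Theorem L2_integral_continuous_version : exists J : Rq -> T -> R,
  (forall th, Th th -> is_L2_integral P mu D (G th) (J th)) /\
  (forall w, {within Th, continuous (fun th => J th w)}).
Proof.
have [N [mN N0 HN]] := ae_lipschitz.
have lip w : exists B, [/\ 0 <= B,
    forall th, Th th -> cvgn (fun m => X N th m w) &
    forall th th' m, Th th -> Th th' ->
      `|X N th m w - X N th' m w| <= B * (`|th - th'| + 2 * (W / 2 ^+ m))].
  have [Nw|Nw] := pselect (N w).
    have X0 th m : X N th m w = 0 by rewrite /X indicE memNset ?mulr0//; exact.
    exists 0; split=> // [th _|th th' m _ _]; last by rewrite !X0 subrr normr0 mul0r.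
    by under eq_fun do rewrite X0; exact: is_cvg_cst.
  have [B [B0 lB]] : exists B, 0 <= B /\ lipschitz_at w B.
    by apply: contrapT => nB; apply: Nw; exact: HN.
  exists B; split=> // [th hth|th th' m hth hth']; first exact: X_cvg lB hth.
  exact: X_lip.
pose J th w := limn (fun m => X N th m w).
have cJ th w : Th th -> X N th m w @[m --> \oo] --> J th w.
  by move=> hth; have [B [_ cB _]] := lip w; exact: cB.
exists J; split=> [th hth|w].
  apply: is_L2_integral_ae (HI hth) _ _.
    apply: (@measurable_fun_cvg _ _ _ _ (X N th)) => [m|u _]; last exact: cJ.
    apply: measurable_funM; first exact: mI.
    by apply: measurable_indic; exact: measurableC.
  by apply: (ae_limit mN N0 hth) => u; exact: cJ.
have [B [B0 _ HB]] := lip w.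
apply: (lipschitz_within_continuous (B := B)) => th th' hth hth'.
apply/ler_addgt0Pr => e e0.
have B1 : 0 < B + 1 by lra.
have e4 : 0 < e / (2 * (B + 1)) by rewrite divr_gt0// mulr_gt0.
have [n0 Hn0] := gap_small e4.
have c1 : `|X N th m w - X N th' m w| @[m --> \oo] --> `|J th w - J th' w|.
  by apply: cvg_norm; apply: cvgB; exact: cJ.
rewrite -(cvg_lim _ c1)//; apply: limr_le.
  by apply/cvg_ex; eexists; exact: c1.
exists n0 => // m /= nm; apply: le_trans (HB th th' m hth hth') _.
rewrite mulrDr lerD2l.
apply: (@le_trans _ _ (B * (2 * (e / (2 * (B + 1)))))).
  by rewrite !ler_wpM2l// Hn0.
have -> : B * (2 * (e / (2 * (B + 1)))) = e * (B / (B + 1)).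
  by field; rewrite gt_eqF.
by rewrite ler_piMr ?(ltW e0)// ler_pdivrMr// mul1r lerDl.
Qed.

End continuous_version.

(** * Prediction weights *)

Section linear_systems.
Context (R : realType) (N : nat).
Variable delta : R.
Hypothesis delta0 : 0 < delta.

Definition coercive (A : 'M[R]_N) : Prop :=
  A^T = A /\ forall v : 'rV[R]_N, delta * sqn v <= (v *m A *m v^T) ord0 ord0.

Lemma mulmx_invmx_coercive (A : 'M[R]_N) (s : 'cV[R]_N) :
  coercive A -> A *m (invmx A *m s) = s.
Proof. by move=> [sA qA]; rewrite mulKVmx//; exact: quadratic_unitmx sA delta0 qA. Qed.

Lemma sqn_le_mulmx (A : 'M[R]_N) (v : 'cV[R]_N) : coercive A ->
  sqn v <= sqn (A *m v) / delta ^+ 2.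
Proof.
move=> [sA qA]; rewrite ler_pdivlMr ?exprn_gt0// mulrC.
exact: quadratic_sqn_ge.
Qed.

Lemma sqn_solution (A : 'M[R]_N) (s : 'cV[R]_N) : coercive A ->
  sqn (invmx A *m s) <= sqn s / delta ^+ 2.
Proof.
move=> cA; apply: le_trans (sqn_le_mulmx _ cA) _.
by rewrite mulmx_invmx_coercive.
Qed.

(** Comparing the two systems in the first matrix turns the difference of the
    solutions into that of the data:
    [A (a - a') = (s - s') - (A - A') a']. *)
Lemma sqn_solution_dist (A A' : 'M[R]_N) (s s' : 'cV[R]_N) (r : R) :
  coercive A -> coercive A' -> (forall i, \sum_j `|(A - A') i j| <= r) ->
  sqn (invmx A *m s - invmx A' *m s') <=
    (2 * sqn (s - s') + 2 * (r ^+ 2 * (sqn s' / delta ^+ 2))) / delta ^+ 2.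
Proof.
move=> cA cA' rs; apply: le_trans (sqn_le_mulmx _ cA) _.
rewrite ler_wpM2r ?invr_ge0 ?exprn_ge0 ?(ltW delta0)//.
set a := invmx A *m s; set a' := invmx A' *m s'.
have -> : A *m (a - a') = (s - s') - (A - A') *m a'.
  rewrite mulmxBr mulmxBl mulmx_invmx_coercive// [A' *m a']mulmx_invmx_coercive//.
  by rewrite opprB addrA subrK.
apply: le_trans (sqnB_le _ _) _; rewrite lerD2l ler_wpM2l//.
apply: (@le_trans _ _ (r ^+ 2 * sqn a')).
  apply: schur_test => //; rewrite linearB /=.
  by case: cA => -> _; case: cA' => -> _.
by rewrite ler_wpM2l ?sqr_ge0//; exact: sqn_solution.
Qed.

Lemma invmx_coercive_tr (A : 'M[R]_N) (s z : 'cV[R]_N) : coercive A ->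
  s^T *m invmx A *m z = (invmx A *m s)^T *m z.
Proof. by move=> [sA _]; rewrite trmx_mul trmx_inv sA. Qed.

End linear_systems.

Section kernel_matrices.
Context (R : realType) (d p : nat).
Local Notation Rd := 'rV[R]_d.+1.
Local Notation kernel := (Rd -> 'M[R]_p.+1).
Variable x : nat -> Rd.
Implicit Types r : kernel.

(** A kernel [r] stands for a covariance function at a fixed parameter, tapered or
    not: [kernel_mx] and [kernel_vec] are then the covariance matrix of the data
    and their covariances with the predicted variable. *)
Definition kernel_vec (n : nat) r (u : Rd) : 'cV[R]_(p.+1 * n) :=
  \col_i r (u - x (unpair i).2) ord0 (unpair i).1.

Definition kernel_mx (n : nat) r : 'M[R]_(p.+1 * n) :=
  cov_mx r (fun a : 'I_n => x a).

Definition weights (n : nat) r (u : Rd) : 'cV[R]_(p.+1 * n) :=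
  invmx (kernel_mx n r) *m kernel_vec n r u.

Lemma sum_unpair n (F : 'I_p.+1 -> 'I_n -> R) :
  \sum_(i < p.+1 * n) F (unpair i).1 (unpair i).2 = \sum_k \sum_b F k b.
Proof.
rewrite pair_big /= (reindex (fun kb => mxvec_index kb.1 kb.2)) /=.
  by apply: eq_bigr => -[k b] _; rewrite unpairK.
exists (fun i => unpair i) => [[k b] _|i _]; first by rewrite unpairK.
exact: mxvec_unindex.
Qed.

Definition kernel_sums (n : nat) r (rho : R) : Prop :=
  forall k l u, \sum_(b < n) `|r (u - x b) k l| <= rho.

Lemma kernel_mx_rows n r rho i : kernel_sums n r rho ->
  \sum_j `|kernel_mx n r i j| <= p.+1%:R * rho.
Proof.
move=> H; pose F l (b : 'I_n) := `|r (x (unpair i).2 - x b) (unpair i).1 l|.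
rewrite (eq_bigr (fun j => F (unpair j).1 (unpair j).2)); last first.
  by move=> j _; rewrite mxE.
rewrite sum_unpair; apply: (@le_trans _ _ (\sum_(k < p.+1) rho)).
  by apply: ler_sum => k _; exact: H.
by rewrite sumr_const card_ord mulr_natl.
Qed.

Lemma kernel_vec_sqn n r rho B u : kernel_sums n r rho ->
  (forall h k l, `|r h k l| <= B) -> sqn (kernel_vec n r u) <= p.+1%:R * (B * rho).
Proof.
move=> H HB; pose F l (b : 'I_n) := r (u - x b) ord0 l ^+ 2.
rewrite sqn_col (eq_bigr (fun j => F (unpair j).1 (unpair j).2)); last first.
  by move=> j _; rewrite mxE.
have B0 : 0 <= B by apply: le_trans (HB 0 ord0 ord0).
rewrite sum_unpair; apply: (@le_trans _ _ (\sum_(k < p.+1) B * rho)).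
  apply: ler_sum => k _; apply: le_trans (_ : B * \sum_(b < n) `|r (u - x b) ord0 k| <= _).
    rewrite mulr_sumr; apply: ler_sum => b _.
    by rewrite /F -real_normK ?num_real// expr2 ler_wpM2r.
  by rewrite ler_wpM2l//; exact: H.
by rewrite sumr_const card_ord mulr_natl.
Qed.

Lemma kernel_mxB n r r' :
  kernel_mx n r - kernel_mx n r' = kernel_mx n (fun h => r h - r' h).
Proof. by apply/matrixP => i j; rewrite !mxE. Qed.

Lemma kernel_vecB n r r' u :
  kernel_vec n r u - kernel_vec n r' u = kernel_vec n (fun h => r h - r' h) u.
Proof. by apply/matrixP => i j; rewrite !mxE. Qed.

Variables (n : nat) (delta : R).
Hypothesis delta0 : 0 < delta.

Lemma weights_sqn r rho B u : coercive delta (kernel_mx n r) ->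
  kernel_sums n r rho -> (forall h k l, `|r h k l| <= B) ->
  sqn (weights n r u) <= p.+1%:R * (B * rho) / delta ^+ 2.
Proof.
move=> cr sr br; apply: le_trans (sqn_solution delta0 _ cr) _.
rewrite ler_wpM2r ?invr_ge0 ?exprn_ge0 ?(ltW delta0)//.
exact: kernel_vec_sqn.
Qed.

Definition weights_gap (rho B rho' B' : R) : R :=
  (2 * (p.+1%:R * (B' * rho')) +
   2 * ((p.+1%:R * rho') ^+ 2 * (p.+1%:R * (B * rho) / delta ^+ 2))) / delta ^+ 2.

Lemma weights_dist r r' rho B rho' B' u :
  coercive delta (kernel_mx n r) -> coercive delta (kernel_mx n r') ->
  kernel_sums n r' rho -> (forall h k l, `|r' h k l| <= B) ->
  kernel_sums n (fun h => r h - r' h) rho' ->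
  (forall h k l, `|(r h - r' h) k l| <= B') ->
  sqn (weights n r u - weights n r' u) <= weights_gap rho B rho' B'.
Proof.
move=> cr cr' sr br sd bd.
apply: le_trans (sqn_solution_dist (r := p.+1%:R * rho') delta0 _ _ cr cr' _) _.
  by move=> i; rewrite kernel_mxB; exact: kernel_mx_rows.
rewrite ler_wpM2r ?invr_ge0 ?exprn_ge0 ?(ltW delta0)//.
apply: lerD; rewrite ler_wpM2l//.
  by rewrite kernel_vecB; exact: kernel_vec_sqn.
rewrite ler_wpM2l ?sqr_ge0// ler_wpM2r ?invr_ge0 ?exprn_ge0 ?(ltW delta0)//.
exact: kernel_vec_sqn.
Qed.

Lemma weights_space_dist r u v : coercive delta (kernel_mx n r) ->
  sqn (weights n r u - weights n r v) <=
    sqn (kernel_vec n r u - kernel_vec n r v) / delta ^+ 2.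
Proof. by move=> cr; rewrite -mulmxBr; exact: sqn_solution. Qed.

End kernel_matrices.

Section model_bounds.
Context (R : realType) (d p q : nat).
Local Notation Rd := 'rV[R]_d.+1.
Local Notation Rq := 'rV[R]_q.+1.
Variables (tinf tsup : R).
Local Notation Th := (param_box (q := q.+1) tinf tsup).
Variables (C : Rd -> Rq -> 'M[R]_p.+1) (t : Rd -> 'M[R]_p.+1).
Variables (x : nat -> Rd) (gamma : nat -> R).
Hypothesis htheta : tinf < tsup.
Hypothesis hC_cov : forall th, Th th -> stationary_covariance (fun h => C h th).
Hypothesis ht_cov : stationary_covariance t.
Hypothesis hgamma : forall n, 0 < gamma n.
Hypothesis h_taper : taper_condition t gamma.
Hypothesis h_C1 : forall u k l, C1_on Th (fun th => C u th k l).

Variables (A alpha Delta delta : R).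
Hypothesis alpha0 : 0 < alpha.
Hypothesis C_decay : forall k l u th, Th th -> `|C u th k l| <= A * decay alpha u.
Hypothesis dC_decay : forall k l i u th, Th th ->
  `|partial_on Th (fun th => C u th k l) i th| <= A * decay alpha u.
Hypothesis Delta0 : 0 < Delta.
Hypothesis sep : forall a b : nat, a != b -> Delta <= `|x a - x b|.
Variable S : R.
Hypothesis S_sum : forall (n : nat) u, \sum_(b < n) decay alpha (u - x b) <= S.
Hypothesis delta0 : 0 < delta.
Hypothesis eigS : forall n th, (0 < n)%N -> Th th ->
  delta <= lambda (Sigma C x n th) (p.+1 * n).
Hypothesis eigK : forall n th, (0 < n)%N -> Th th ->
  delta <= lambda (K C t x gamma n th) (p.+1 * n).

Definition tapered (n : nat) (th : Rq) (h : Rd) : 'M[R]_p.+1 :=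
  \matrix_(k, l) (C h th k l * t ((gamma n)^-1 *: h) k l).

Lemma K_kernel n th : K C t x gamma n th = kernel_mx x n (tapered n th).
Proof. by apply/matrixP => i j; rewrite !mxE. Qed.

Lemma k_vec_kernel n th u : k_vec C t x gamma n th u = kernel_vec x n (tapered n th) u.
Proof. by apply/matrixP => i j; rewrite !mxE. Qed.

Let x_inj n : injective (fun a : 'I_n => x a).
Proof.
move=> a b ab; apply: val_inj; apply/eqP; apply/negPn/negP => /sep.
by rewrite ab subrr normr0 leNgt Delta0.
Qed.

Lemma A_ge0 : 0 <= A.
Proof.
have th0 : Th (const_mx tinf) by move=> i; rewrite mxE lexx ltW.
have := le_trans (normr_ge0 _) (C_decay ord0 ord0 0 th0).
by rewrite pmulr_lge0// invr_gt0 decay_den_gt0.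
Qed.

Lemma Sigma_coercive n th : Th th -> coercive delta (Sigma C x n th).
Proof.
move=> hth; have [sS _] := hC_cov hth (@x_inj n); split=> // v.
apply: eigvals_quadratic => //.
by rewrite muln_gt0 => /andP[_ n0]; exact: eigS.
Qed.

Lemma K_coercive n th : Th th -> coercive delta (kernel_mx x n (tapered n th)).
Proof.
move=> hth; rewrite -K_kernel.
have [sS _] := hC_cov hth (@x_inj n).
have yinj : injective (fun a : 'I_n => (gamma n)^-1 *: x a).
  by move=> a b /(scalerI (invr_neq0 (lt0r_neq0 (hgamma n)))); exact: x_inj.
have [sT _] := ht_cov yinj.
have sK : (K C t x gamma n th)^T = K C t x gamma n th.
  apply/matrixP => i j; rewrite !mxE.
  have /matrixP/(_ i j) := sS; rewrite !mxE => ->.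
  have /matrixP/(_ i j) := sT; rewrite !mxE -!scalerBr => ->.
  by [].
split=> // v; apply: eigvals_quadratic => //.
by rewrite muln_gt0 => /andP[_ n0]; exact: eigK.
Qed.


Lemma decay_sums (B : R) (r : Rd -> 'M[R]_p.+1) n : 0 <= B ->
  (forall h k l, `|r h k l| <= B * decay alpha h) -> kernel_sums x n r (B * S).
Proof.
move=> B0 H k l u; apply: (@le_trans _ _ (B * \sum_(b < n) decay alpha (u - x b))).
  by rewrite mulr_sumr; apply: ler_sum => b _; exact: H.
by rewrite ler_wpM2l.
Qed.

Lemma decay_bound (B : R) (r : Rd -> 'M[R]_p.+1) : 0 <= B ->
  (forall h k l, `|r h k l| <= B * decay alpha h) ->
  forall h k l, `|r h k l| <= B.
Proof.
by move=> B0 H h k l; apply: le_trans (H h k l) _; rewrite ler_piMr// decay_le1.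
Qed.

Lemma taper_le1 k l u : `|t u k l| <= 1.
Proof. by have [H _] := h_taper; have [_ _] := H k l; apply. Qed.

Lemma tapered_decay n th h k l : Th th -> `|tapered n th h k l| <= A * decay alpha h.
Proof.
move=> hth; rewrite mxE normrM -[leRHS]mulr1.
by apply: ler_pM => //; [exact: C_decay|exact: taper_le1].
Qed.

Lemma C_lipschitz k l h th th' : Th th -> Th th' ->
  `|C h th k l - C h th' k l| <= q.+1%:R * A * `|th - th'| * decay alpha h.
Proof.
move=> hth hth'.
have -> : q.+1%:R * A * `|th - th'| * decay alpha h =
  q.+1%:R * (A * decay alpha h) * `|th - th'| by ring.
by apply: (lipschitz_box (h_C1 h k l) _ hth hth') => i th1 h1; exact: dC_decay.
Qed.

Lemma tapered_lipschitz n k l h th th' : Th th -> Th th' ->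
  `|tapered n th h k l - tapered n th' h k l| <=
    q.+1%:R * A * `|th - th'| * decay alpha h.
Proof.
move=> hth hth'; rewrite !mxE -mulrBl normrM -[leRHS]mulr1.
by apply: ler_pM => //; [exact: C_lipschitz|exact: taper_le1].
Qed.

Definition weight_cst : R := p.+1%:R * (A * (A * S)) / delta ^+ 2.

Definition weight_lip : R := Num.sqrt
  (weights_gap p delta (A * S) A (q.+1%:R * A * S) (q.+1%:R * A)) + 1.

Lemma S_ge0 : 0 <= S. Proof. by have := S_sum 0%N 0; rewrite big_ord0. Qed.

Lemma weight_cst_ge0 : 0 <= weight_cst.
Proof.
have A0 := A_ge0; have S0 := S_ge0.
rewrite divr_ge0 ?exprn_ge0 ?(ltW delta0)//; by do !apply: mulr_ge0.
Qed.


Lemma weight_lip_gt0 : 0 < weight_lip.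
Proof. by rewrite ltr_wpDl// sqrtr_ge0. Qed.

(** Both families of kernels, tapered or not, satisfy the same bounds. *)
Definition admissible_family (n : nat) (r : Rq -> Rd -> 'M[R]_p.+1) : Prop :=
  [/\ forall th, Th th -> coercive delta (kernel_mx x n (r th)),
      forall th h k l, Th th -> `|r th h k l| <= A * decay alpha h &
      forall th th' h k l, Th th -> Th th' ->
        `|r th h k l - r th' h k l| <= q.+1%:R * A * `|th - th'| * decay alpha h].

Lemma C_admissible n : admissible_family n (fun th h => C h th).
Proof.
split; [exact: Sigma_coercive|by move=> *; exact: C_decay|].
by move=> *; exact: C_lipschitz.
Qed.

Lemma tapered_admissible n : admissible_family n (tapered n).
Proof.
split; [exact: K_coercive|by move=> *; exact: tapered_decay|].
by move=> *; exact: tapered_lipschitz.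
Qed.

Lemma weights_bounded n r th u : admissible_family n r -> Th th ->
  sqn (weights x n (r th) u) <= weight_cst.
Proof.
move=> [cr dr _] hth; apply: weights_sqn => //; first exact: cr.
  by apply: decay_sums => [|h k l]; [exact: A_ge0|exact: dr].
by apply: decay_bound => [|h k l]; [exact: A_ge0|exact: dr].
Qed.

Lemma weights_lipschitz n r th th' u : admissible_family n r -> Th th -> Th th' ->
  sqn (weights x n (r th) u - weights x n (r th') u) <= (weight_lip * `|th - th'|) ^+ 2.
Proof.
move=> [cr dr lr] hth hth'; have A0 := A_ge0; have S0 := S_ge0.
pose B' := q.+1%:R * A * `|th - th'|.
have B'0 : 0 <= B' by rewrite !mulr_ge0.
have dB' h k l : `|(r th h - r th' h) k l| <= B' * decay alpha h.
  by rewrite !mxE; exact: lr.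
apply: (@le_trans _ _ (weights_gap p delta (A * S) A (B' * S) B')).
  apply: weights_dist => //; [exact: cr|exact: cr| | | |].
  - by apply: decay_sums => // h k l; exact: dr.
  - by apply: decay_bound => // h k l; exact: dr.
  - exact: decay_sums.
  - exact: decay_bound.
have -> : weights_gap p delta (A * S) A (B' * S) B' =
    weights_gap p delta (A * S) A (q.+1%:R * A * S) (q.+1%:R * A) * `|th - th'| ^+ 2.
  by rewrite /weights_gap /B'; field; rewrite gt_eqF.
rewrite exprMn ler_wpM2r ?sqr_ge0// /weight_lip.
set g := weights_gap _ _ _ _ _ _.
have g0 : 0 <= g.
  rewrite divr_ge0 ?exprn_ge0 ?(ltW delta0)// addr_ge0// mulr_ge0//.
    by do !apply: mulr_ge0.
  rewrite mulr_ge0 ?sqr_ge0// divr_ge0 ?exprn_ge0 ?(ltW delta0)//.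
  by do !apply: mulr_ge0.
rewrite -{1}(sqr_sqrtr g0) lerXn2r ?nnegrE ?addr_ge0 ?sqrtr_ge0//.
by rewrite lerDl.
Qed.

(** The difference of both kernels is at most [A * decay alpha h] times the
    distance from the taper to [1]: its sums along the observation points tend to
    [0] uniformly. *)
Lemma weights_taper_small (eps : R) : 0 < eps ->
  exists N, forall n, (N <= n)%N -> forall th u, Th th ->
    sqn (weights x n (fun h => C h th) u - weights x n (tapered n th) u) <= eps.
Proof.
move=> eps0; have A0 := A_ge0; have S0 := S_ge0.
pose c := (2 * (p.+1%:R * (2 * A)) * A +
  2 * ((p.+1%:R * A) ^+ 2 * weight_cst)) / delta ^+ 2 + 1.
have c0 : 0 < c.
  rewrite ltr_wpDl// divr_ge0 ?exprn_ge0 ?(ltW delta0)// addr_ge0//.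
    by do !apply: mulr_ge0.
  by apply: mulr_ge0 => //; apply: mulr_ge0; [exact: sqr_ge0|exact: weight_cst_ge0].
pose eta := Num.min 1 (eps / c).
have eta0 : 0 < eta by rewrite lt_min ltr01 divr_gt0.
have [tc gy] := h_taper.
have /choice[Nkl HN] : forall kl : 'I_p.+1 * 'I_p.+1, exists N : nat,
    forall n, (N <= n)%N -> forall (m : nat) (u : Rd),
    \sum_(b < m) decay alpha (u - x b) *
      `|1 - t ((gamma n)^-1 *: (u - x b)) kl.1 kl.2| <= eta.
  move=> [k l] /=; have [t0 t1 t2] := tc k l.
  exact: (taper_sum_small Delta0 sep (t := fun u => t u k l)).
exists (\max_(kl : 'I_p.+1 * 'I_p.+1) Nkl kl)%N => n Nn th u hth.
have sums : kernel_sums x n (fun h => C h th - tapered n th h) (A * eta).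
  move=> k l v.
  have := HN (k, l) n (leq_trans (leq_bigmax (k, l)) Nn) n v => /= H.
  apply: le_trans (ler_wpM2l A0 H); rewrite mulr_sumr; apply: ler_sum => b _.
  rewrite !mxE; set h := v - x b.
  rewrite -[X in `|X - _|]mulr1 -mulrBr normrM mulrA ler_wpM2r//.
  exact: C_decay.
have bnd h k l : `|(C h th - tapered n th h) k l| <= 2 * A.
  rewrite !mxE; apply: le_trans (ler_normB _ _) _; rewrite normrM mulrDl mul1r.
  have H := decay_bound A0 (fun h k l => C_decay k l h hth) h k l.
  apply: lerD => //; rewrite -[leRHS]mulr1; apply: ler_pM => //.
  exact: taper_le1.
have [_ dk _] := tapered_admissible n.
apply: (@le_trans _ _ (weights_gap p delta (A * S) A (A * eta) (2 * A))).
  apply: weights_dist => //; [exact: Sigma_coercive|exact: K_coercive| |].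
    by apply: decay_sums => // h k l; exact: dk.
  by apply: decay_bound => // h k l; exact: dk.
apply: (@le_trans _ _ (c * eta)); last first.
  by rewrite mulrC -ler_pdivlMr// ge_min lexx orbT.
have eta1 : eta <= 1 by rewrite ge_min lexx.
have w0 := weight_cst_ge0; set w := weight_cst in w0 *.
rewrite /weights_gap -[p.+1%:R * (A * (A * S)) / _]/weight_cst -/w.
have id2 : 0 <= (delta ^+ 2)^-1 by rewrite invr_ge0 exprn_ge0// ltW.
rewrite /c -/w [leRHS]mulrDl mul1r; apply: ler_wpDr; first exact: ltW.
rewrite [leRHS]mulrAC ler_wpM2r// [leRHS]mulrDl lerD//; first by rewrite !mulrA.
rewrite -[leRHS]mulrA ler_wpM2l//.
have -> : (p.+1%:R * (A * eta)) ^+ 2 * w = (p.+1%:R * A) ^+ 2 * w * (eta * eta) by ring.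
rewrite ler_wpM2l ?mulr_ge0 ?sqr_ge0//.
by rewrite ler_piMl// ltW.
Qed.

End model_bounds.

(** * Uniform comparison of both squared errors *)

Section gaussian_combinations.
Context (R : realType) (d p : nat).
Local Notation Rd := 'rV[R]_d.+1.
Context (disp : measure_display) (T : measurableType disp).
Variable P : probability T R.
Local Notation L2 := (Lfun P 2%:E).
Local Notation n2 := (n2 P).
Local Notation ip := (ip P).

Variables (D : set Rd) (Z : 'I_p.+1 -> Rd -> {RV P >-> R}).
Variables (C0 : Rd -> 'M[R]_p.+1) (x : nat -> Rd).
Hypothesis hZ_gauss : gaussian_process D Z.
Hypothesis hZ_mean : forall k s, D s -> ('E_P[Z k s] = 0)%E.
Hypothesis hZ_cov : forall k l s h, D s -> D (s + h) ->
  covariance P (Z k s) (Z l (s + h)) = (C0 h k l)%:E.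
Hypothesis hx_D : forall a, D (x a).

Variables (A alpha S : R).
Hypothesis A0 : 0 <= A.
Hypothesis C0_decay : forall k l h, `|C0 h k l| <= A * decay alpha h.
Hypothesis S_sum : forall (n : nat) u, \sum_(b < n) decay alpha (u - x b) <= S.

Lemma S_sum_ge0 : 0 <= S.
Proof. by have := S_sum 0%N 0; rewrite big_ord0. Qed.

Lemma field_moment k l s s' : D s -> D s' ->
  (\int[P]_w (Z k s w * Z l s' w)%:E = (C0 (s' - s) k l)%:E)%E.
Proof.
move=> Ds Ds'; have := @hZ_cov k l s (s' - s) Ds.
rewrite addrC subrK => /(_ Ds') <-.
rewrite unlock; rewrite !hZ_mean//= unlock.
by apply: eq_integral => w _; rewrite -[RHS]/(((Z k s w - 0) * (Z l s' w - 0))%:E) !subr0.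
Qed.

Lemma field_L2 k s : D s -> (Z k s : T -> R) \in L2.
Proof.
move=> Ds; apply/L2P; split; first exact: measurable_funPT.
have -> : EE P (fun w => Z k s w ^+ 2) = (C0 (s - s) k k)%:E.
  by rewrite -field_moment//; apply: eq_integral => w _; rewrite expr2.
by rewrite ltry.
Qed.

Lemma field_ip k l s s' : D s -> D s' -> ip (Z k s) (Z l s') = C0 (s' - s) k l.
Proof. by move=> Ds Ds'; rewrite /ip /Rintegral field_moment. Qed.

Definition data_comb (n : nat) (v : 'cV[R]_(p.+1 * n)) (w : T) : R :=
  \sum_(i < p.+1 * n) v i ord0 * Z (unpair i).1 (x (unpair i).2) w.

(** Up to squaring, every random quantity of the model is such a linear
    combination of the data and of the predicted variable. *)
Definition combination (n : nat) (v : 'cV[R]_(p.+1 * n)) (c : R) (u : Rd) (w : T) : R :=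
  data_comb v w - c * Z ord0 u w.

Lemma data_combE n (v : 'cV[R]_(p.+1 * n)) w :
  (v^T *m obs x Z n w) ord0 ord0 = data_comb v w.
Proof. by rewrite mxE; apply: eq_bigr => i _; rewrite !mxE. Qed.

Lemma data_combD n (v v' : 'cV[R]_(p.+1 * n)) w :
  data_comb (v + v') w = data_comb v w + data_comb v' w.
Proof. by rewrite /data_comb -big_split; apply: eq_bigr => i _; rewrite mxE mulrDl. Qed.

Lemma data_combB n (v v' : 'cV[R]_(p.+1 * n)) w :
  data_comb (v - v') w = data_comb v w - data_comb v' w.
Proof. by rewrite /data_comb -sumrB; apply: eq_bigr => i _; rewrite !mxE mulrBl. Qed.

Lemma combinationB n (v v' : 'cV[R]_(p.+1 * n)) c c' u w :
  combination v c u w - combination v' c' u w = combination (v - v') (c - c') u w.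
Proof. by rewrite /combination data_combB; ring. Qed.

Lemma combinationD n (v v' : 'cV[R]_(p.+1 * n)) c c' u w :
  combination v c u w + combination v' c' u w = combination (v + v') (c + c') u w.
Proof. by rewrite /combination data_combD; ring. Qed.

Lemma data_L2 n (v : 'cV[R]_(p.+1 * n)) : data_comb v \in L2.
Proof. by apply: L2_sum => i; apply: L2Z; exact: field_L2. Qed.

Lemma combination_L2 n (v : 'cV[R]_(p.+1 * n)) c u : D u -> combination v c u \in L2.
Proof. by move=> Du; apply: L2B; [exact: data_L2|apply: L2Z; exact: field_L2]. Qed.

Lemma combination_measurable n (v : 'cV[R]_(p.+1 * n)) c u :
  D u -> measurable_fun setT (combination v c u).
Proof. by move=> Du; apply: L2_measurable; exact: combination_L2. Qed.

Let row_cst := p.+1%:R * (A * S).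

(** The covariance matrix of the data satisfies the hypothesis of the Schur
    test, by decay of the covariances. *)
Lemma data_second_moment n (v : 'cV[R]_(p.+1 * n)) :
  ip (data_comb v) (data_comb v) <= row_cst * sqn v.
Proof.
set zv := data_comb v; pose z (i : 'I_(p.+1 * n)) : T -> R := Z (unpair i).1 (x (unpair i).2).
have Lz i : z i \in L2 by exact: field_L2.
pose Gam : 'M[R]_(p.+1 * n) := \matrix_(i, j) ip (z i) (z j).
have symG : Gam^T = Gam by apply/matrixP => i j; rewrite !mxE ipC.
have S0 := S_sum_ge0.
have rowG i : \sum_j `|Gam i j| <= row_cst.
  pose F l (b : 'I_n) := `|C0 (x b - x (unpair i).2) (unpair i).1 l|.
  rewrite (eq_bigr (fun j => F (unpair j).1 (unpair j).2)); last first.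
    by move=> j _; rewrite mxE /z field_ip.
  rewrite sum_unpair; apply: (@le_trans _ _ (\sum_(k < p.+1) A * S)).
    apply: ler_sum => l _.
    apply: (@le_trans _ _ (A * \sum_(b < n) decay alpha (x (unpair i).2 - x b))).
      rewrite mulr_sumr; apply: ler_sum => b _.
      by rewrite -decayN opprB; exact: C0_decay.
    by rewrite ler_wpM2l.
  by rewrite sumr_const card_ord /row_cst mulr_natl.
have row0 : 0 <= row_cst by rewrite /row_cst !mulr_ge0.
have ipE : ip zv zv = (v^T *m (Gam *m v)^T^T) ord0 ord0.
  have Lzv : zv \in L2 by exact: data_L2.
  have Lvz i : (fun w => v i ord0 * z i w) \in L2 by exact: L2Z.
  rewrite trmxK {2}/zv /data_comb ip_sumr//.
  rewrite mxE; apply: eq_bigr => j _; rewrite ipZr//; last exact: (Lz j).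
  rewrite ipC /zv /data_comb ip_sumr//; last exact: (Lz j).
  rewrite !mxE; congr (_ * _); apply: eq_bigr => i _.
  by rewrite (ipZr _ (Lz j) (Lz i)) [RHS]mulrC mxE.
have CS := cauchy_schwarz_row v^T (Gam *m v)^T; rewrite -ipE !sqn_tr in CS.
have ST := schur_test symG rowG v.
have s0 := sqn_ge0 v.
rewrite -(@ler_pXn2r _ 2)// ?nnegrE ?ip_ge0 ?mulr_ge0//.
apply: (le_trans CS); apply: le_trans (ler_wpM2l s0 ST) _.
by rewrite le_eqVlt; apply/orP; left; apply/eqP; ring.
Qed.

Definition comb_cst : R := 2 * row_cst + 2 * A + 1.

Lemma comb_cst_gt0 : 0 < comb_cst.
Proof.
have S0 := S_sum_ge0.
by rewrite ltr_wpDl// addr_ge0// mulr_ge0// /row_cst !mulr_ge0.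
Qed.

Lemma combination_second_moment n (v : 'cV[R]_(p.+1 * n)) c u : D u ->
  (EE P (fun w => combination v c u w ^+ 2)%R <= (comb_cst * (sqn v + c ^+ 2))%:E)%E.
Proof.
move=> Du; have S0 := S_sum_ge0.
have LZ := field_L2 ord0 Du.
pose zv : T -> R := data_comb v.
have Lzv : zv \in L2 by exact: data_L2.
have LcZ := L2Z c LZ.
apply: (@le_trans _ _ (EE P (fun w => 2 * zv w ^+ 2 + 2 * (c * Z ord0 u w) ^+ 2)%R)).
  apply: le_EE.
  - by apply: measurable_funX; exact: combination_measurable.
  - apply: measurable_funD; apply: measurable_funM => //; apply: measurable_funX.
      exact: (L2_measurable Lzv).
    exact: (L2_measurable LcZ).
  - by move=> w; exact: sqr_ge0.
  - move=> w; rewrite /combination -/(zv w) -subr_ge0.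
    set b := c * _; have -> : 2 * zv w ^+ 2 + 2 * b ^+ 2 - (zv w - b) ^+ 2 =
      (zv w + b) ^+ 2 by ring.
    exact: sqr_ge0.
rewrite EED; [|apply: measurable_funM => //; apply: measurable_funX; exact: (L2_measurable Lzv)|
  apply: measurable_funM => //; apply: measurable_funX; exact: (L2_measurable LcZ)|
  by move=> w; rewrite mulr_ge0 ?sqr_ge0|by move=> w; rewrite mulr_ge0 ?sqr_ge0].
rewrite !EEZ//; [|by apply: measurable_funX; exact: (L2_measurable LcZ)|
  by move=> w; exact: sqr_ge0|by apply: measurable_funX; exact: (L2_measurable Lzv)|
  by move=> w; exact: sqr_ge0].
rewrite !ip_EE// -!EFinM -EFinD lee_fin.
have H1 := data_second_moment v; rewrite -/zv in H1.
have H2 : ip (fun w => c * Z ord0 u w) (fun w => c * Z ord0 u w) <= c ^+ 2 * A.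
  rewrite ipZr// ipC ipZr// mulrA -expr2 ler_wpM2l ?sqr_ge0// field_ip//.
  apply: le_trans (ler_norm _) _; apply: le_trans (C0_decay _ _ _) _.
  by rewrite ler_piMr// decay_le1.
have s0 := sqn_ge0 v; have c0 := sqr_ge0 c.
have r0 : 0 <= row_cst by rewrite /row_cst !mulr_ge0.
apply: (@le_trans _ _ (2 * (row_cst * sqn v) + 2 * (c ^+ 2 * A))).
  by rewrite lerD// ler_wpM2l.
rewrite /comb_cst.
have -> : (2 * row_cst + 2 * A + 1) * (sqn v + c ^+ 2) =
  2 * (row_cst * sqn v) + 2 * (c ^+ 2 * A) +
  (2 * A * sqn v + 2 * row_cst * c ^+ 2 + sqn v + c ^+ 2).
  by ring.
have t1 : 0 <= 2 * A * sqn v by rewrite mulr_ge0// mulr_ge0.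
have t2 : 0 <= 2 * row_cst * c ^+ 2 := mulr_ge0 (mulr_ge0 (ler0n _ 2) r0) c0.
by rewrite lerDl addr_ge0// addr_ge0// addr_ge0.
Qed.

Lemma combination_gaussian n (v : 'cV[R]_(p.+1 * n)) c u : D u ->
  gaussian_rv P (combination v c u).
Proof.
move=> Du.
pose k (i : 'I_(p.+1 * n).+1) : 'I_p.+1 := oapp (fun j => (unpair j).1) ord0 (unlift ord0 i).
pose s (i : 'I_(p.+1 * n).+1) : Rd := oapp (fun j => x (unpair j).2) u (unlift ord0 i).
pose a (i : 'I_(p.+1 * n).+1) : R := oapp (fun j => v j ord0) (- c) (unlift ord0 i).
have Ds i : D (s i) by rewrite /s; case: unlift => //= j; exact: hx_D.
rewrite (_ : combination v c u = fun w => \sum_i a i * Z (k i) (s i) w); last first.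
  apply/funext => w; rewrite /combination /data_comb big_ord_recl /a /k /s.
  rewrite unlift_none /= mulNr addrC.
  by congr (_ + _); apply: eq_bigr => i _; rewrite liftK.
exact: hZ_gauss.
Qed.

Lemma combination_subg n (v : 'cV[R]_(p.+1 * n)) c u s : D u -> 0 < s ->
  comb_cst * (sqn v + c ^+ 2) <= s ^+ 2 -> subg P (combination v c u) (8 * s).
Proof.
move=> Du s0 H; apply: gaussian_subg => //; first exact: combination_gaussian.
by apply: le_trans (combination_second_moment _ _ Du) _; rewrite lee_fin.
Qed.

Lemma field_increment_subg u v s : D u -> D v -> 0 < s ->
  C0 0 ord0 ord0 + C0 0 ord0 ord0 - C0 (v - u) ord0 ord0 - C0 (u - v) ord0 ord0 <= s ^+ 2 ->
  subg P (fun w => Z ord0 u w - Z ord0 v w) (8 * s).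
Proof.
move=> Du Dv s0 H.
have Lu := field_L2 ord0 Du; have Lv := field_L2 ord0 Dv.
apply: gaussian_subg => //.
  have := @hZ_gauss 2%N (fun=> ord0) (fun i => if i == ord0 then u else v)
    (fun i => if i == ord0 then 1 else -1).
  rewrite (_ : (fun w => \sum_i _) = (fun w => Z ord0 u w - Z ord0 v w)); last first.
    by apply/funext => w; rewrite !big_ord_recl big_ord0 /= mul1r mulN1r addr0.
  by apply => i; case: ifP.
rewrite ip_EE ?L2B// lee_fin; apply: le_trans H.
pose X : T -> R := Z ord0 u; pose Y : T -> R := Z ord0 v.
rewrite -[ip _ _]/(ip (fun w => X w - Y w) (fun w => X w - Y w)).
rewrite ipBr ?L2B// ipC ipBr// [ip (fun w => _ - _) Y]ipC ipBr// !field_ip//.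
by rewrite !subrr; lra.
Qed.

End gaussian_combinations.

Section uniform_prediction_gap.
Context (R : realType) (disp : measure_display) (T : measurableType disp).
Variable P : probability T R.
Context (q : nat) (tinf tsup : R).
Hypothesis htheta : tinf < tsup.
Local Notation Rq := 'rV[R]_q.+1.
Local Notation Th := (param_box (q := q.+1) tinf tsup).
Local Notation gmax := (@gmax R q tinf tsup).

(** From [2 * `|x * y| <= k^-1 * x ^+ 2 + k * y ^+ 2]. *)
Lemma EE_gmax_mul (X Y : Rq -> T -> R) (k : R) m : 0 < k ->
  (forall th, Th th -> measurable_fun setT (X th)) ->
  (forall th, Th th -> measurable_fun setT (Y th)) ->
  (EE P (fun w => gmax m (fun th => `|X th w * Y th w|))%R <=
   k^-1%:E * EE P (fun w => gmax m (fun th => X th w ^+ 2))%R +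
   k%:E * EE P (fun w => gmax m (fun th => Y th w ^+ 2))%R)%E.
Proof.
move=> k0 mX mY; have ki : 0 < k^-1 by rewrite invr_gt0.
have mX2 : measurable_fun setT (fun w => gmax m (fun th => X th w ^+ 2)).
  by apply: (measurable_gmax htheta) => th hth; apply: measurable_funX; exact: mX.
have mY2 : measurable_fun setT (fun w => gmax m (fun th => Y th w ^+ 2)).
  by apply: (measurable_gmax htheta) => th hth; apply: measurable_funX; exact: mY.
rewrite -!EEZ//; try (by rewrite ltW); try by move=> w; exact: gmax_ge0.
rewrite -EED; try exact: measurable_funM;
  try by move=> w; rewrite mulr_ge0 ?gmax_ge0// ltW.
apply: le_EE.
- apply: (measurable_gmax htheta) => th hth; apply: measurableT_comp => //.
  by apply: measurable_funM; [exact: mX|exact: mY].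
- by apply: measurable_funD; apply: measurable_funM.
- by move=> w; exact: gmax_ge0.
move=> w; apply: bigmax_le.
  by rewrite addr_ge0// mulr_ge0 ?gmax_ge0// ltW.
move=> j _; set a := X _ w; set b := Y _ w.
have Xle := le_gmax tinf tsup (fun th => X th w ^+ 2) j.
have Yle := le_gmax tinf tsup (fun th => Y th w ^+ 2) j.
rewrite -/a in Xle; rewrite -/b in Yle.
apply: (@le_trans _ _ (k^-1 * a ^+ 2 + k * b ^+ 2)); last first.
  by apply: lerD; apply: ler_wpM2l => //; exact: ltW.
have -> : k^-1 * a ^+ 2 + k * b ^+ 2 = k^-1 * (`|a| ^+ 2 + (k * `|b|) ^+ 2).
  by rewrite exprMn !real_normK ?num_real//; field; rewrite gt_eqF.
rewrite ler_pdivlMl// normrM.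
have -> : `|a| ^+ 2 + (k * `|b|) ^+ 2 =
    (`|a| - k * `|b|) ^+ 2 + k * (`|a| * `|b|) + k * (`|a| * `|b|).
  by ring.
by rewrite lerDr addr_ge0 ?sqr_ge0// !mulr_ge0// ltW.
Qed.


Context (d p : nat).
Local Notation Rd := 'rV[R]_d.+1.
Variables (D : set Rd) (Z : 'I_p.+1 -> Rd -> {RV P >-> R}).
Variables (C0 : Rd -> 'M[R]_p.+1) (x : nat -> Rd).
Hypothesis hZ_gauss : gaussian_process D Z.
Hypothesis hZ_mean : forall k s, D s -> ('E_P[Z k s] = 0)%E.
Hypothesis hZ_cov : forall k l s h, D s -> D (s + h) ->
  covariance P (Z k s) (Z l (s + h)) = (C0 h k l)%:E.
Hypothesis hx_D : forall a, D (x a).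
Variables (A alpha S : R).
Hypothesis A0 : 0 <= A.
Hypothesis C0_decay : forall k l h, `|C0 h k l| <= A * decay alpha h.
Hypothesis S_sum : forall (n : nat) u, \sum_(b < n) decay alpha (u - x b) <= S.

Variables (a b : forall n, Rq -> Rd -> 'cV[R]_(p.+1 * n)) (Wc L : R).
Hypothesis Wc0 : 0 <= Wc.
Hypothesis L0 : 0 < L.
Hypothesis a_bounded : forall n th u, Th th -> sqn (a n th u) <= Wc.
Hypothesis b_bounded : forall n th u, Th th -> sqn (b n th u) <= Wc.
Hypothesis a_lip : forall n th th' u, Th th -> Th th' ->
  sqn (a n th u - a n th' u) <= (L * `|th - th'|) ^+ 2.
Hypothesis b_lip : forall n th th' u, Th th -> Th th' ->
  sqn (b n th u - b n th' u) <= (L * `|th - th'|) ^+ 2.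
Hypothesis ab_small : forall e, 0 < e -> exists N, forall n, (N <= n)%N ->
  forall th u, Th th -> sqn (a n th u - b n th u) <= e.

Local Notation comb := (combination Z x).
Let cc := comb_cst p A S.
Let cc0 : 0 < cc. Proof. exact: comb_cst_gt0 x A alpha S A0 S_sum. Qed.

(** The summand [1] keeps the scales positive. *)
Let root (y : R) := Num.sqrt y + 1.
Let root_gt0 y : 0 < root y. Proof. by rewrite ltr_wpDl// sqrtr_ge0. Qed.
Let root_sqr y : 0 <= y -> y <= root y ^+ 2.
Proof.
move=> y0; rewrite -{1}(sqr_sqrtr y0) lerXn2r ?nnegrE ?sqrtr_ge0//.
  exact: ltW.
by rewrite lerDl.
Qed.

Let lipc := 8 * (root cc * (2 * L)).
Let lipc0 : 0 < lipc. Proof. by rewrite mulr_gt0// mulr_gt0// mulr_gt0. Qed.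

Let comb_lip n (v v' : 'cV[R]_(p.+1 * n)) c u r : D u -> 0 < r ->
  sqn (v - v') <= 4 * (L * r) ^+ 2 ->
  subg P (fun w => comb v c u w - comb v' c u w) (lipc * r).
Proof.
move=> Du r0 H.
rewrite (_ : (fun w => _) = comb (v - v') 0 u); last first.
  by apply/funext => w; rewrite combinationB subrr.
rewrite (_ : lipc * r = 8 * (root cc * (2 * L) * r)); last by rewrite /lipc -mulrA.
apply: (combination_subg (hZ_gauss) hZ_mean hZ_cov hx_D A0 C0_decay S_sum) => //.
  by rewrite !mulr_gt0.
rewrite expr0n /= addr0 -/cc.
apply: le_trans (ler_wpM2l (ltW cc0) H) _.
have -> : (root cc * (2 * L) * r) ^+ 2 = root cc ^+ 2 * (4 * (L * r) ^+ 2) by ring.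
by rewrite ler_wpM2r ?root_sqr ?mulr_ge0 ?sqr_ge0// ltW.
Qed.

Let gap n (th : Rq) (u : Rd) := comb (a n th u - b n th u) 0 u.
Let total n (th : Rq) (u : Rd) := comb (a n th u + b n th u) 2 u.

Let gap_lip n u th th' r : D u -> Th th -> Th th' -> 0 < r -> `|th - th'| <= r ->
  subg P (fun w => gap n th u w - gap n th' u w) (lipc * r).
Proof.
move=> Du hth hth' r0 H; apply: comb_lip => //.
have -> : a n th u - b n th u - (a n th' u - b n th' u) =
    (a n th u - a n th' u) - (b n th u - b n th' u).
  by rewrite !opprB [b n th' u - _]addrC addrACA [- b n th u + _]addrC.
apply: le_trans (sqnB_le _ _) _.
have Hr : (L * `|th - th'|) ^+ 2 <= (L * r) ^+ 2.
  by rewrite lerXn2r ?nnegrE ?mulr_ge0 ?(ltW L0) ?(ltW r0)// ler_wpM2l// ltW.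
have := a_lip n u hth hth'; have := b_lip n u hth hth'; lra.
Qed.

Let total_lip n u th th' r : D u -> Th th -> Th th' -> 0 < r -> `|th - th'| <= r ->
  subg P (fun w => total n th u w - total n th' u w) (lipc * r).
Proof.
move=> Du hth hth' r0 H; apply: comb_lip => //.
rewrite opprD addrACA; apply: le_trans (sqnD_le _ _) _.
have Hr : (L * `|th - th'|) ^+ 2 <= (L * r) ^+ 2.
  by rewrite lerXn2r ?nnegrE ?mulr_ge0 ?(ltW L0) ?(ltW r0)// ler_wpM2l// ltW.
have := a_lip n u hth hth'; have := b_lip n u hth hth'; lra.
Qed.

Let c2 := chain_cst2 q tinf tsup.
Let c20 : 0 <= c2. Proof. exact: chain_cst2_ge0. Qed.
Let c1 m := chain_cst1 R q m.
Let c10 m : 0 <= c1 m. Proof. exact: chain_cst1_ge0. Qed.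

Let total_size := 8 * root (cc * (4 * Wc + 4)).
Let total_bound := c1 0 * total_size ^+ 2 + c2 * lipc ^+ 2 / 2 ^+ 0.

Let EE_total n u m : D u ->
  (EE P (fun w => gmax m (fun th => total n th u w ^+ 2))%R <= total_bound%:E)%E.
Proof.
move=> Du; apply: (chaining htheta (s := total_size) (L := lipc)) => //.
- by rewrite mulr_gt0.
- move=> th hth.
  rewrite -[X in subg P X]/(comb (a n th u + b n th u) 2 u) /total_size.
  apply: (combination_subg (hZ_gauss) hZ_mean hZ_cov hx_D A0 C0_decay S_sum) => //.
  have s1 : sqn (a n th u + b n th u) <= 4 * Wc.
    apply: le_trans (sqnD_le _ _) _.
    have := a_bounded n u hth; have := b_bounded n u hth; lra.
  apply: (@le_trans _ _ (cc * (4 * Wc + 4))).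
    rewrite ler_wpM2l ?(ltW cc0)//; apply: lerD => //.
    by rewrite expr2; lra.
  by rewrite root_sqr// mulr_ge0 ?(ltW cc0)// addr_ge0// mulr_ge0.
- by move=> th th' r hth hth' r0 H; exact: total_lip.
Qed.

Let EE_gap n u m m0 s : D u -> 0 < s ->
  (forall th, Th th -> cc * sqn (a n th u - b n th u) <= s ^+ 2) ->
  (EE P (fun w => gmax m (fun th => gap n th u w ^+ 2))%R <=
    (c1 m0 * (8 * s) ^+ 2 + c2 * lipc ^+ 2 / 2 ^+ m0)%:E)%E.
Proof.
move=> Du s0 Hs; apply: (chaining htheta (s := 8 * s) (L := lipc)) => //.
- by rewrite mulr_gt0.
- move=> th hth.
  rewrite -[X in subg P X]/(comb (a n th u - b n th u) 0 u).
  apply: (combination_subg (hZ_gauss) hZ_mean hZ_cov hx_D A0 C0_decay S_sum) => //.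
  by rewrite expr0n /= addr0; exact: Hs.
- by move=> th th' r hth hth' r0 H; exact: gap_lip.
Qed.

(** The coarse level [m0] of the chain absorbs the Lipschitz constant, which does
    not tend to [0]; the variances only have to be small compared with the cost
    of that fixed level. *)
Let gap_small e : 0 < e -> exists N, forall n, (N <= n)%N -> forall u m, D u ->
  (EE P (fun w => gmax m (fun th => gap n th u w ^+ 2))%R <= e%:E)%E.
Proof.
move=> e0; have e2 : 0 < e / 2 by rewrite divr_gt0.
have y0 : 0 < c2 * lipc ^+ 2 + 1 by rewrite ltr_wpDl// mulr_ge0 ?sqr_ge0.
have [m0 Hm0] := half_pow_small (divr_gt0 e2 y0).
have z0 : 0 < 64 * c1 m0 + 1 by rewrite ltr_wpDl// mulr_ge0.
pose y := e / 2 / (64 * c1 m0 + 1); have yp : 0 < y by rewrite divr_gt0.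
have [N HN] := ab_small (divr_gt0 yp cc0).
exists N => n Nn u m Du; apply: le_trans (EE_gap m m0 (s := Num.sqrt y) Du _ _) _.
- by rewrite sqrtr_gt0.
- move=> th hth; rewrite sqr_sqrtr ?(ltW yp)// mulrC -ler_pdivlMr//; exact: HN.
rewrite lee_fin exprMn sqr_sqrtr ?(ltW yp)//.
have -> : e = e / 2 + e / 2 by lra.
apply: lerD.
  have -> : c1 m0 * (8 ^+ 2 * y) = (e / 2) * ((64 * c1 m0) / (64 * c1 m0 + 1)).
    by rewrite /y; field; rewrite gt_eqF.
  by rewrite ler_piMr ?(ltW e2)// ler_pdivrMr// mul1r lerDl.
apply: (@le_trans _ _ ((c2 * lipc ^+ 2) * (e / 2 / (c2 * lipc ^+ 2 + 1)))).
  by rewrite ler_wpM2l// mulr_ge0 ?sqr_ge0.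
rewrite mulrCA ler_piMr ?(ltW e2)// ler_pdivrMr// mul1r lerDl//.
Qed.

Let gap_mul_total n th u w :
  comb (a n th u) 1 u w ^+ 2 - comb (b n th u) 1 u w ^+ 2 = gap n th u w * total n th u w.
Proof.
rewrite subr_sqr combinationB combinationD subrr.
by rewrite (_ : 1 + 1 = 2 :> R)//; lra.
Qed.

(** The difference of the squared errors factors into a gap between both
    predictions, which is uniformly small, and a quantity with bounded second
    moments. *)
Lemma squared_errors_gap e : 0 < e -> exists N, forall n, (N <= n)%N -> forall u m, D u ->
  (EE P (fun w => gmax m (fun th =>
     `|comb (a n th u) 1 u w ^+ 2 - comb (b n th u) 1 u w ^+ 2|))%R <= e%:E)%E.
Proof.
move=> e0; have e2 : 0 < e / 2 by rewrite divr_gt0.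
have t0 : 0 < total_bound + 1.
  by rewrite ltr_wpDl// addr_ge0// ?divr_ge0//; apply: mulr_ge0 => //; exact: sqr_ge0.
pose k := e / 2 / (total_bound + 1); have k0 : 0 < k by rewrite divr_gt0.
have [N HN] := gap_small (mulr_gt0 k0 e2); exists N => n Nn u m Du.
under eq_EE do under eq_fun do rewrite gap_mul_total.
apply: le_trans (EE_gmax_mul m k0 _ _) _.
- by move=> th _; apply: (combination_measurable hZ_mean hZ_cov hx_D).
- by move=> th _; apply: (combination_measurable hZ_mean hZ_cov hx_D).
have -> : e = e / 2 + e / 2 by lra.
rewrite EFinD; apply: leeD.
  apply: (@le_trans _ _ (k^-1%:E * (k * (e / 2))%:E)%E).
    by apply: lee_wpmul2l; [rewrite lee_fin invr_ge0 ltW|exact: HN].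
  by rewrite -EFinM lee_fin mulKf// gt_eqF.
apply: (@le_trans _ _ (k%:E * total_bound%:E)%E).
  by apply: lee_wpmul2l; [rewrite lee_fin ltW|exact: EE_total].
rewrite -EFinM lee_fin /k mulrAC ler_pdivrMr// ler_wpM2l ?(ltW e2)//.
by rewrite lerDl.
Qed.

End uniform_prediction_gap.

(** * Integrated squared errors *)

Section subgaussian_products.
Context (R : realType) (disp : measure_display) (T : measurableType disp).
Variable P : probability T R.
Local Notation L2 := (Lfun P 2%:E).
Local Notation n2 := (n2 P).
Local Notation K := (subg_const R).

Let K0 : 0 <= K. Proof. by apply: le_trans (subg_const_ge1 R). Qed.

Lemma subg_sqr_L2 X s : 0 < s -> subg P X s ->
  (fun w => X w ^+ 2) \in L2 /\ n2 (fun w => X w ^+ 2) <= 2 * K * s ^+ 2.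
Proof.
move=> s0 [mX sX].
have mX2 : measurable_fun setT (fun w => X w ^+ 2) by exact: measurable_funX.
have E4 : (EE P (fun w => (X w ^+ 2) ^+ 2)%R <= ((2 * K * s ^+ 2) ^+ 2)%:E)%E.
  under eq_EE do rewrite -exprM.
  apply: le_trans (subg_pow4 s0 (conj mX sX)) _; rewrite lee_fin.
  have -> : (2 * K * s ^+ 2) ^+ 2 = (4 * s ^+ 4 * K) * K by ring.
  by rewrite ler_peMr ?subg_const_ge1// mulr_ge0// mulr_ge0// exprn_ge0// ltW.
have L : (fun w => X w ^+ 2) \in L2.
  by apply/L2P; split=> //; apply: le_lt_trans E4 _; rewrite ltry.
by split=> //; apply: n2_le => //; rewrite mulr_ge0 ?sqr_ge0// mulr_ge0.
Qed.

(** Cauchy-Schwarz applied to the squares, which are in [L2]. *)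
Lemma subg_mul_L2 X Y s s' : 0 < s -> 0 < s' -> subg P X s -> subg P Y s' ->
  (fun w => X w * Y w) \in L2 /\ n2 (fun w => X w * Y w) <= 2 * K * (s * s').
Proof.
move=> s0 s'0 sX sY.
have [LX nX] := subg_sqr_L2 s0 sX; have [LY nY] := subg_sqr_L2 s'0 sY.
have mXY : measurable_fun setT (fun w => X w * Y w).
  by apply: measurable_funM; [case: sX|case: sY].
have E4 : (EE P (fun w => (X w * Y w) ^+ 2)%R <= ((2 * K * (s * s')) ^+ 2)%:E)%E.
  have -> : EE P (fun w => (X w * Y w) ^+ 2) =
      (ip P (fun w => X w ^+ 2) (fun w => Y w ^+ 2))%:E.
    rewrite /ip /Rintegral fineK.
      by apply: eq_integral => w _; rewrite exprMn.
    by apply: integrable_fin_num => //; exact: L2_mul_integrable.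
  rewrite lee_fin; apply: le_trans (ler_norm _) _.
  apply: le_trans (cauchy_schwarz LX LY) _.
  have -> : (2 * K * (s * s')) ^+ 2 = (2 * K * s ^+ 2) * (2 * K * s' ^+ 2) by ring.
  by apply: ler_pM => //; exact: n2_ge0.
have L : (fun w => X w * Y w) \in L2.
  by apply/L2P; split=> //; apply: le_lt_trans E4 _; rewrite ltry.
by split=> //; apply: n2_le => //; rewrite !mulr_ge0// ltW.
Qed.

End subgaussian_products.

Lemma data_comb_le (R : realType) (disp : measure_display) (T : measurableType disp)
    (P : probability T R) (d p n : nat) (Z : 'I_p.+1 -> 'rV[R]_d.+1 -> {RV P >-> R})
    (x : nat -> 'rV[R]_d.+1) (v : 'cV[R]_(p.+1 * n)) w :
  `|data_comb Z x v w| <= Num.sqrt (sqn v) *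
    Num.sqrt (\sum_(i < p.+1 * n) Z (unpair i).1 (x (unpair i).2) w ^+ 2).
Proof.
have -> : \sum_(i < p.+1 * n) Z (unpair i).1 (x (unpair i).2) w ^+ 2 = sqn (obs x Z n w).
  by rewrite sqn_col; apply: eq_bigr => i _; rewrite mxE.
have CS := cauchy_schwarz_row v^T (obs x Z n w)^T.
rewrite trmxK !sqn_tr data_combE in CS.
by rewrite -sqrtrM ?sqn_ge0// -sqrtr_sqr ler_wsqrtr.
Qed.

Section error_integrals.
Context (R : realType) (disp : measure_display) (T : measurableType disp).
Variable P : probability T R.
Context (q : nat) (tinf tsup : R).
Hypothesis htheta : tinf < tsup.
Local Notation Rq := 'rV[R]_q.+1.
Local Notation Th := (param_box (q := q.+1) tinf tsup).
Local Notation L2 := (Lfun P 2%:E).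
Local Notation n2 := (n2 P).
Local Notation K := (subg_const R).

Context (d p : nat).
Local Notation Rd := 'rV[R]_d.+1.
Variables (D : set Rd) (Z : 'I_p.+1 -> Rd -> {RV P >-> R}).
Variables (C0 : Rd -> 'M[R]_p.+1) (x : nat -> Rd).
Hypothesis hZ_gauss : gaussian_process D Z.
Hypothesis hZ_mean : forall k s, D s -> ('E_P[Z k s] = 0)%E.
Hypothesis hZ_cov : forall k l s h, D s -> D (s + h) ->
  covariance P (Z k s) (Z l (s + h)) = (C0 h k l)%:E.
Hypothesis hx_D : forall a, D (x a).
Variables (A alpha S : R).
Hypothesis A0 : 0 <= A.
Hypothesis C0_decay : forall k l h, `|C0 h k l| <= A * decay alpha h.
Hypothesis S_sum : forall (n : nat) u, \sum_(b < n) decay alpha (u - x b) <= S.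
Hypothesis C0_cont : {for 0, continuous (fun h => C0 h ord0 ord0)}.

Variables (n : nat) (a : Rq -> Rd -> 'cV[R]_(p.+1 * n)) (Wc L : R).
Hypothesis Wc0 : 0 <= Wc.
Hypothesis L0 : 0 < L.
Hypothesis a_bounded : forall th u, Th th -> sqn (a th u) <= Wc.
Hypothesis a_lip : forall th th' u, Th th -> Th th' ->
  sqn (a th u - a th' u) <= (L * `|th - th'|) ^+ 2.
Hypothesis a_cont : forall th u e, Th th -> 0 < e ->
  exists2 r, 0 < r & forall v, `|u - v| < r -> sqn (a th u - a th v) <= e.

Variables (Dn : set Rd) (f : Rd -> R).
Hypothesis DnD : Dn `<=` D.
Hypothesis mDn : measurable (Dn : set (lebRd R d)).
Hypothesis f_cont : continuous_on Dn f.
Hypothesis f_ge0 : forall u, Dn u -> 0 <= f u.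
Hypothesis f_int1 : (\int[@lebesgue_Rd R d]_(u in Dn) (f u)%:E = 1)%E.

Local Notation comb := (combination Z x).
Let cc := comb_cst p A S.
Let cc0 : 0 < cc. Proof. exact: comb_cst_gt0 x A alpha S A0 S_sum. Qed.

Let G (th : Rq) (u : Rd) (w : T) := comb (a th u) 1 u w ^+ 2 * f u.

Let K0 : 0 <= K. Proof. by apply: le_trans (subg_const_ge1 R). Qed.

Let size := 8 * (Num.sqrt (cc * (Wc + 1)) + 1).
Let size0 : 0 < size. Proof. by rewrite mulr_gt0// ltr_wpDl// sqrtr_ge0. Qed.

Let comb_subg th u : Th th -> D u -> subg P (comb (a th u) 1 u) size.
Proof.
move=> hth Du; have y0 : 0 <= cc * (Wc + 1).
  by rewrite mulr_ge0 ?(ltW cc0)// addr_ge0.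
apply: (combination_subg hZ_gauss hZ_mean hZ_cov hx_D A0 C0_decay S_sum) => //.
apply: (@le_trans _ _ (cc * (Wc + 1))).
  by rewrite expr1n ler_wpM2l ?(ltW cc0)// lerD2r; exact: a_bounded.
rewrite -{1}(sqr_sqrtr y0) lerXn2r ?nnegrE ?addr_ge0 ?sqrtr_ge0//.
by rewrite lerDl.
Qed.

Let G_L2 th u : Th th -> Dn u -> G th u \in L2.
Proof.
move=> hth /DnD Du; have [LX _] := subg_sqr_L2 size0 (comb_subg hth Du).
by rewrite /G; under eq_fun do rewrite mulrC; exact: L2Z.
Qed.

Let hcst := 2 * K * size ^+ 2.
Let hcst0 : 0 <= hcst. Proof. by rewrite !mulr_ge0// sqr_ge0. Qed.

Let G_norm th u : Th th -> Dn u -> n2 (G th u) <= hcst * f u.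
Proof.
move=> hth Du; have [LX nX] := subg_sqr_L2 size0 (comb_subg hth (DnD Du)).
rewrite (@eq_n2 _ _ _ _ _ (fun w => f u * comb (a th u) 1 u w ^+ 2)); last first.
  by move=> w; rewrite /G mulrC.
rewrite n2Z// ger0_norm ?f_ge0// mulrC ler_wpM2r ?f_ge0//.
Qed.

(** Both increments are Gaussian, with variances tending to [0] by continuity of
    the weights and of the covariance. *)
Let increment_subg th u s : Th th -> D u -> 0 < s ->
  exists2 r, 0 < r & forall v, D v -> `|u - v| < r ->
    subg P (comb (a th u - a th v) 0 u) (8 * s) /\
    subg P (fun w => Z ord0 u w - Z ord0 v w) (8 * s).
Proof.
move=> hth Du s0; have s2 : 0 < s ^+ 2 by rewrite exprn_gt0.
have [r1 r10 H1] := a_cont u hth (divr_gt0 s2 cc0).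
have : 0 < s ^+ 2 / 2 by rewrite divr_gt0.
move/(cvgrPdist_lt _ _).1: C0_cont => /[apply] /nbhs_ballP[r2 r20 H2].
exists (Num.min r1 r2); first by rewrite lt_min r10.
move=> v Dv; rewrite lt_min => /andP[h1 h2]; split.
  apply: (combination_subg hZ_gauss hZ_mean hZ_cov hx_D A0 C0_decay S_sum) => //.
  by rewrite expr0n /= addr0 mulrC -ler_pdivlMr//; exact: H1.
apply: (field_increment_subg hZ_gauss hZ_mean hZ_cov) => //.
have /H2 h3 : ball (0 : Rd) r2 (v - u) by rewrite -ball_normE /= sub0r opprB.
have /H2 h4 : ball (0 : Rd) r2 (u - v) by rewrite -ball_normE /= sub0r opprB distrC.
have {}h3 := le_lt_trans (ler_norm _) h3; have {}h4 := le_lt_trans (ler_norm _) h4.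
rewrite /= in h3 h4; lra.
Qed.

Let G_continuous th u e : Th th -> Dn u -> 0 < e ->
  exists2 r, 0 < r & forall v, Dn v -> `|u - v| < r ->
    n2 (fun w => G th u w - G th v w) <= e.
Proof.
move=> hth Dnu e0; have Du := DnD Dnu; have fu0 := f_ge0 Dnu.
have e2 : 0 < e / 2 by rewrite divr_gt0.
pose kap := 64 * K * size * f u + 1.
have kap0 : 0 < kap by rewrite ltr_wpDl// !mulr_ge0// ltW.
pose s := e / 2 / kap; have s0 : 0 < s by rewrite divr_gt0.
have [r1 r10 H1] := increment_subg hth Du s0.
have h1 : 0 < hcst + 1 by rewrite ltr_wpDl.
have [r2 r20 H2] := f_cont Dnu (divr_gt0 e2 h1).
exists (Num.min r1 r2); first by rewrite lt_min r10.
move=> v Dnv; rewrite lt_min => /andP[uv1 uv2]; have Dv := DnD Dnv.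
have [q1 q2] := H1 _ Dv uv1.
pose Q1 : T -> R := comb (a th u - a th v) 0 u.
pose Q2 w := Z ord0 u w - Z ord0 v w.
pose Xu : T -> R := comb (a th u) 1 u; pose Xv : T -> R := comb (a th v) 1 v.
have s8 : 0 < 8 * s by rewrite mulr_gt0.
have su := comb_subg hth Du; have sv := comb_subg hth Dv.
have [l1 b1] := subg_mul_L2 s8 size0 q1 su.
have [l2 b2] := subg_mul_L2 s8 size0 q1 sv.
have [l3 b3] := subg_mul_L2 s8 size0 q2 su.
have [l4 b4] := subg_mul_L2 s8 size0 q2 sv.
have [l5 b5] := subg_sqr_L2 size0 sv.
pose I1 w := (Q1 w * Xu w + Q1 w * Xv w) - (Q2 w * Xu w + Q2 w * Xv w).
have LI1 : I1 \in L2 by apply: L2B; apply: L2D.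
have E w : G th u w - G th v w = f u * I1 w + (f u - f v) * (Xv w ^+ 2).
  rewrite /G /I1 -/(Xu w) -/(Xv w).
  have -> : Q1 w = Xu w - Xv w + Q2 w.
    by rewrite /Q1 /Xu /Xv /Q2 /combination data_combB; ring.
  by ring.
rewrite (eq_n2 _ E).
have nI1 : n2 I1 <= 64 * K * size * s.
  apply: le_trans (n2B (L2D l1 l2) (L2D l3 l4)) _.
  apply: le_trans (lerD (n2D l1 l2) (n2D l3 l4)) _.
  have -> : 64 * K * size * s = (2 * K * (8 * s * size) + 2 * K * (8 * s * size)) +
    (2 * K * (8 * s * size) + 2 * K * (8 * s * size)) by ring.
  by rewrite !lerD.
apply: le_trans (n2D (L2Z _ LI1) (L2Z _ l5)) _.
rewrite !n2Z// (ger0_norm fu0).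
have -> : e = e / 2 + e / 2 by lra.
apply: lerD.
  apply: (@le_trans _ _ (f u * (64 * K * size * s))); first by rewrite ler_wpM2l.
  have -> : f u * (64 * K * size * s) = e / 2 * ((64 * K * size * f u) / kap).
    by rewrite /s; field; rewrite gt_eqF.
  by rewrite ler_piMr ?(ltW e2)// ler_pdivrMr// mul1r lerDl.
apply: (@le_trans _ _ (e / 2 / (hcst + 1) * hcst)).
  by apply: ler_pM => //; [exact: n2_ge0|apply: ltW; exact: H2].
by rewrite mulrAC ler_pdivrMr// ler_wpM2l ?(ltW e2)// lerDl.
Qed.

Let mf : measurable_fun (Dn : set (lebRd R d)) (f : lebRd R d -> R).
Proof. exact: continuous_on_measurable. Qed.

Lemma error_integral_exists th : Th th ->
  exists I, is_L2_integral P (@lebesgue_Rd R d) Dn (G th) I.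
Proof.
move=> hth.
pose ex (k : nat) : set (lebRd R d) := [set y : Rd | `|y| < k%:R].
have mex k : measurable (ex k).
  have -> : ex k = [set y : Rd | `|(0 : Rd) - y| < k%:R].
    by apply/funext => y; rewrite /ex /= sub0r normrN.
  exact: measurable_rv_ball.
have ndex (k m : nat) : (k <= m)%N -> ex k `<=` ex m.
  by move=> km y; rewrite /ex /= => /lt_le_trans; apply; rewrite ler_nat.
have exT u : exists k, ex k u.
  exists (Num.truncn `|(u : Rd)|).+1; rewrite /ex /=.
  by have /andP[] := truncn_itv (normr_ge0 (u : Rd)).
have exfin k : (@lebesgue_Rd R d (ex k) < +oo)%E by exact: lebesgue_Rd_ball.
have mh : measurable_fun (Dn : set (lebRd R d)) ((fun u => hcst * f u) : lebRd R d -> R).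
  by apply: measurable_funM => //; exact: mf.
have hfin : (\int[@lebesgue_Rd R d]_(u in Dn) (hcst * f u)%:E < +oo)%E.
  under eq_integral do rewrite EFinM.
  rewrite ge0_integralZl ?lee_fin//.
  - by rewrite f_int1 mule1 ltry.
  - by apply/measurable_EFinP; exact: mf.
have Gc u : Dn u -> forall e : R, 0 < e -> exists k, cell k u /\
    forall v, Dn v -> cell k v -> n2 (fun w => G th u w - G th v w) <= e.
  move=> Du e e0; have [r r0 Hr] := G_continuous hth Du e0.
  have [k [ku Hk]] := cell_base u r0; exists k; split=> // v Dv kv.
  by apply: Hr => //; exact: Hk.
exact: (L2_integral_exists (@measurable_cell R d) mex ndex exT exfin mDn
  (fun u Du => G_L2 hth Du) mh (fun u Du => G_norm hth Du) hfin Gc).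
Qed.

(** Lipschitz constant of [G] at [u] in the parameter: all the randomness comes
    from the squares of the data and of the predicted variable. *)
Let psi (u : Rd) (w : T) :=
  L * ((2 * Num.sqrt Wc + 1) * (\sum_(i < p.+1 * n) Z (unpair i).1 (x (unpair i).2) w ^+ 2)
    + Z ord0 u w ^+ 2) * `|f u|.
Let M := L * ((2 * Num.sqrt Wc + 1) * ((p.+1 * n)%:R * A) + A).

Let G_lipschitz th th' u w : Th th -> Th th' -> Dn u ->
  `|G th u w - G th' u w| <= `|th - th'| * psi u w.
Proof.
move=> hth hth' Du; rewrite /G -mulrBl normrM /psi mulrA ler_wpM2r//.
rewrite subr_sqr combinationB combinationD subrr normrM.
set rho := \sum_(_ < _) _.
have rho0 : 0 <= rho by apply: sumr_ge0 => i _; exact: sqr_ge0.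
pose s := Num.sqrt rho; have s0 : 0 <= s by exact: sqrtr_ge0.
have sE : s ^+ 2 = rho by rewrite sqr_sqrtr.
have t0 := normr_ge0 (th - th').
have B1 : `|comb (a th u - a th' u) 0 u w| <= L * `|th - th'| * s.
  rewrite /combination mul0r subr0; apply: le_trans (data_comb_le _ _ _ _) _.
  rewrite ler_wpM2r// -[leRHS]ger0_norm ?mulr_ge0 ?(ltW L0)//.
  by rewrite -sqrtr_sqr ler_wsqrtr// a_lip.
have B2 : `|comb (a th u + a th' u) (1 + 1) u w| <= 2 * Num.sqrt Wc * s + 2 * `|Z ord0 u w|.
  rewrite /combination; apply: le_trans (ler_normB _ _) _; apply: lerD.
    apply: le_trans (data_comb_le _ _ _ _) _; rewrite ler_wpM2r//.
    have -> : 2 * Num.sqrt Wc = Num.sqrt (4 * Wc).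
      rewrite sqrtrM//; congr (_ * _).
      by rewrite (_ : 4 = 2 ^+ 2) ?sqrtr_sqr ?ger0_norm//; ring.
    rewrite ler_wsqrtr//; apply: le_trans (sqnD_le _ _) _.
    have := a_bounded u hth; have := a_bounded u hth'; lra.
  by rewrite normrM ger0_norm// ler_wpM2r//; lra.
apply: le_trans (ler_pM (normr_ge0 _) (normr_ge0 _) B1 B2) _.
have -> : L * `|th - th'| * s * (2 * Num.sqrt Wc * s + 2 * `|Z ord0 u w|) =
  L * `|th - th'| * (2 * Num.sqrt Wc * s ^+ 2 + 2 * (s * `|Z ord0 u w|)) by ring.
rewrite [leRHS]mulrA [_ * L]mulrC ler_wpM2l ?mulr_ge0 ?(ltW L0)//.
rewrite -(real_normK (num_real (Z ord0 u w))) -sE; set b := `|Z _ _ _|.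
rewrite -subr_ge0; set W2 := 2 * Num.sqrt Wc.
have -> : (W2 + 1) * s ^+ 2 + b ^+ 2 - (W2 * s ^+ 2 + 2 * (s * b)) = (s - b) ^+ 2 by ring.
exact: sqr_ge0.
Qed.

Let EE_psi u : Dn u -> (EE P (psi u) <= (M * f u)%:E)%E.
Proof.
move=> Dnu; have Du := DnD Dnu; have fu := f_ge0 Dnu.
have mZ k s : measurable_fun setT (fun w => Z k s w ^+ 2).
  by apply: measurable_funX; exact: measurable_funPT.
have EZ k s : D s -> (EE P (fun w => Z k s w ^+ 2)%R <= A%:E)%E.
  move=> Ds; rewrite (ip_EE (field_L2 hZ_mean hZ_cov k Ds)) lee_fin (field_ip hZ_mean hZ_cov)//.
  apply: le_trans (ler_norm _) _; apply: le_trans (C0_decay _ _ _) _.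
  by rewrite ler_piMr// decay_le1.
have mrho : measurable_fun setT
    (fun w => \sum_(i < p.+1 * n) Z (unpair i).1 (x (unpair i).2) w ^+ 2).
  by apply: measurable_sum => i; exact: mZ.
have rho0 w : 0 <= \sum_(i < p.+1 * n) Z (unpair i).1 (x (unpair i).2) w ^+ 2.
  by apply: sumr_ge0 => i _; exact: sqr_ge0.
have Wp : 0 <= 2 * Num.sqrt Wc + 1 by rewrite addr_ge0// mulr_ge0// sqrtr_ge0.
have psiE : psi u =1 fun w => (L * f u) * ((2 * Num.sqrt Wc + 1) *
    (\sum_(i < p.+1 * n) Z (unpair i).1 (x (unpair i).2) w ^+ 2) + Z ord0 u w ^+ 2).
  by move=> w; rewrite /psi ger0_norm// mulrAC.
rewrite (eq_EE _ psiE) EEZ//; last first.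
- by rewrite mulr_ge0// ltW.
- by move=> w; rewrite addr_ge0 ?sqr_ge0// mulr_ge0.
- by apply: measurable_funD => //; exact: measurable_funM.
rewrite EED//; last first.
- by move=> w; exact: sqr_ge0.
- by move=> w; rewrite mulr_ge0.
- exact: measurable_funM.
rewrite EEZ// EE_sum//; last by move=> i w; exact: sqr_ge0.
have -> : M * f u = (L * f u) * ((2 * Num.sqrt Wc + 1) * ((p.+1 * n)%:R * A) + A).
  by rewrite /M mulrAC.
rewrite [leRHS]EFinM; apply: lee_wpmul2l; first by rewrite lee_fin mulr_ge0// ltW.
rewrite [leRHS]EFinD; apply: leeD; last exact: EZ.
rewrite [leRHS]EFinM; apply: lee_wpmul2l; first by rewrite lee_fin.
apply: (@le_trans _ _ (\sum_(i < p.+1 * n) A%:E)%E).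
  by apply: lee_sum => i _; apply: EZ; exact: hx_D.
by rewrite sumEFin sumr_const card_ord mulr_natl.
Qed.

Lemma error_integral_continuous_version : exists I : Rq -> T -> R,
  (forall th, Th th -> is_L2_integral P (@lebesgue_Rd R d) Dn (G th) (I th)) /\
  (forall w, {within Th, continuous (fun th => I th w)}).
Proof.
have GI th : exists I, Th th -> is_L2_integral P (@lebesgue_Rd R d) Dn (G th) I.
  have [hth|nth] := pselect (Th th); last by exists (fun=> 0).
  by have [I HI] := error_integral_exists hth; exists I.
have [I HI] := choice GI.
have Wp : 0 <= 2 * Num.sqrt Wc + 1 by rewrite addr_ge0// mulr_ge0// sqrtr_ge0.
have mpsi u : Dn u -> measurable_fun setT (psi u).
  move=> Du; apply: measurable_funM => //; apply: measurable_funM => //.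
  apply: measurable_funD; last by apply: measurable_funX; exact: measurable_funPT.
  apply: measurable_funM => //; apply: measurable_sum => i.
  by apply: measurable_funX; exact: measurable_funPT.
have psi0 u w : 0 <= psi u w.
  rewrite mulr_ge0// mulr_ge0 ?(ltW L0)// addr_ge0 ?sqr_ge0// mulr_ge0//.
  by apply: sumr_ge0 => i _; exact: sqr_ge0.
have M0 : 0 <= M.
  by rewrite mulr_ge0 ?(ltW L0)// addr_ge0// mulr_ge0// mulr_ge0.
exact: (@L2_integral_continuous_version _ _ _ P _ (lebRd R d) (@lebesgue_Rd R d) _ _ _
  htheta Dn G psi f M mDn mpsi G_lipschitz psi0 EE_psi M0 mf f_ge0 f_int1 I HI).
Qed.

End error_integrals.

(** * Conclusion *)

Section integral_gap.
Context (R : realType) (disp : measure_display) (T : measurableType disp).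
Variable P : probability T R.
Context (dU : measure_display) (U : measurableType dU).
Variable mu : {measure set U -> \bar R}.
Context (q : nat) (tinf tsup : R).
Hypothesis htheta : tinf < tsup.
Local Notation Rq := 'rV[R]_q.+1.
Local Notation Th := (param_box (q := q.+1) tinf tsup).
Local Notation gmax := (@gmax R q tinf tsup).

(** Both families of integrals are treated as one, indexed by a grid point and a
    boolean, and [al] takes the differences. *)
Lemma integral_gap_le (D : set U) (G G' : Rq -> U -> T -> R) (I I' : Rq -> T -> R)
    (f : U -> R) (e : R) m :
  measurable D -> (forall th, Th th -> is_L2_integral P mu D (G th) (I th)) ->
  (forall th, Th th -> is_L2_integral P mu D (G' th) (I' th)) ->
  measurable_fun D f -> (forall u, D u -> 0 <= f u) ->
  (\int[mu]_(u in D) (f u)%:E = 1)%E -> 0 <= e ->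
  (forall u, D u ->
    (EE P (fun w => gmax m (fun th => `|G th u w - G' th u w|))%R <= (e * f u)%:E)%E) ->
  (EE P (fun w => gmax m (fun th => `|I th w - I' th w|))%R <= e%:E)%E.
Proof.
move=> mD HI HI' mf f0 f1 e0 H.
pose gp (k : gidx q m) := gpt tinf tsup k.
have hgp k : Th (gp k) by exact: gpt_in.
pose L : finType := (gidx q m * bool)%type.
pose al (k : gidx q m) (l : L) : R := (l.1 == k)%:R * (if l.2 then 1 else -1).
have sumE k (F F' : Rq -> R) :
    \sum_l al k l * (if l.2 then F (gp l.1) else F' (gp l.1)) = F (gp k) - F' (gp k).
  rewrite -(pair_bigA _ (fun j b => al k (j, b) * (if b then F (gp j) else F' (gp j)))) /=.
  rewrite (bigD1 k)//= [X in _ + X]big1 ?addr0; last first.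
    by move=> j /negbTE jk; rewrite big_bool /al /= jk !mul0r addr0.
  by rewrite big_bool /al /= eqxx !mul1r mulN1r.
have HL (l : L) : is_L2_integral P mu D
    (fun u w => if l.2 then G (gp l.1) u w else G' (gp l.1) u w)
    (fun w => if l.2 then I (gp l.1) w else I' (gp l.1) w).
  by case: l => j [] /=; [exact: HI|exact: HI'].
have := L2_integral_max (alpha := al) mD HL mf f0 f1 e0.
under eq_EE do under eq_bigr do rewrite (sumE _ (fun th => I th _) (fun th => I' th _)).
apply=> u Du; apply: le_trans (H u Du).
rewrite le_eqVlt; apply/orP; left; apply/eqP; apply: eq_EE => w; apply: eq_bigr => k _.
by rewrite (sumE _ (fun th => G th u w) (fun th => G' th u w)).
Qed.

End integral_gap.

Lemma continuous_rescale (R : realType) (d : nat) (g : 'rV[R]_d.+1 -> R) (c : R) :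
  continuous g -> continuous (fun h : 'rV[R]_d.+1 => g (c *: h)).
Proof.
move=> cg u; have FF : Filter (nbhs u) by exact: nbhs_filter.
apply/(@cvgrPdist_lt _ _ _ _ FF) => e e0.
have /cvgrPdist_lt/(_ _ e0)/nbhs_ballP[r r0 H] := cg (c *: u).
have c1 : 0 < `|c| + 1 by rewrite ltr_wpDl.
apply/nbhs_ballP; exists (r / (`|c| + 1)) => /=; first exact: divr_gt0.
move=> v; rewrite -ball_normE /= ltr_pdivlMr// => uv.
apply: H; rewrite -ball_normE /= -scalerBr normrZ; apply: le_lt_trans uv.
by rewrite mulrC ler_wpM2l// lerDl.
Qed.

Section predictors.
Context (R : realType) (disp : measure_display) (T : measurableType disp).
Variable P : probability T R.
Context (d p : nat).
Local Notation Rd := 'rV[R]_d.+1.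
Variables (Z : 'I_p.+1 -> Rd -> {RV P >-> R}) (x : nat -> Rd) (n : nat).

Lemma prediction_error delta (r : Rd -> 'M[R]_p.+1) u w :
  coercive delta (kernel_mx x n r) ->
  ((kernel_vec x n r u)^T *m invmx (kernel_mx x n r) *m obs x Z n w) ord0 ord0
    - Z ord0 u w = combination Z x (weights x n r u) 1 u w.
Proof.
by move=> cr; rewrite (invmx_coercive_tr _ _ cr) data_combE /combination mul1r.
Qed.

Lemma kernel_vec_continuous (r : Rd -> 'M[R]_p.+1) u e :
  (forall k l, continuous (fun h => r h k l)) -> 0 < e ->
  exists2 c, 0 < c & forall v, `|u - v| < c ->
    sqn (kernel_vec x n r u - kernel_vec x n r v) <= e.
Proof.
move=> cr e0.
pose F (i : 'I_(p.+1 * n)) v := r (v - x (unpair i).2) ord0 (unpair i).1.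
have FF : Filter (nbhs u) by exact: nbhs_filter.
have cF i : {for u, continuous (F i)}.
  apply/(@cvgrPdist_lt _ _ _ _ FF) => e1 e10.
  have /cvgrPdist_lt/(_ _ e10)/nbhs_ballP[c c0 H] := cr ord0 (unpair i).1 (u - x (unpair i).2).
  apply/nbhs_ballP; exists c => // v; rewrite -ball_normE /= => uv.
  by apply: H; rewrite -ball_normE /= opprB addrA subrK.
have cs : {for u, continuous (fun v => \sum_i (F i u - F i v) ^+ 2)}.
  apply: cvg_sumR => i; under eq_fun do rewrite expr2; rewrite expr2.
  by apply: cvgM; apply: cvgB; [exact: cvg_cst|exact: cF|exact: cvg_cst|exact: cF].
have /nbhs_ballP[c c0 H] := (@cvgrPdist_lt _ _ _ _ FF _ _).1 cs _ e0; exists c => // v uv.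
have := H v; rewrite -ball_normE => /(_ uv) /=.
rewrite [X in `|X - _|]big1 => [|i _]; last by rewrite subrr expr0n.
rewrite sub0r normrN => /ltW h.
apply: le_trans h; apply: le_trans (ler_norm _).
by rewrite sqn_col le_eqVlt; apply/orP; left; apply/eqP/eq_bigr => i _; rewrite !mxE.
Qed.

Lemma weights_continuous delta (r : Rd -> 'M[R]_p.+1) u e : 0 < delta ->
  coercive delta (kernel_mx x n r) ->
  (forall k l, continuous (fun h => r h k l)) -> 0 < e ->
  exists2 c, 0 < c & forall v, `|u - v| < c ->
    sqn (weights x n r u - weights x n r v) <= e.
Proof.
move=> d0 cr kr e0; have ed : 0 < e * delta ^+ 2 by rewrite mulr_gt0// exprn_gt0.
have [c c0 H] := kernel_vec_continuous u kr ed; exists c => // v /H h.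
apply: le_trans (weights_space_dist d0 _ _ cr) _.
by rewrite ler_pdivrMr// exprn_gt0.
Qed.

Lemma combination_lipschitz (q : nat) (Th : set 'rV[R]_q.+1) (L : R)
    (a : 'rV[R]_q.+1 -> 'cV[R]_(p.+1 * n)) (g : 'rV[R]_q.+1 -> R) c u w : 0 <= L ->
  (forall th th', Th th -> Th th' -> sqn (a th - a th') <= (L * `|th - th'|) ^+ 2) ->
  (forall th, Th th -> g th = combination Z x (a th) c u w) ->
  {within Th, continuous g}.
Proof.
move=> L0 aL gE.
pose s := Num.sqrt (\sum_(i < p.+1 * n) Z (unpair i).1 (x (unpair i).2) w ^+ 2).
apply: (lipschitz_within_continuous (B := L * s)) => th th' hth hth'.
rewrite !gE// combinationB subrr /combination mul0r subr0.
apply: le_trans (data_comb_le _ _ _ _) _; rewrite -/s mulrAC ler_wpM2r ?sqrtr_ge0//.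
rewrite -[leRHS]ger0_norm ?mulr_ge0// -sqrtr_sqr ler_wsqrtr//; exact: aL.
Qed.

End predictors.

(* The dimensions of the paper are d.+1, p.+1 and q.+1, hence at least 1. *)
Theorem theorem3 (R : realType) (d p q : nat)
  (disp : measure_display) (Omega : measurableType disp)
  (P : probability Omega R)
  (D : set 'rV[R]_d.+1)
  (Z : 'I_p.+1 -> 'rV[R]_d.+1 -> {RV P >-> R})
  (tinf tsup : R)
  (C : 'rV[R]_d.+1 -> 'rV[R]_q.+1 -> 'M[R]_p.+1)
  (theta0 : 'rV[R]_q.+1)
  (t : 'rV[R]_d.+1 -> 'M[R]_p.+1)
  (x : nat -> 'rV[R]_d.+1)
  (gamma : nat -> R)
  (htheta : tinf < tsup)
  (hZ_gauss : gaussian_process D Z)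
  (hZ_mean : forall k s, D s -> ('E_P[Z k s] = 0)%E)
  (hC_cov : forall th, param_box tinf tsup th ->
     stationary_covariance (fun h => C h th))
  (htheta0 : forall i, tinf < theta0 ord0 i < tsup)
  (hZ_cov : forall k l s h, D s -> D (s + h) ->
     covariance P (Z k s) (Z l (s + h)) = (C h theta0 k l)%:E)
  (ht_cov : stationary_covariance t)
  (ht_supp : forall h k l, 1 <= enorm h -> t h k l = 0)
  (hx_D : forall a, D (x a))
  (hgamma : forall n, 0 < gamma n)
  (h_smooth : smoothness_decay C (param_box tinf tsup))
  (h_taper : taper_condition t gamma)
  (h_dist : minimal_distance x)
  (h_eig : minimal_eigenvalue C t x gamma (param_box tinf tsup)) :
  (forall xnew : nat -> 'rV[R]_d.+1, (forall n, D (xnew n)) ->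
     op1 P (fun n w => ereal_sup
       [set `|sq_err C x Z n th (xnew n) w
              - sq_err_taper C t x gamma Z n th (xnew n) w|%:E
       | th in param_box tinf tsup]))
  /\
  ((forall th k l, param_box tinf tsup th ->
      continuous (fun u => C u th k l)) ->
   (forall k l, continuous (fun u => t u k l)) ->
   forall (Dn : nat -> set 'rV[R]_d.+1) (f : nat -> 'rV[R]_d.+1 -> R),
     (forall n, Dn n `<=` D) ->
     (forall n, measurable (Dn n : set (lebRd R d))) ->
     (forall n, (0 < lebesgue_Rd (Dn n))%E) ->
     (forall n, {within Dn n, continuous (f n)}) ->
     (forall n u, Dn n u -> 0 <= f n u) ->
     (forall n, (\int[@lebesgue_Rd R d]_(u in Dn n) (f n u)%:E = 1)%E) ->
     (forall n,
        (exists I, int_err P (param_box tinf tsup) (sq_err C x Z n)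
                     (Dn n) (f n) I) /\
        (exists J, int_err P (param_box tinf tsup)
                     (sq_err_taper C t x gamma Z n) (Dn n) (f n) J)) /\
     forall I J : nat -> 'rV[R]_q.+1 -> Omega -> R,
       (forall n, int_err P (param_box tinf tsup) (sq_err C x Z n)
                    (Dn n) (f n) (I n)) ->
       (forall n, int_err P (param_box tinf tsup)
                    (sq_err_taper C t x gamma Z n) (Dn n) (f n) (J n)) ->
       op1 P (fun n w => ereal_sup
         [set `|I n th w - J n th w|%:E | th in param_box tinf tsup])).
Proof.
have [h_C1 [A [alpha [alpha0 h_bounds]]]] := h_smooth.
have [Delta [Delta0 h_sep]] := h_dist.
have [delta [delta0 h_lambda]] := h_eig.
pose Th := param_box (q := q.+1) tinf tsup.
have hth0 : Th theta0.
  by move=> i; have /andP[/ltW -> /ltW ->] := htheta0 i.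
have C_decay k l u th : Th th -> `|C u th k l| <= A * decay alpha u.
  by move=> hth; case: (h_bounds k l ord0 u th hth).
have dC_decay k l i u th : Th th ->
    `|partial_on Th (fun th => C u th k l) i th| <= A * decay alpha u.
  by move=> hth; case: (h_bounds k l i u th hth).
have sep (a b : nat) : a != b -> Delta <= `|x a - x b|.
  move=> ab; have la : (a < (maxn a b).+1)%N by rewrite ltnS leq_maxl.
  have lb : (b < (maxn a b).+1)%N by rewrite ltnS leq_maxr.
  by have := h_sep _ (Ordinal la) (Ordinal lb) ab.
have eigS n th : (0 < n)%N -> Th th -> delta <= lambda (Sigma C x n th) (p.+1 * n).
  by move=> n0 hth; case: (h_lambda n th n0 hth).
have eigK n th : (0 < n)%N -> Th th -> delta <= lambda (K C t x gamma n th) (p.+1 * n).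
  by move=> n0 hth; case: (h_lambda n th n0 hth).
have S_sum := lattice_sum_le Delta0 sep alpha0.
set S := lattice_cst _ _ _ in S_sum.
have A0 : 0 <= A := A_ge0 htheta C_decay.
have S0 : 0 <= S := S_ge0 S_sum.
pose a n (th : 'rV[R]_q.+1) u := weights x n (fun h => C h th) u.
pose b n (th : 'rV[R]_q.+1) u := weights x n (tapered C t gamma n th) u.
have cohS n th : Th th -> coercive delta (kernel_mx x n (fun h => C h th)).
  exact: (Sigma_coercive hC_cov Delta0 sep delta0 eigS).
have cohK n th : Th th -> coercive delta (kernel_mx x n (tapered C t gamma n th)).
  exact: (K_coercive hC_cov ht_cov hgamma Delta0 sep delta0 eigK).
have admC n := C_admissible hC_cov h_C1 C_decay dC_decay Delta0 sep delta0 eigS n.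
have admK n := tapered_admissible hC_cov ht_cov hgamma h_taper h_C1 C_decay dC_decay
  Delta0 sep delta0 eigK n.
pose Wc := weight_cst p A delta S.
pose L := weight_lip p q A delta S.
have Wc0 : 0 <= Wc by exact: (weight_cst_ge0 htheta C_decay S_sum delta0).
have L0 : 0 < L by exact: weight_lip_gt0.
have a_bd n th u : Th th -> sqn (a n th u) <= Wc.
  exact: (weights_bounded htheta C_decay S_sum delta0 _ (admC n)).
have b_bd n th u : Th th -> sqn (b n th u) <= Wc.
  exact: (weights_bounded htheta C_decay S_sum delta0 _ (admK n)).
have a_lip n th th' u : Th th -> Th th' ->
    sqn (a n th u - a n th' u) <= (L * `|th - th'|) ^+ 2.
  exact: (weights_lipschitz htheta C_decay S_sum delta0 _ (admC n)).
have b_lip n th th' u : Th th -> Th th' ->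
    sqn (b n th u - b n th' u) <= (L * `|th - th'|) ^+ 2.
  exact: (weights_lipschitz htheta C_decay S_sum delta0 _ (admK n)).
have ab_small e : 0 < e -> exists N, forall n, (N <= n)%N ->
    forall th u, Th th -> sqn (a n th u - b n th u) <= e.
  exact: (weights_taper_small htheta hC_cov ht_cov hgamma h_taper h_C1 alpha0
    C_decay dC_decay Delta0 sep S_sum delta0 eigS eigK).
(* the true covariances enter through second moments only *)
pose C0 h := C h theta0.
have C0_decay k l h : `|C0 h k l| <= A * decay alpha h by exact: C_decay.
have gap e : 0 < e -> exists N, forall n, (N <= n)%N -> forall u m, D u -> _ :=
  squared_errors_gap htheta hZ_gauss hZ_mean hZ_cov hx_D A0 C0_decay S_sum
    Wc0 L0 a_bd b_bd a_lip b_lip ab_small (e := e).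
have errE n th u w : Th th -> sq_err C x Z n th u w = combination Z x (a n th u) 1 u w ^+ 2.
  by move=> hth; rewrite /sq_err (prediction_error _ _ _ (cohS n th hth)).
have errKE n th u w : Th th ->
    sq_err_taper C t x gamma Z n th u w = combination Z x (b n th u) 1 u w ^+ 2.
  move=> hth; rewrite /sq_err_taper k_vec_kernel K_kernel.
  by rewrite (prediction_error _ _ _ (cohK n th hth)).
have gap_err e : 0 < e -> exists N, forall n, (N <= n)%N -> forall u m, D u ->
    (EE P (fun w => gmax tinf tsup m (fun th =>
      `|sq_err C x Z n th u w - sq_err_taper C t x gamma Z n th u w|))%R <= e%:E)%E.
  move=> /gap[N HN]; exists N => n Nn u m Du; apply: le_trans (HN n Nn u m Du).
  rewrite le_eqVlt; apply/orP; left; apply/eqP; apply: eq_EE => w.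
  by apply: eq_bigr => k _; rewrite errE ?errKE//; exact: gpt_in.
split.
  move=> xnew Dxnew; apply: (op1_sup htheta).
  - move=> n th hth.
    rewrite (_ : (fun w => _) = (fun w => combination Z x (a n th (xnew n)) 1 (xnew n) w ^+ 2
      - combination Z x (b n th (xnew n)) 1 (xnew n) w ^+ 2)); last first.
      by apply/funext => w; rewrite errE// errKE.
    apply: measurable_funB; apply: measurable_funX;
      exact: (combination_measurable hZ_mean hZ_cov hx_D).
  - move=> n w.
    have c1 : {within Th, continuous (fun th =>
        ((sigma_vec C x n th (xnew n))^T *m invmx (Sigma C x n th) *m obs x Z n w) ord0 ord0
          - Z ord0 (xnew n) w)}.
      apply: (combination_lipschitz (ltW L0) (fun th th' => a_lip n th th' (xnew n))).
      by move=> th hth; exact: (prediction_error _ _ _ (cohS n th hth)).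
    have c2 : {within Th, continuous (fun th =>
        ((k_vec C t x gamma n th (xnew n))^T *m invmx (K C t x gamma n th) *m obs x Z n w) ord0 ord0
          - Z ord0 (xnew n) w)}.
      apply: (combination_lipschitz (ltW L0) (fun th th' => b_lip n th th' (xnew n))).
      move=> th hth; rewrite k_vec_kernel K_kernel.
      exact: (prediction_error _ _ _ (cohK n th hth)).
    rewrite /sq_err /sq_err_taper => th.
    apply: cvgB.
      by under eq_fun do rewrite expr2; rewrite expr2; apply: cvgM; exact: c1.
    by under eq_fun do rewrite expr2; rewrite expr2; apply: cvgM; exact: c2.
  - move=> e /gap_err[N HN]; exists N => n Nn m; exact: HN.
move=> C_cont t_cont Dn f DnD mDn Dn_gt0 f_cont f_ge0 f_int1.
have fc n : continuous_on (Dn n) (f n).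
  by move=> u Du e e0; exact: continuous_within_dist.
have mf n : measurable_fun (Dn n : set (lebRd R d)) (f n : lebRd R d -> R).
  exact: continuous_on_measurable.
have C0_cont : {for 0, continuous (fun h => C0 h ord0 ord0)} by exact: C_cont.
have tapered_cont n th k l : Th th -> continuous (fun h => tapered C t gamma n th h k l).
  move=> hth u.
  rewrite (_ : (fun h => _) = (fun h => C h th k l * t ((gamma n)^-1 *: h) k l)); last first.
    by apply/funext => h; rewrite mxE.
  apply: (@continuousM R _ (fun h => C h th k l) (fun h => t ((gamma n)^-1 *: h) k l)).
    exact: (C_cont th k l hth).
  exact: (@continuous_rescale R d (fun h => t h k l) (gamma n)^-1 (t_cont k l) u).
split.
  move=> n.
  have a_cont th u e : Th th -> 0 < e ->
      exists2 r, 0 < r & forall v, `|u - v| < r -> sqn (a n th u - a n th v) <= e.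
    move=> hth; apply: (weights_continuous u delta0 (cohS n th hth)) => k l.
    exact: C_cont.
  have b_cont th u e : Th th -> 0 < e ->
      exists2 r, 0 < r & forall v, `|u - v| < r -> sqn (b n th u - b n th v) <= e.
    move=> hth; apply: (weights_continuous u delta0 (cohK n th hth)) => k l.
    exact: tapered_cont.
  split.
    have [I [HI cI]] := error_integral_continuous_version htheta hZ_gauss hZ_mean hZ_cov
      hx_D A0 C0_decay S_sum C0_cont Wc0 L0 (a_bd n) (a_lip n) a_cont (DnD n) (mDn n)
      (fc n) (f_ge0 n) (f_int1 n).
    exists I; split=> // th hth.
    rewrite (_ : (fun u w => _) = (fun u w => combination Z x (a n th u) 1 u w ^+ 2 * f n u)).
      exact: HI.
    by apply/funext => u; apply/funext => w; rewrite errE.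
  have [I [HI cI]] := error_integral_continuous_version htheta hZ_gauss hZ_mean hZ_cov
    hx_D A0 C0_decay S_sum C0_cont Wc0 L0 (b_bd n) (b_lip n) b_cont (DnD n) (mDn n)
    (fc n) (f_ge0 n) (f_int1 n).
  exists I; split=> // th hth.
  rewrite (_ : (fun u w => _) = (fun u w => combination Z x (b n th u) 1 u w ^+ 2 * f n u)).
    exact: HI.
  by apply/funext => u; apply/funext => w; rewrite errKE.
move=> I J HI HJ; apply: (op1_sup htheta).
- move=> n th hth; have [iI _] := HI n; have [iJ _] := HJ n.
  have [_ [LI _]] := iI th hth; have [_ [LJ _]] := iJ th hth.
  by apply: measurable_funB; [exact: (L2_measurable LI)|exact: (L2_measurable LJ)].
- move=> n w th; have [_ cI] := HI n; have [_ cJ] := HJ n.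
  by apply: cvgB; [exact: cI|exact: cJ].
- move=> e e0; have [N HN] := gap_err e e0; exists N => n Nn m.
  have [iI _] := HI n; have [iJ _] := HJ n.
  apply: (integral_gap_le (U := lebRd R d) (mu := @lebesgue_Rd R d) htheta (mDn n) iI iJ
    (mf n) (f_ge0 n) (f_int1 n) (ltW e0)) => u Du.
  have fu := f_ge0 n u Du; have Du' := DnD n u Du.
  have mdiff th : Th th -> measurable_fun setT
      (fun w => sq_err C x Z n th u w - sq_err_taper C t x gamma Z n th u w).
    move=> hth.
    rewrite (_ : (fun w => _) = (fun w => combination Z x (a n th u) 1 u w ^+ 2
      - combination Z x (b n th u) 1 u w ^+ 2)); last first.
      by apply/funext => w; rewrite errE// errKE.
    apply: measurable_funB; apply: measurable_funX;
      exact: (combination_measurable hZ_mean hZ_cov hx_D).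
  have mg : measurable_fun setT (fun w => gmax tinf tsup m (fun th =>
      `|sq_err C x Z n th u w - sq_err_taper C t x gamma Z n th u w|)).
    by apply: (measurable_gmax htheta) => th hth; apply: measurableT_comp => //; exact: mdiff.
  apply: (@le_trans _ _ (EE P (fun w => f n u * gmax tinf tsup m (fun th =>
      `|sq_err C x Z n th u w - sq_err_taper C t x gamma Z n th u w|))%R)).
    apply: le_EE.
    + apply: (measurable_gmax htheta) => th hth; apply: measurableT_comp => //.
      under eq_fun do rewrite -mulrBl.
      by apply: measurable_funM => //; exact: mdiff.
    + exact: measurable_funM.
    + by move=> w; exact: gmax_ge0.
    + move=> w; apply: bigmax_le; first by rewrite mulr_ge0// gmax_ge0.
      move=> k _; rewrite -mulrBl normrM (ger0_norm fu) mulrC ler_wpM2l//.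
      exact: (le_gmax tinf tsup (fun th =>
        `|sq_err C x Z n th u w - sq_err_taper C t x gamma Z n th u w|) k).
  rewrite EEZ//; last by move=> w; exact: gmax_ge0.
  by rewrite mulrC EFinM; apply: lee_wpmul2l => //; exact: HN.
Qed.
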